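(* Let the action of a right amenable semitopological semigroup $G$ on $K$ be uniquely ergodic with invariant probability measure $\mu$, let $N\in\mathbb N$ and let $\mathcal S$ and $\mathcal S_2$ be the corresponding Koopman representations on $C(K,\mathbb C^N)$ and $L^2(K,\mathbb C^N,\mu)$, respectively. Let $Z$ be a compact subgroup of $U(N)$, assume that $\Lambda\subseteq\Gamma(G\times K,Z)$ is compact, and consider the semigroups $\gamma\mathcal S$ on $C(K,\mathbb C^N)$ for $\gamma\in\Lambda$. If $\{(A_\alpha^{\gamma\mathcal S})_{\alpha\in\mathcal A}:\gamma\in\Lambda\}$ is a uniform family of right ergodic nets on $C(K,\mathbb C^N)$ and if $f\in C(K,\mathbb C^N)$ satisfies (1) $P_{\operatorname{Fix}\gamma\mathcal S_2}f\in\operatorname{Fix}\gamma\mathcal S$ for each $\gamma\in\Lambda$ (i.e. it has a representative in $\operatorname{Fix}\gamma\mathcal S$), and (2) $\Lambda\to\mathbb R_+$, $\gamma\mapsto\|A_\alpha^{\gamma\mathcal S}f-P_\gamma f\|$ is continuous for each $\alpha\in\mathcal A$, then $$\lim_\alpha\sup_{\gamma\in\Lambda}\|A_\alpha^{\gamma\mathcal S}f-P_\gamma f\|=0.$$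
   Context: $K$ is a compact (Hausdorff) space; $C(K,\mathbb C^N)$ is the space of continuous $\mathbb C^N$-valued functions with norm $\|f\|=\sup_{x\in K}\|f(x)\|_2$ ($\|\cdot\|_2$ Euclidean). $\mathscr L(X)$ carries the strong operator topology, in which closures are taken. $U(N)$ is the group of unitary operators on $\mathbb C^N$. A semitopological semigroup is a semigroup with a topology making multiplication separately continuous. $G$ is right amenable if there is $m\in C_b(G)'$ with $\langle m,\mathbf 1\rangle=\|m\|=1$ and $\langle m,R_gf\rangle=\langle m,f\rangle$ for all $g\in G,f\in C_b(G)$, where $R_gf(h)=f(hg)$. A (semigroup) action of $G$ on $K$ is a continuous map $G\times K\to K$, $(g,x)\mapsto gx$, with $(g_1g_2)x=g_1(g_2x)$. It is uniquely ergodic if there is a unique $G$-invariant probability measure $\mu$ on $K$ ($\mu(A)=\mu(\{x:gx\in A\})$ for all Borel $A$, $g\in G$). The Koopman representation on $C(K,\mathbb C^N)$ is $\mathcal S=\{S_g\}$, $S_gf(x)=f(gx)$; $\mathcal S_2$ is its extension to $L^2(K,\mathbb C^N,\mu)$. A continuous cocycle into a topological group $\Omega$ is a continuous $\gamma:G\times K\to\Omega$ with $\gamma(g_1g_2,x)=\gamma(g_2,x)\gamma(g_1,g_2x)$; $\Gamma(G\times K,\Omega)$ is the set of these. If $\Omega$ is a compact metric group with metric $d$, $\Gamma(G\times K,\Omega)$ carries the metric $\tilde d(\gamma_1,\gamma_2)=\sup_{(g,x)\in G\times K}d(\gamma_1(g,x),\gamma_2(g,x))$. For $\gamma$ with values in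 $U(N)$, $\gamma\mathcal S=\{\gamma(g,\cdot)S_g\}$, $\gamma(g,\cdot)S_gf(x)=\gamma(g,x)f(gx)$, with $\gamma\mathcal S_2$ the analogue on $L^2(K,\mathbb C^N,\mu)$. $\operatorname{Fix}$ denotes the space of common fixed points; $P_H$ is the orthogonal projection onto $H$. Under (1) the semigroup $\gamma\mathcal S$ is mean ergodic on $Y_f=\overline{\operatorname{lin}}\,\gamma\mathcal Sf$, i.e. $\overline{\operatorname{co}}(\gamma\mathcal S|_{Y_f})$ contains a zero element $P_\gamma$ ($P_\gamma T=TP_\gamma=P_\gamma$ for all $T$ in it), the mean ergodic projection. $P_\gamma f$ is its value at $f$ (if $f\notin Y_f$, it means $P_\gamma(\gamma(g,\cdot)S_gf)$, which does not depend on $g\in G$). Uniform family: let $\mathcal S_i=\{S_{i,g}:g\in G\}$, $i\in I$, be representations of $G$ on a Banach space $X$ with $\sup_{i,g}\|S_{i,g}\|<\infty$, $\mathcal A$ a directed set and $(A_\alpha^{\mathcal S_i})_{\alpha\in\mathcal A}\subset\mathscr L(X)$ a net for each $i$. They form a uniform family of right ergodic nets if (i) for all $\alpha\in\mathcal A$, $\varepsilon>0$, $f_1,\dots,f_m\in X$ there are $g_1,\dots,g_n\in G$ such that for each $i$ there is a convex combination $\sum_{j=1}^nc_{i,j}S_{i,g_j}$ with $\sup_{i}\|A_\alpha^{\mathcal S_i}f_k-\sum_jc_{i,j}S_{i,g_j}f_k\|<\varepsilon$ for all $k$; (ii) $\lim_\alpha\sup_i\|A_\alpha^{\mathcal S_i}f-A_\alpha^{\mathcal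 S_i}S_{i,g}f\|=0$ for all $g\in G,f\in X$. Here $X=C(K,\mathbb C^N)$, $I=\Lambda$, $\mathcal S_\gamma=\gamma\mathcal S$. *)

(* Defs.v *)
From HB Require Import structures.
From mathcomp Require Import all_boot all_order all_algebra.
From mathcomp Require Import all_classical all_reals all_analysis.
From mathcomp Require Import complex spectral ring lra.
Set Implicit Arguments.
Unset Strict Implicit.
Unset Printing Implicit Defensive.
Import Order.TTheory GRing.Theory Num.Theory.
Import numFieldNormedType.Exports.
Local Open Scope classical_set_scope.
Local Open Scope complex_scope.
Local Open Scope ring_scope.

HB.instance Definition _ (R : rcfType) := NormedModule.copy R[i] (R[i])^o.

(* Norms of R[i]-normed spaces take values in R[i]; [rnorm] is the same norm
   as an element of R. *)
Definition rnorm (R : realType) (X : normedModType R[i]) (x : X) : R :=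
  complex.Re `|x|.

(* Supremum in [0, +oo] of a nonnegative family: the empty supremum is 0 and
   the supremum of an unbounded family is +oo. *)
Definition usup (R : realType) (I : Type) (D : set I) (F : I -> R) : \bar R :=
  ereal_sup ([set 0%E] `|` [set (F i)%:E | i in D]).

Section nets.
Context {A : Type} (le : A -> A -> Prop).

Definition directed : Prop :=
  [/\ inhabited A, forall a, le a a,
      forall a b c, le a b -> le b c -> le a c
    & forall a b, exists c, le a c /\ le b c].

Definition tails : set_system A :=
  filter_from setT (fun a => [set b | le a b]).

End nets.

HB.mixin Record isSemitopological G & Semigroup G & Topological G := {
  mulg_continuousr : forall g : G, continuous (fun h : G => (g * h)%g);
  mulg_continuousl : forall g : G, continuous (fun h : G => (h * g)%g)
}.

#[short(type="semitopSemigroupType")]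
HB.structure Definition SemitopSemigroup :=
  {G of Semigroup G & Topological G & isSemitopological G}.

HB.mixin Record isCompactHausdorff K & Topological K := {
  compactT : compact [set: K];
  hausdorffT : hausdorff_space K
}.

(* Points are required because the library's measurable types are pointed;
   a space carrying a probability measure is nonempty. *)
#[short(type="compactHausdorffType")]
HB.structure Definition CompactHausdorff :=
  {K of PointedTopological K & isCompactHausdorff K}.

Section amenability.
Variables (R : realType) (G : semitopSemigroupType).

Definition Cb : set (G -> R[i]) :=
  [set f | continuous f /\ exists M : R, forall h, rnorm (f h) <= M].

(* The real supremum of an unbounded set is 0, so the equation on the norm
   of m entails that m is bounded. *)
Definition right_invariant_mean (m : (G -> R[i]) -> R[i]) : Prop :=
  [/\ forall (a : R[i]) (f h : G -> R[i]), Cb f -> Cb h ->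
        m (fun x => a * f x + h x) = a * m f + m h,
      m (fun=> 1) = 1,
      sup [set rnorm (m f) | f in
             [set f | Cb f /\ forall h, rnorm (f h) <= 1]] = 1
    & forall g f, Cb f -> m (fun h => f (h * g)%g) = m f].

Definition right_amenable : Prop := exists m, right_invariant_mean m.

End amenability.

Section operators.
Variables (R : realType) (X : normedModType R[i]).
Implicit Types (Y : set X) (T P : X -> X).

(* Operators on a subspace Y are represented by functions on X, of which only
   the restriction to Y matters. *)
Definition bounded_op Y T : Prop :=
  [/\ forall x, Y x -> Y (T x),
      forall (a : R[i]) x y, Y x -> Y y -> T (a *: x + y) = a *: T x + T y
    & exists M : R, forall x, Y x -> rnorm (T x) <= M * rnorm x].

(* Closure in L(Y) for the strong operator topology, by basic neighbourhoods. *)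
Definition sot_closure Y (C : set (X -> X)) : set (X -> X) :=
  [set T | bounded_op Y T /\
    forall (n : nat) (y : 'I_n -> X) (e : R), (forall k, Y (y k)) -> 0 < e ->
      exists2 U, C U & forall k, rnorm (T (y k) - U (y k)) < e].

Definition zero_element Y (C : set (X -> X)) P : Prop :=
  C P /\ forall T, C T -> forall y, Y y -> P (T y) = P y /\ T (P y) = P y.

Section representation.
Context {G : Type}.
Implicit Type S : G -> X -> X.

Definition convex_weights n (c : 'I_n -> R) : Prop :=
  (forall j, 0 <= c j) /\ \sum_j c j = 1.

Definition convex_hull S : set (X -> X) :=
  [set T | exists n (c : 'I_n -> R) (g : 'I_n -> G),
    convex_weights c /\ T = fun x => \sum_j (c j)%:C *: S (g j) x].

Definition orbit_span S (f : X) : set X :=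
  closure [set x | exists n (c : 'I_n -> R[i]) (g : 'I_n -> G),
    x = \sum_j c j *: S (g j) f].

Definition fixed_points S : set X := [set x | forall g, S g x = x].

Definition is_mean_ergodic_value S (f v : X) : Prop :=
  let Y := orbit_span S f in
  exists P, [/\ zero_element Y (sot_closure Y (convex_hull S)) P,
                Y f -> v = P f & ~ Y f -> forall g, v = P (S g f)].

(* The value at f of the mean ergodic projection of S on the closed linear
   span of the orbit of f; junk value 0 when S is not mean ergodic there. *)
Definition mean_ergodic_value S (f : X) : X :=
  xget 0 (is_mean_ergodic_value S f).

End representation.

Definition uniform_right_ergodic (G I A : Type) (D : set I)
    (le : A -> A -> Prop) (S : I -> G -> X -> X) (E : I -> A -> X -> X) :
    Prop :=
  [/\ exists M : R, forall i g x, D i -> rnorm (S i g x) <= M * rnorm x,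
      forall i a, D i -> bounded_op setT (E i a),
      forall a (e : R) m (f : 'I_m -> X), 0 < e ->
        exists n (g : 'I_n -> G) (c : I -> 'I_n -> R),
          (forall i, D i -> convex_weights (c i)) /\
          forall k, (usup D (fun i => rnorm
            (E i a (f k) - \sum_j (c i j)%:C *: S i (g j) (f k))%R) < e%:E)%E
    & forall g f,
        usup D (fun i => rnorm (E i a f - E i a (S i g f))) @[a --> tails le]
          --> 0%E].

End operators.

Section euclidean.
Variable R : realType.

Definition enorm N (v : 'cV[R[i]]_N) : R :=
  Num.sqrt (\sum_i rnorm (v i ord0) ^+ 2).

Definition opnorm N (A : 'M[R[i]]_N) : R :=
  sup [set enorm (A *m v) | v in [set v | enorm v <= 1]].

Definition unitary_subgroup N (Z : set 'M[R[i]]_N) : Prop :=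
  [/\ Z `<=` [set u | u \is unitarymx], Z 1%:M,
      forall u v, Z u -> Z v -> Z (u *m v)
    & forall u, Z u -> Z (invmx u)].

Lemma rnormE (z : R[i]) : `|z| = (rnorm z)%:C.
Proof. rewrite /rnorm normc_def; reflexivity. Qed.

Lemma rnorm_ge0 (z : R[i]) : 0 <= rnorm z.
Proof. rewrite -lecR -rnormE; exact: normr_ge0. Qed.

Lemma rnormD (z w : R[i]) : rnorm (z + w) <= rnorm z + rnorm w.
Proof. by rewrite -lecR rmorphD /= -!rnormE ler_normD. Qed.

Lemma rnormM (z w : R[i]) : rnorm (z * w) = rnorm z * rnorm w.
Proof. by apply: complexI; rewrite rmorphM /= -!rnormE normrM. Qed.

Lemma rnorm_continuous : continuous (@rnorm R R[i]).
Proof.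
move=> z A /nbhs_ballP [e /= e0 eA].
have e0C : 0 < e%:C by rewrite ltcR.
rewrite nbhs_simpl /=.
apply: filterS (nbhsx_ballx z _ e0C) => w zw.
have {zw} : `|z - w| < e%:C by [].
move=> zw; apply: eA; move: zw; rewrite /ball/=.
rewrite rnormE ltcR; apply: le_lt_trans; rewrite ler_distl.
have := rnormD (z - w) w; have := rnormD (w - z) z.
have -> : rnorm (w - z) = rnorm (z - w) by rewrite /rnorm distrC.
by rewrite !subrK => h1 h2; apply/andP; split; lra.
Qed.

Lemma enorm_ge0 N (v : 'cV[R[i]]_N) : 0 <= enorm v.
Proof. exact: sqrtr_ge0. Qed.

Lemma sum_sqr_ge0 N (a : 'I_N -> R) : 0 <= \sum_i a i ^+ 2.
Proof. by apply: sumr_ge0 => i _; exact: sqr_ge0. Qed.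

Lemma sum_CS N (a b : 'I_N -> R) :
  (\sum_i a i * b i) ^+ 2 <= (\sum_i a i ^+ 2) * (\sum_i b i ^+ 2).
Proof.
have : 0 <= \sum_i \sum_j (a i * b j - a j * b i) ^+ 2.
  by apply: sumr_ge0 => i _; apply: sumr_ge0 => j _; exact: sqr_ge0.
suff -> : \sum_i \sum_j (a i * b j - a j * b i) ^+ 2 =
   ((\sum_i a i ^+ 2) * (\sum_i b i ^+ 2) - (\sum_i a i * b i) ^+ 2) *+ 2.
  by rewrite pmulrn_lge0// subr_ge0.
transitivity (\sum_i \sum_j (a i ^+ 2 * b j ^+ 2 + b i ^+ 2 * a j ^+ 2
    - (a i * b i * (a j * b j)) *+ 2)).
  apply: eq_bigr => i _; apply: eq_bigr => j _.
  by ring.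
under eq_bigr do rewrite sumrB big_split/= -!mulr_sumr sumrMnl -mulr_sumr.
rewrite sumrB big_split/= sumrMnl -!mulr_suml expr2.
by rewrite (mulrC (\sum_i b i ^+ 2)) -mulr2n mulrnBl.
Qed.

Lemma enormD N (v w : 'cV[R[i]]_N) : enorm (v + w) <= enorm v + enorm w.
Proof.
set a := fun i => rnorm (v i ord0); set b := fun i => rnorm (w i ord0).
rewrite -(ger0_norm (addr_ge0 (enorm_ge0 v) (enorm_ge0 w))) -sqrtr_sqr.
apply: ler_wsqrtr.
apply: (@le_trans _ _ (\sum_i (a i + b i) ^+ 2)).
  apply: ler_sum => i _; rewrite ler_pXn2r ?nnegrE ?addr_ge0 ?rnorm_ge0//.
  by rewrite mxE rnormD.
under eq_bigr do rewrite sqrrD.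
rewrite !big_split/= -mulr2n sqrrD /enorm !sqr_sqrtr ?sum_sqr_ge0//.
rewrite lerD2r lerD2l ler_pMn2r// -sqrtrM ?sum_sqr_ge0//.
have ab0 : 0 <= \sum_i a i * b i.
  by apply: sumr_ge0 => i _; rewrite mulr_ge0 ?rnorm_ge0.
by rewrite -[leLHS]ger0_norm// -sqrtr_sqr ler_wsqrtr// sum_CS.
Qed.

Lemma enormZ N (c : R[i]) (v : 'cV[R[i]]_N) :
  enorm (c *: v) = rnorm c * enorm v.
Proof.
rewrite /enorm; under eq_bigr do rewrite mxE rnormM exprMn.
by rewrite -mulr_sumr sqrtrM ?sqr_ge0// sqrtr_sqr ger0_norm ?rnorm_ge0.
Qed.

Lemma enorm0_eq0 N (v : 'cV[R[i]]_N) : enorm v = 0 -> v = 0.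
Proof.
move=> /eqP; rewrite sqrtr_eq0 => v0.
have /eqP : \sum_i rnorm (v i ord0) ^+ 2 = 0.
  by apply/eqP; rewrite eq_le v0 sum_sqr_ge0.
rewrite psumr_eq0; last by move=> i _; exact: sqr_ge0.
move=> /allP v00; apply/matrixP => i j; rewrite (ord1 j) mxE.
have /= := v00 i (mem_index_enum i); rewrite sqrf_eq0 => /eqP vi.
by apply/eqP; rewrite -normr_eq0 rnormE vi.
Qed.

Lemma enorm0 N : enorm (0 : 'cV[R[i]]_N) = 0.
Proof.
rewrite /enorm big1 ?sqrtr0// => i _.
by rewrite mxE /rnorm normr0/= expr0n.
Qed.

Lemma enormN N (v : 'cV[R[i]]_N) : enorm (- v) = enorm v.
Proof. by rewrite -scaleN1r enormZ /rnorm normrN1 mul1r. Qed.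

Lemma enorm_le_sum N (v : 'cV[R[i]]_N) : enorm v <= \sum_i rnorm (v i ord0).
Proof.
have s0 (P : pred 'I_N) : 0 <= \sum_(i | P i) rnorm (v i ord0).
  by apply: sumr_ge0 => i _; exact: rnorm_ge0.
rewrite -[leRHS]ger0_norm// -sqrtr_sqr ler_wsqrtr//.
rewrite expr2 mulr_suml ler_sum// => i _.
by rewrite expr2 ler_wpM2l ?rnorm_ge0// (bigD1 i)//= lerDl.
Qed.

Lemma enorm_unitary N (u : 'M[R[i]]_N) (v : 'cV[R[i]]_N) :
  u \is unitarymx -> enorm (u *m v) = enorm v.
Proof.
have E (w : 'cV[R[i]]_N) :
    (\sum_i rnorm (w i ord0) ^+ 2)%:C = (w^t* *m w)%sesqui ord0 ord0.
  rewrite mxE rmorph_sum; apply: eq_bigr => i _.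
  by rewrite rmorphXn /= -rnormE !mxE normCK mulrC.
move=> uU; congr Num.sqrt; apply: complexI; rewrite !E.
have -> : ((u *m v)^t* = v^t* *m u^t*)%sesqui by rewrite trmx_mul map_mxM.
have uu : (u^t* *m u)%sesqui = 1%:M.
  by rewrite -invmx_unitary// mulVmx ?unitarymx_unit.
have -> // : (v^t* *m u^t* *m (u *m v) = v^t* *m v)%sesqui.
by rewrite mulmxA -(mulmxA (v^t*)%sesqui) uu mulmx1.
Qed.

Lemma enormB_unitary N (u w : 'M[R[i]]_N) (v : 'cV[R[i]]_N) :
  u \is unitarymx -> w \is unitarymx -> enorm v <= 1 ->
  enorm ((u - w) *m v) <= 2.
Proof.
move=> uU wU v1; rewrite mulmxBl; apply: (le_trans (enormD _ _)).
by rewrite enormN !enorm_unitary//; lra.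
Qed.

Lemma opnorm_nonempty N (A : 'M[R[i]]_N) :
  [set enorm (A *m v) | v in [set v | enorm v <= 1]] !=set0.
Proof. by exists (enorm (A *m 0)), 0 => //=; rewrite enorm0. Qed.

Lemma opnorm_le N (A : 'M[R[i]]_N) (M : R) :
  (forall v, enorm v <= 1 -> enorm (A *m v) <= M) -> opnorm A <= M.
Proof.
by move=> H; apply: ge_sup; [exact: opnorm_nonempty|move=> _ [v /H ? <-]].
Qed.

Lemma opnormB_ub N (u w : 'M[R[i]]_N) (v : 'cV[R[i]]_N) :
  u \is unitarymx -> w \is unitarymx -> enorm v <= 1 ->
  enorm ((u - w) *m v) <= opnorm (u - w).
Proof.
move=> uU wU v1; apply: sup_upper_bound; last by exists v.
split; first exact: opnorm_nonempty.
by exists 2 => _ [x x1 <-]; exact: enormB_unitary.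
Qed.

Lemma opnormB_ge0 N (u w : 'M[R[i]]_N) :
  u \is unitarymx -> w \is unitarymx -> 0 <= opnorm (u - w).
Proof.
move=> uU wU; apply: le_trans (enorm_ge0 _) (opnormB_ub (v := 0) uU wU _).
by rewrite enorm0.
Qed.

Lemma opnormB_triangle N (u v w : 'M[R[i]]_N) :
  u \is unitarymx -> v \is unitarymx -> w \is unitarymx ->
  opnorm (u - w) <= opnorm (u - v) + opnorm (v - w).
Proof.
move=> uU vU wU; apply: opnorm_le => x x1.
have -> : (u - w) *m x = (u - v) *m x + (v - w) *m x.
  by rewrite -mulmxDl addrA subrK.
apply: (le_trans (enormD _ _)).
exact: lerD (opnormB_ub uU vU x1) (opnormB_ub vU wU x1).
Qed.

Lemma opnormBC N (u w : 'M[R[i]]_N) : opnorm (u - w) = opnorm (w - u).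
Proof.
apply: (congr1 (@sup R)); apply: eq_imagel => v _.
have -> : (u - w) *m v = u *m v - w *m v by rewrite mulmxBl.
have -> : (w - u) *m v = w *m v - u *m v by rewrite mulmxBl.
by rewrite -enormN opprB.
Qed.

Lemma opnormB_eq0 N (u w : 'M[R[i]]_N) :
  u \is unitarymx -> w \is unitarymx -> opnorm (u - w) = 0 -> u = w.
Proof.
move=> uU wU uw0; apply/matrixP => i j.
have d1 : enorm (delta_mx j ord0 : 'cV[R[i]]_N) <= 1.
  rewrite /enorm (bigD1 j)//= big1 ?addr0.
    by rewrite mxE !eqxx /rnorm normr1/= expr1n sqrtr1.
  by move=> k kj; rewrite mxE (negbTE kj) /rnorm normr0/= expr0n.
have := opnormB_ub uU wU d1; rewrite uw0 => le0.
have /enorm0_eq0 /matrixP /(_ i ord0) : enorm ((u - w) *m delta_mx j ord0) = 0.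
  by apply/eqP; rewrite eq_le le0 enorm_ge0.
by rewrite -colE !mxE => /eqP; rewrite subr_eq0 => /eqP.
Qed.

Lemma opnorm0 N : opnorm (0 : 'M[R[i]]_N) = 0.
Proof.
rewrite -(subrr 1%:M); apply/eqP; rewrite eq_le.
have U1 : (1%:M : 'M[R[i]]_N) \is unitarymx.
  by apply/unitarymxP; rewrite trmx1 map_mx1 mulmx1.
rewrite opnormB_ge0// andbT subrr; apply: opnorm_le => v _.
by rewrite mul0mx enorm0.
Qed.

End euclidean.

(* G x K carries the product topology: the action is jointly continuous. *)
Record action (G : semitopSemigroupType) (K : topologicalType) := Action {
  act_fun :> G -> K -> K;
  act_continuous : continuous (fun p : G * K => act_fun p.1 p.2);
  actM : forall g1 g2 x, act_fun (g1 * g2)%g x = act_fun g1 (act_fun g2 x) }.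

Section function_space.
Variables (R : realType) (K : compactHausdorffType) (N : nat).
Local Notation V := 'cV[R[i]]_N.

Lemma mx_continuousP (T : topologicalType) m n (f : T -> 'M[R[i]]_(m, n)) :
  (forall i j, continuous (fun x => f x i j)) -> continuous f.
Proof.
move=> fc x A [P Pn PA]; rewrite nbhs_simpl /=.
have : \near x, forall ij : 'I_m * 'I_n, P ij.1 ij.2 (f x ij.1 ij.2).
  by apply: filter_forall => -[i j] /=; exact: fc (Pn i j).
by apply: filterS => y Py; apply: PA => i j; exact: (Py (i, j)).
Qed.

Lemma entry_continuous (T : topologicalType) m n (f : T -> 'M[R[i]]_(m, n)) :
  continuous f -> forall i j, continuous (fun x => f x i j).
Proof.
move=> fc i j x A An.
have : nbhs (f x) [set M | A (M i j)].
  exists (fun i' j' => [set z | i' = i -> j' = j -> A z]).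
    move=> i' j'.
    have [[-> ->]|nij] := pselect (i' = i /\ j' = j).
      by apply: filterS An => z Az.
    by apply: filterS filterT => z _ ii jj; case: nij.
  by move=> M /= Mij; exact: Mij.
exact: fc.
Qed.

Definition CKN := continuousType K V.

HB.instance Definition _ := Choice.on CKN.

Lemma CKN_continuous (f : CKN) : continuous (f : K -> V).
Proof. exact: cts_fun. Qed.

Lemma CKN_eq (f g : CKN) : (forall x, (f : K -> V) x = (g : K -> V) x) -> f = g.
Proof. by move=> fg; apply/continuousEP. Qed.

Lemma CKN_addc (f g : CKN) :
  continuous (fun x => (f : K -> V) x + (g : K -> V) x).
Proof.
apply: mx_continuousP => i j x.
under [X in continuous_at _ X]funext do rewrite mxE.
by apply: cvgD; apply: entry_continuous; exact: CKN_continuous.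
Qed.

Lemma CKN_scalec (a : R[i]) (f : CKN) :
  continuous (fun x => a *: (f : K -> V) x).
Proof.
apply: mx_continuousP => i j x.
under [X in continuous_at _ X]funext do rewrite mxE.
by apply: cvgMr; apply: entry_continuous; exact: CKN_continuous.
Qed.

Lemma CKN_zeroc : continuous (fun _ : K => 0 : V).
Proof. by move=> x; exact: cvg_cst. Qed.

Definition CKN_zero : CKN := mkcts CKN_zeroc.
Definition CKN_add (f g : CKN) : CKN := mkcts (@CKN_addc f g).
Definition CKN_scale (a : R[i]) (f : CKN) : CKN := mkcts (@CKN_scalec a f).

Lemma CKN_addA : associative CKN_add.
Proof. by move=> f g h; apply: CKN_eq => x /=; rewrite /mkcts addrA. Qed.

Lemma CKN_addC : commutative CKN_add.
Proof. by move=> f g; apply: CKN_eq => x /=; rewrite /mkcts addrC. Qed.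

Lemma CKN_add0 : left_id CKN_zero CKN_add.
Proof. by move=> f; apply: CKN_eq => x /=; rewrite /mkcts add0r. Qed.

Lemma CKN_addN : left_inverse CKN_zero (CKN_scale (-1)) CKN_add.
Proof. by move=> f; apply: CKN_eq => x /=; rewrite /mkcts scaleN1r addNr. Qed.

HB.instance Definition _ :=
  GRing.isZmodule.Build CKN CKN_addA CKN_addC CKN_add0 CKN_addN.

Lemma CKN_scaleA a b f :
  CKN_scale a (CKN_scale b f) = CKN_scale (a * b) f.
Proof. by apply: CKN_eq => x /=; rewrite /mkcts scalerA. Qed.

Lemma CKN_scale1 : left_id 1 CKN_scale.
Proof. by move=> f; apply: CKN_eq => x /=; rewrite /mkcts scale1r. Qed.

Lemma CKN_scaleDr : right_distributive CKN_scale +%R.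
Proof. by move=> a f g; apply: CKN_eq => x /=; rewrite /mkcts scalerDr. Qed.

Lemma CKN_scaleDl f : {morph CKN_scale^~ f : a b / a + b}.
Proof. by move=> a b; apply: CKN_eq => x /=; rewrite /mkcts scalerDl. Qed.

HB.instance Definition _ := GRing.Zmodule_isLmodule.Build R[i] CKN
  CKN_scaleA CKN_scale1 CKN_scaleDr CKN_scaleDl.

Definition supnorm (f : CKN) : R := sup [set enorm ((f : K -> V) x) | x in setT].

Lemma supnorm_has_sup (f : CKN) : has_sup [set enorm ((f : K -> V) x) | x in setT].
Proof.
split; first by exists (enorm ((f : K -> V) point)), point.
have bnd i : exists M : R, forall x, rnorm ((f : K -> V) x i ord0) <= M.
  have cpt : compact [set rnorm ((f : K -> V) x i ord0) | x in [set: K]].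
    apply: continuous_compact; last exact: compactT.
    apply: continuous_subspaceT => x; apply: continuous_comp.
      by apply: entry_continuous; exact: CKN_continuous.
    exact: rnorm_continuous.
  have [M [_ HM]] := compact_bounded cpt.
  exists (M + 1) => x.
  have M1 : M < M + 1 by rewrite ltrDl.
  by apply: (le_trans (ler_norm _)); apply: (HM _ M1); exists x.
have [M HM] := choice bnd.
exists (\sum_i M i) => _ [x _ <-].
by apply: (le_trans (enorm_le_sum _)); apply: ler_sum => i _.
Qed.

Lemma supnorm_ub (f : CKN) x : enorm ((f : K -> V) x) <= supnorm f.
Proof. by apply: sup_upper_bound; [exact: supnorm_has_sup|exists x]. Qed.

Lemma supnorm_le (f : CKN) (M : R) :
  (forall x, enorm ((f : K -> V) x) <= M) -> supnorm f <= M.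
Proof.
move=> H; apply: ge_sup; first by have [] := supnorm_has_sup f.
by move=> _ [x _ <-].
Qed.

Lemma supnormD (f g : CKN) : supnorm (f + g) <= supnorm f + supnorm g.
Proof.
apply: supnorm_le => x; apply: (le_trans (enormD _ _)).
by apply: lerD; exact: supnorm_ub.
Qed.

Lemma supnorm_ge0 (f : CKN) : 0 <= supnorm f.
Proof. exact: le_trans (enorm_ge0 _) (supnorm_ub f point). Qed.

Lemma supnorm0_eq0 (f : CKN) : supnorm f = 0 -> f = 0.
Proof.
move=> f0; apply: CKN_eq => x; apply: enorm0_eq0.
by apply/eqP; rewrite eq_le enorm_ge0 andbT -f0 supnorm_ub.
Qed.

Lemma supnormZ_le (a : R[i]) (f : CKN) :
  supnorm (a *: f) <= rnorm a * supnorm f.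
Proof.
apply: supnorm_le => x; rewrite [leLHS](enormZ a).
by rewrite ler_wpM2l ?rnorm_ge0// supnorm_ub.
Qed.

Lemma supnormZ (a : R[i]) (f : CKN) : supnorm (a *: f) = rnorm a * supnorm f.
Proof.
apply/eqP; rewrite eq_le supnormZ_le/=.
have [->|a0] := eqVneq a 0.
  by rewrite /rnorm normr0/= mul0r supnorm_ge0.
have /= := supnormZ_le a^-1 (a *: f).
rewrite scalerA mulVf// scale1r => H.
have ra0 : 0 < rnorm a by rewrite -ltcR -rnormE normr_gt0.
rewrite -(ler_pM2l ra0) in H; apply: (le_trans H).
by rewrite mulrA -rnormM mulfV// /rnorm normr1/= mul1r.
Qed.

Definition CKN_norm (f : CKN) : R[i] := (supnorm f)%:C.

Lemma CKN_normD f g : CKN_norm (f + g) <= CKN_norm f + CKN_norm g.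
Proof. by rewrite /CKN_norm -rmorphD /= lecR supnormD. Qed.

Lemma CKN_normZ (a : R[i]) f : CKN_norm (a *: f) = `|a| * CKN_norm f.
Proof. by rewrite /CKN_norm supnormZ rnormE rmorphM. Qed.

Lemma CKN_norm0_eq0 f : CKN_norm f = 0 -> f = 0.
Proof. by move=> /complexI; exact: supnorm0_eq0. Qed.

HB.instance Definition _ := @Lmodule_isNormed.Build R[i] CKN
  CKN_norm CKN_normD CKN_normZ CKN_norm0_eq0.

End function_space.

Section cocycles.
Variables (R : realType) (G : semitopSemigroupType) (K : compactHausdorffType).
Variables (N : nat) (phi : action G K).
Local Notation V := 'cV[R[i]]_N.

Record cocycle := Cocycle {
  cocycle_fun :> G -> K -> 'M[R[i]]_N;
  cocycle_continuous : continuous (fun p : G * K => cocycle_fun p.1 p.2);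
  cocycleM : forall g1 g2 x, cocycle_fun (g1 * g2)%g x =
    cocycle_fun g2 x *m cocycle_fun g1 (phi g2 x);
  cocycle_unitary : forall g x, cocycle_fun g x \is unitarymx }.

Definition cocycles_in (Z : set 'M[R[i]]_N) : set cocycle :=
  [set gam | forall g x, Z (gam g x)].

HB.instance Definition _ := gen_eqMixin cocycle.
HB.instance Definition _ := gen_choiceMixin cocycle.

Lemma cocycle_eq (a b : cocycle) : (forall g x, a g x = b g x) -> a = b.
Proof.
case: a b => [a ac aM aU] [b bc bM bU] /= ab.
have {}ab : a = b by apply: funext => g; apply: funext => x.
by subst b; congr Cocycle; exact: Prop_irrelevance.
Qed.

(* U(N) carries the operator-norm metric. Distances of unitaries are at most 2,
   so the real supremum is a genuine one. *)
Definition cocycle_dist (a b : cocycle) : R :=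
  sup [set opnorm (a p.1 p.2 - b p.1 p.2) | p in [set: G * K]].

Lemma cocycle_dist_ub (a b : cocycle) g x : opnorm (a g x - b g x) <= cocycle_dist a b.
Proof.
apply: sup_upper_bound; last by exists (g, x).
split; first by exists (opnorm (a g x - b g x)), (g, x).
exists 2 => _ [p _ <-]; apply: opnorm_le => v v1.
by apply: enormB_unitary => //; exact: cocycle_unitary.
Qed.

Lemma cocycle_dist_le (a b : cocycle) (M : R) : 0 <= M ->
  (forall g x, opnorm (a g x - b g x) <= M) -> cocycle_dist a b <= M.
Proof.
move=> M0 H; rewrite /cocycle_dist.
set D := [set _ | _ in _].
have [->|/set0P D0] := eqVneq D set0; first by rewrite sup0.
by apply: ge_sup => // _ [p _ <-].
Qed.

Lemma cocycle_dist_ge0 a b : 0 <= cocycle_dist a b.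
Proof.
have [[p _]|nGK] := pselect ([set: G * K] !=set0).
  apply: le_trans (cocycle_dist_ub a b p.1 p.2).
  by apply: opnormB_ge0; exact: cocycle_unitary.
by rewrite /cocycle_dist (_ : [set: G * K] = set0) ?image_set0 ?sup0//;
  apply/seteqP; split=> // p _; apply: nGK; exists p.
Qed.

Lemma cocycle_distxx a : cocycle_dist a a = 0.
Proof.
apply/eqP; rewrite eq_le cocycle_dist_ge0 andbT.
by apply: cocycle_dist_le => // g x; rewrite subrr opnorm0.
Qed.

Lemma cocycle_dist_eq0 a b : cocycle_dist a b = 0 -> a = b.
Proof.
move=> ab0; apply: cocycle_eq => g x.
apply: opnormB_eq0; [exact: cocycle_unitary|exact: cocycle_unitary|].
apply/eqP; rewrite eq_le -{1}ab0 cocycle_dist_ub/=.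
by apply: opnormB_ge0; exact: cocycle_unitary.
Qed.

Lemma cocycle_dist_sym a b : cocycle_dist a b = cocycle_dist b a.
Proof.
apply: (congr1 (@sup R)); apply: eq_imagel => p _; exact: opnormBC.
Qed.

Lemma cocycle_dist_triangle b a c :
  cocycle_dist a c <= cocycle_dist a b + cocycle_dist b c.
Proof.
apply: cocycle_dist_le => [|g x]; first by rewrite addr_ge0 ?cocycle_dist_ge0.
apply: le_trans (lerD (cocycle_dist_ub a b g x) (cocycle_dist_ub b c g x)).
by apply: opnormB_triangle; exact: cocycle_unitary.
Qed.

HB.instance Definition _ := @isMetric.Build R cocycle cocycle_dist
  cocycle_distxx cocycle_dist_eq0 cocycle_dist_sym cocycle_dist_triangle.

(* gamma(g, .) S_g on arbitrary functions, hence also on representatives of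
   classes in L^2. *)
Definition twisted (gam : cocycle) (g : G) (f : K -> V) : K -> V :=
  fun x => gam g x *m f (phi g x).

Lemma twisted_continuous gam g (f : CKN R K N) :
  continuous (twisted gam g f).
Proof.
have phic : continuous (phi g).
  move=> x; apply: (@continuous_comp _ _ _ (fun y => (g, y))
    (fun p : G * K => phi p.1 p.2)); last exact: act_continuous.
  by apply: cvg_pair; [exact: cvg_cst|exact: cvg_id].
have gamc : continuous (gam g).
  move=> x; apply: (@continuous_comp _ _ _ (fun y => (g, y))
    (fun p : G * K => gam p.1 p.2)); last exact: cocycle_continuous.
  by apply: cvg_pair; [exact: cvg_cst|exact: cvg_id].
have fc : continuous (fun x => f (phi g x)).
  move=> x; apply: continuous_comp; first exact: phic.
  exact: CKN_continuous.
apply: mx_continuousP => i j x.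
under [X in continuous_at _ X]funext do rewrite mxE.
apply: cvg_big => [|k _]; first exact: add_continuous.
apply: cvgM; first exact: (entry_continuous gamc).
exact: (entry_continuous fc).
Qed.

Definition twisted_koopman (gam : cocycle) (g : G) (f : CKN R K N) :
  CKN R K N := mkcts (@twisted_continuous gam g f).

End cocycles.

Section ergodicity.
Variables (R : realType) (G : semitopSemigroupType) (K : compactHausdorffType).

Definition borel := g_sigma_algebraType (@open K).
HB.instance Definition _ := Measurable.on borel.

Definition regular_measure (mu : probability borel R) : Prop :=
  forall A : set borel, measurable A ->
    mu A = ereal_sup [set mu F | F in [set F : set K | closed F /\ F `<=` A]] /\
    mu A = ereal_inf [set mu U | U in [set U : set K | open U /\ A `<=` U]].

Definition invariant_measure (phi : action G K) (mu : probability borel R) :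
    Prop :=
  forall (g : G) (A : set borel), measurable A -> mu A = mu (phi g @^-1` A).

(* On a compact space, a probability measure is a regular Borel one, that is
   a state of C(K); regularity is automatic when K is metrizable. *)
Definition uniquely_ergodic (phi : action G K) (mu : probability borel R) :
    Prop :=
  [/\ regular_measure mu, invariant_measure phi mu
    & forall nu : probability borel R, regular_measure nu ->
        invariant_measure phi nu ->
        forall A : set borel, measurable A -> nu A = mu A].

End ergodicity.

(* Elements of L^2(K, C^N, mu) are represented by functions; equality of
   elements is equality almost everywhere. *)
Section square_integrable.
Variables (R : realType) (G : semitopSemigroupType) (K : compactHausdorffType).
Variables (N : nat) (mu : probability (borel K) R).
Local Notation V := 'cV[R[i]]_N.
Implicit Types f h p : K -> V.

Definition L2 : set (K -> V) :=
  [set h : K -> V |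
    (forall i, measurable_fun setT (fun x : borel K => complex.Re (h x i ord0)) /\
               measurable_fun setT (fun x : borel K => complex.Im (h x i ord0))) /\
    (\int[mu]_x ((enorm (h x) ^+ 2)%:E) < +oo)%E].

Definition L2_inner f h : R[i] :=
  let w (x : borel K) := \sum_i f x i ord0 * (h x i ord0)^* in
  (\int[mu]_x complex.Re (w x))%R +i* (\int[mu]_x complex.Im (w x))%R.

(* p represents the orthogonal projection of f onto H. *)
Definition is_orthogonal_projection (H : set (K -> V)) f p : Prop :=
  H p /\ forall h, H h -> L2_inner (fun x => f x - p x) h = 0.

Definition fixed_points_L2 (phi : action G K) (gam : cocycle R N phi) :
    set (K -> V) :=
  [set h : K -> V | L2 h /\
    forall g, {ae mu, forall x : borel K, twisted gam g h x = h x}].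

End square_integrable.

(* Main.v *)
From HB Require Import structures.
Require Import Defs.
From mathcomp Require Import all_boot all_order all_algebra.
From mathcomp Require Import all_classical all_reals all_analysis.
From mathcomp Require Import measurable_realfun.
From mathcomp Require Import complex ring lra.
Set Implicit Arguments.
Unset Strict Implicit.
Unset Printing Implicit Defensive.
Import Order.TTheory GRing.Theory Num.Theory.
Import numFieldNormedType.Exports.
Local Open Scope classical_set_scope.
Local Open Scope complex_scope.
Local Open Scope ring_scope.

(** Fix a cocycle gam, let p be the continuous representative of the projection
    of f onto the fixed functions, and put u = f - p.  The crux is that the
    averages E_a u tend to 0 uniformly on K ([perp_net_cvg0]); since E_a fixes p,
    this says E_a f -> p.

    Suppose E_a u does not tend to 0.  Frequently in a there are then a point
    x_a and a unit vector w_a such that <E_a u(x_a), w_a> stays away from 0, and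
    the limit of h |-> <E_a h(x_a), w_a> along an ultrafilter is a bounded
    functional with L u > 0.  It is invariant under the twisted Koopman operators
    because the net is right ergodic ([net_functional]).  Three facts show that
    such an L cannot exist.

    - The variation f |-> sup of L h over the continuous h with |h| <= f is a
      positive functional on C(K) ([functional_variation_positive]), and since a
      cocycle with unitary values does not change lengths, it is invariant under
      the action.  By the Riesz-Markov theorem ([riesz_markov]) it is given by an
      invariant regular measure, which unique ergodicity makes a multiple of mu.
      So L h <= c * int |h| dmu ([invariant_functional_le_integral]).

    - Take a sequence h_n minimizing the mean square on the hyperplane L h = L u.
      By the parallelogram law it is Cauchy in mean square.  The twisted Koopman
      operators preserve both the hyperplane and the mean square, so the images
      of h_n are minimizing too, and the limit k in L^2 is a fixed function
      ([minimizer_fixed]).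

    - Now u is orthogonal to k, so moving from h_n a little towards u, which stays
      on the hyperplane, would decrease the mean square unless the minimum is 0
      ([level_min_eq0]).  Then the bound of L by the integral gives L u <= 0
      ([invariant_functional_le0]).

    Once E_a f -> p is known, a functional of the same kind, normalized at p,
    gives a bounded invariant lam with lam f * p = p, and y |-> lam y * p is the
    zero element on the closed span of the orbit of f.  So p is the mean ergodic
    value ([twisted_mean_ergodic_value]).

    Uniformity over the compact set of cocycles is then soft.  Near gam one
    average E_b f is close to the limit, by continuity; the uniform family
    replaces E_b by a convex combination of operators attached to finitely many
    g_j that do not depend on the cocycle, and E_a absorbs these operators
    uniformly as a grows.  Hence E_a f is close to E_a E_b f, which is close to
    E_a p = p, for all cocycles near gam at once ([uniform_net_convergence]). *)

(** * Real and complex preliminaries *)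

Section small_numbers.
Context (R : realType).

Lemma le_of_eps_mul (x y c : R) : 0 <= c ->
  (forall e, 0 < e -> x <= y + e * c) -> x <= y.
Proof.
move=> c0 H; apply/ler_addgt0Pr => e e0.
have c1 : 0 < c + 1 by lra.
apply: le_trans (H (e / (c + 1)) _) _; first exact: divr_gt0.
rewrite lerD2l -mulrA ler_piMr// ?(ltW e0)//.
by rewrite mulrC ler_pdivrMr// mul1r; lra.
Qed.

Lemma sum_geometric_le (e : R) n : 0 <= e ->
  \sum_(i < n) e / 2 ^+ i.+1 <= e.
Proof.
move=> e0; suff -> : \sum_(i < n) e / 2 ^+ i.+1 = e - e / 2 ^+ n.
  by rewrite gerBl divr_ge0// exprn_ge0.
elim: n => [|n IH]; first by rewrite big_ord0 expr0 divr1 subrr.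
rewrite big_ord_recr/= IH exprS.
have : (2 ^+ n : R) != 0 by rewrite expf_neq0.
by move=> ?; field.
Qed.

Lemma geometric_small (C e : R) : 0 < e -> exists n, C * 4 ^- n < e.
Proof.
move=> e0; have : geometric C (4^-1 : R) @ \oo --> 0.
  by apply: cvg_geometric; rewrite ger0_norm// invf_lt1// ltr1n.
move=> /cvgrPdist_lt /(_ _ e0) [n _ /(_ n (leqnn n))].
rewrite /= sub0r normrN exprVn => /ltr_normlW ?; by exists n.
Qed.

End small_numbers.

Section complex_numbers.
Context (R : realType).
Implicit Types z : R[i].

Lemma rnorm_real_complex (a : R) : rnorm (a%:C : R[i]) = `|a|.
Proof. by apply: complexI; rewrite -rnormE normc_def /= expr0n/= addr0 sqrtr_sqr. Qed.

Lemma Re_le_rnorm (z : R[i]) : `|complex.Re z| <= rnorm z.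
Proof.
case: z => a b; rewrite /rnorm normc_def/= -sqrtr_sqr ler_wsqrtr//.
by rewrite lerDl sqr_ge0.
Qed.

Lemma Im_le_rnorm (z : R[i]) : `|complex.Im z| <= rnorm z.
Proof.
case: z => a b; rewrite /rnorm normc_def/= -sqrtr_sqr ler_wsqrtr//.
by rewrite lerDr sqr_ge0.
Qed.

Lemma rnorm_conj (z : R[i]) : rnorm z^* = rnorm z.
Proof. by case: z => a b; rewrite /rnorm !normc_def/= sqrrN. Qed.

Lemma rnorm_ball (z : R[i]) (e : R) : 0 < e ->
  nbhs z [set w | rnorm (z - w) < e].
Proof.
move=> e0; have e0C : 0 < e%:C by rewrite ltcR.
apply: filterS (nbhsx_ballx z _ e0C) => w zw.
have {zw} : `|z - w| < e%:C by [].
by rewrite rnormE ltcR.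
Qed.

Lemma Re_continuous : continuous (@complex.Re R).
Proof.
move=> z A /nbhs_ballP [e /= e0 eA]; rewrite nbhs_simpl/=.
apply: filterS (rnorm_ball z e0) => w zw; apply: eA.
apply: le_lt_trans zw; rewrite /ball/=.
apply: le_trans (Re_le_rnorm _).
by case: z => ? ?; case: w => ? ?.
Qed.

Lemma Im_continuous : continuous (@complex.Im R).
Proof.
move=> z A /nbhs_ballP [e /= e0 eA]; rewrite nbhs_simpl/=.
apply: filterS (rnorm_ball z e0) => w zw; apply: eA.
apply: le_lt_trans zw; rewrite /ball/=.
apply: le_trans (Im_le_rnorm _).
by case: z => ? ?; case: w => ? ?.
Qed.

Lemma real_complex_continuous : continuous (fun a : R => a%:C : R[i]).
Proof.
move=> a A /nbhs_ballP [e /= e0 eA]; rewrite nbhs_simpl /=.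
have [e0R eE] : 0 < complex.Re e /\ e = (complex.Re e)%:C.
  by move: e e0 {eA} => [r s]; rewrite ltcE/= => /andP[/eqP -> ?].
apply: filterS (nbhsx_ballx a _ e0R) => b ab; apply: eA.
rewrite /ball/= eE -rmorphB /= rnormE ltcR rnorm_real_complex; exact: ab.
Qed.

Lemma enormZ_real (a : R) N (v : 'cV[R[i]]_N) : 0 <= a -> enorm (a%:C *: v) = a * enorm v.
Proof. by move=> a0; rewrite enormZ rnorm_real_complex ger0_norm. Qed.

End complex_numbers.

Section real_valued_norm.
Context (R : realType) (X : normedModType R[i]).
Implicit Types x y z : X.

Lemma normr_rnorm x : `|x| = (rnorm x)%:C.
Proof.
have := normr_ge0 x; rewrite /rnorm lecE => /andP[/eqP im _].
by apply/eqP; rewrite eq_complex/= im !eqxx.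
Qed.

Lemma rnormX_ge0 x : 0 <= rnorm x.
Proof. by rewrite -lecR -normr_rnorm normr_ge0. Qed.

Lemma rnormXD x y : rnorm (x + y) <= rnorm x + rnorm y.
Proof. by rewrite -lecR rmorphD/= -!normr_rnorm ler_normD. Qed.

Lemma rnormXZ (a : R[i]) x : rnorm (a *: x) = rnorm a * rnorm x.
Proof. by apply: complexI; rewrite rmorphM/= -normr_rnorm normrZ normr_rnorm rnormE. Qed.

Lemma rnormX0 : rnorm (0 : X) = 0.
Proof. by rewrite /rnorm normr0. Qed.

Lemma rnormXN x : rnorm (- x) = rnorm x.
Proof. by rewrite /rnorm normrN. Qed.

Lemma rnormXB x y z : rnorm (x - z) <= rnorm (x - y) + rnorm (y - z).
Proof. by apply: le_trans (rnormXD _ _); rewrite addrA subrK. Qed.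

Lemma rnormX_sum n (x : 'I_n -> X) : rnorm (\sum_j x j) <= \sum_j rnorm (x j).
Proof.
elim/big_ind2 : _ => [|a x' b y' xa yb|//]; first by rewrite rnormX0.
by apply: le_trans (rnormXD _ _) _; exact: lerD.
Qed.

Lemma rnorm_eq0 x : rnorm x = 0 -> x = 0.
Proof.
rewrite /rnorm => h; apply/eqP; rewrite -normr_eq0.
have := normr_ge0 x; rewrite lecE => /andP[/eqP im _].
by rewrite eq_complex/= h im eqxx.
Qed.

Lemma closure_rnormP (B : set X) x :
  closure B x <-> forall e, 0 < e -> exists2 y, B y & rnorm (x - y) < e.
Proof.
split=> [cx e e0|H W /nbhs_ballP[e /= e0 eW]].
  have e0C : 0 < e%:C by rewrite ltcR.
  have [y [By xy]] := cx _ (nbhsx_ballx x _ e0C).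
  by exists y => //; move: xy; rewrite -ball_normE/= normr_rnorm ltcR.
have [e0R eE] : 0 < complex.Re e /\ e = (complex.Re e)%:C.
  by move: e e0 {eW} => [r s]; rewrite ltcE/= => /andP[/eqP -> ?].
have [y By xy] := H _ e0R; exists y; split => //; apply: eW.
by rewrite -ball_normE/= normr_rnorm eE ltcR.
Qed.

End real_valued_norm.

Lemma rnorm_small_eq0 (R : realType) (z : R[i]) : (forall e, 0 < e -> rnorm z <= e) -> z = 0.
Proof.
move=> h; apply: rnorm_eq0; apply/eqP; rewrite eq_le rnorm_ge0 andbT.
by apply/ler_addgt0Pr => e e0; rewrite add0r h.
Qed.

Section probability_integrals.
Context d (T : measurableType d) (R : realType) (P : probability T R).

Lemma integral_cst_probability (a : R) : (\int[P]_x (a%:E : \bar R) = a%:E)%E.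
Proof.
by rewrite (integral_cst P measurableT) -[RHS]mule1 -(@probability_setT _ _ _ P).
Qed.

(** Integrate |t| <= (a t^2 + 1/a) / 2.  With a parameter to choose, this
    replaces the Cauchy-Schwarz inequality here and avoids square roots. *)
Lemma integral_normr_le_sqr (f : T -> R) (a : R) : 0 < a ->
  measurable_fun setT f ->
  (\int[P]_x `|f x|%:E <=
     (a / 2)%:E * \int[P]_x (f x ^+ 2)%:E + (a^-1 / 2)%:E)%E.
Proof.
move=> a0 mf.
have aV : 0 < a^-1 by rewrite invr_gt0.
have mf2 : measurable_fun setT (fun x => (f x ^+ 2)%:E).
  by apply/measurable_EFinP; exact: measurable_funX.
rewrite -ge0_integralZl_EFin//; last 2 first.
  by move=> x _; rewrite lee_fin sqr_ge0.
  by rewrite divr_ge0// ltW.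
have mg : measurable_fun setT (fun x => (a / 2)%:E * (f x ^+ 2)%:E)%E.
  by apply: emeasurable_funM => //; exact: measurable_cst.
have g0 x : setT x -> (0 <= (a / 2)%:E * (f x ^+ 2)%:E :> \bar R)%E.
  by move=> _; rewrite lee_fin mulr_ge0 ?sqr_ge0 ?divr_ge0 ?ltW.
rewrite -[X in (_ + X)%E]integral_cst_probability -ge0_integralD//; last first.
  by move=> x _; rewrite lee_fin divr_ge0 ?ltW.
apply: ge0_le_integral => //.
- by apply/measurable_EFinP; exact: measurableT_comp.
- exact: emeasurable_funD.
- move=> x _; rewrite -EFinM -EFinD lee_fin.
  have := sqr_ge0 (a * `|f x| - 1).
  rewrite sqrrB1 exprMn real_normK ?num_real// => h.
  rewrite -(ler_pM2l (mulr_gt0 (ltr0n R 2) a0)).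
  have -> : 2 * a * (a / 2 * f x ^+ 2 + a^-1 / 2) = a ^+ 2 * f x ^+ 2 + 1.
    by field; rewrite gt_eqF.
  by rewrite -mulrA mulr_natl; lra.
Qed.

End probability_integrals.

(** * The Riesz-Markov theorem on a compact Hausdorff space *)

Section riesz_markov.
Context (R : realType) (K : compactHausdorffType).
Implicit Types (f g : K -> R) (U V F : set K).

Definition nonneg_continuous f := continuous f /\ forall x, 0 <= f x.

Lemma nonneg_continuousD f g : nonneg_continuous f -> nonneg_continuous g ->
  nonneg_continuous (fun x => f x + g x).
Proof.
move=> [cf f0] [cg g0]; split => [x|x]; last exact: addr_ge0.
by apply: cvgD; [exact: cf|exact: cg].
Qed.

Lemma nonneg_continuousM f g : nonneg_continuous f -> nonneg_continuous g ->
  nonneg_continuous (fun x => f x * g x).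
Proof.
move=> [cf f0] [cg g0]; split => [x|x]; last exact: mulr_ge0.
by apply: cvgM; [exact: cf|exact: cg].
Qed.

Lemma nonneg_continuous_cst (a : R) : 0 <= a -> nonneg_continuous (fun=> a).
Proof. by move=> a0; split => // x; exact: cvg_cst. Qed.

Lemma nonneg_continuousZ (a : R) f : 0 <= a -> nonneg_continuous f ->
  nonneg_continuous (fun x => a * f x).
Proof. by move=> a0 ?; apply: nonneg_continuousM => //; exact: nonneg_continuous_cst. Qed.

Lemma nonneg_continuousB f g : nonneg_continuous f -> nonneg_continuous g ->
  (forall x, g x <= f x) -> nonneg_continuous (fun x => f x - g x).
Proof.
move=> [cf f0] [cg g0] gf; split => [x|x]; last by rewrite subr_ge0.
by apply: cvgB; [exact: cf|exact: cg].
Qed.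

(** The positive part of f - e.  It replaces f by a function whose support
    lies in the closed set where f is at least e, and compactness applies to
    that set. *)
Definition cutoff (e : R) f x := Num.max (f x - e) 0.

Lemma nonneg_continuous_cutoff e f : nonneg_continuous f ->
  nonneg_continuous (cutoff e f).
Proof.
move=> [cf f0]; split => [x|x]; last by rewrite /cutoff le_max lexx orbT.
apply: (@continuous_max R K (fun x => f x - e) (fun=> 0)); last exact: cvg_cst.
by apply: cvgB; [exact: cf|exact: cvg_cst].
Qed.

Lemma urysohn_open F U : closed F -> open U -> F `<=` U ->
  exists f, [/\ nonneg_continuous f, forall x, f x <= 1,
    forall x, F x -> f x = 1 & forall x, ~ U x -> f x = 0].
Proof.
move=> cF oU FU.
have nK : normal_space K by apply: compact_normal; [exact: hausdorffT|exact: compactT].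
have FU0 : (~` U) `&` F = set0.
  by apply/disjoints_subset; exact: subsetC.
have [f [cf f0 f1 fr]] := @urysohn_ext_itv K R nK _ _ 0 1
  (open_closedC oU) cF FU0 ltr01.
have f01 x : 0 <= f x <= 1 by have /= := fr (f x) (ex_intro2 _ _ x I erefl);
  rewrite in_itv.
exists f; split.
- by split => // x; have /andP[] := f01 x.
- by move=> x; have /andP[] := f01 x.
- by move=> x Fx; apply: f1; exists x.
- by move=> x Ux; apply: f0; exists x.
Qed.

(** The functional is only constrained on nonnegative functions, where
    additivity and homogeneity suffice; this is what the variation of a bounded
    functional provides directly. *)
Definition positive_functional (La : (K -> R) -> R) :=
  [/\ forall f, nonneg_continuous f -> 0 <= La f,
    forall f g, nonneg_continuous f -> nonneg_continuous g ->
      La (fun x => f x + g x) = La f + La g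
  & forall (a : R) f, 0 <= a -> nonneg_continuous f ->
      La (fun x => a * f x) = a * La f].

Variable La : (K -> R) -> R.
Hypothesis pLa : positive_functional La.

Lemma positive_functional_le f g : nonneg_continuous f -> nonneg_continuous g ->
  (forall x, f x <= g x) -> La f <= La g.
Proof.
move=> cf cg fg; have [La0 LaD _] := pLa.
have -> : g = (fun x => f x + (g x - f x)) by apply/funext => x; ring.
have cgf := nonneg_continuousB cg cf fg.
by rewrite LaD// lerDl La0.
Qed.

Lemma positive_functional0 : La (fun=> 0) = 0.
Proof.
have [_ _ LaZ] := pLa.
have -> : (fun=> 0) = (fun x : K => 0 * (fun=> 0) x) :> (K -> R).
  by apply/funext => x; rewrite mul0r.
by rewrite LaZ ?mul0r//; exact: (nonneg_continuous_cst (lexx 0)).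
Qed.

Definition subordinate U : set (K -> R) := [set f |
  [/\ nonneg_continuous f, forall x, f x <= 1 & forall x, ~ U x -> f x = 0]].

(** The measure that an open set must receive from a regular measure
    representing the functional. *)
Definition open_content U := sup [set La f | f in subordinate U].

Local Notation lam := open_content.

Lemma positive_functional1_ge0 : 0 <= La (fun=> 1).
Proof. by have [La0 _ _] := pLa; apply/La0/nonneg_continuous_cst. Qed.

Lemma subordinate_le f U : subordinate U f -> La f <= La (fun=> 1).
Proof.
by move=> [cf f1 _]; apply: positive_functional_le => //; exact: nonneg_continuous_cst.
Qed.

Lemma subordinate0 U : subordinate U (fun=> 0).
Proof. by split => [|x|//]; [exact: (nonneg_continuous_cst (lexx 0))|exact: ler01]. Qed.

Lemma open_content_has_sup U : has_sup [set La f | f in subordinate U].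
Proof.
split; first by exists (La (fun=> 0)), (fun=> 0) => //; exact: subordinate0.
by exists (La (fun=> 1)) => _ [f Uf <-]; exact: subordinate_le Uf.
Qed.

Lemma open_content_ub U f : subordinate U f -> La f <= lam U.
Proof.
by move=> Uf; apply: sup_upper_bound; [exact: open_content_has_sup|exists f].
Qed.

Lemma open_content_le U (M : R) :
  (forall f, subordinate U f -> La f <= M) -> lam U <= M.
Proof.
move=> H; apply: ge_sup; first by have [] := open_content_has_sup U.
by move=> _ [f Uf <-]; exact: H.
Qed.

Lemma open_content_ge0 U : 0 <= lam U.
Proof.
have [La0 _ _] := pLa; apply: le_trans (open_content_ub (subordinate0 U)).
exact/La0/nonneg_continuous_cst.
Qed.

Lemma open_content_homo U V : U `<=` V -> lam U <= lam V.
Proof.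
move=> UV; apply: open_content_le => f [cf f1 fU]; apply: open_content_ub.
by split => // x nV; apply: fU => /UV.
Qed.

Lemma open_contentT : lam setT = La (fun=> 1).
Proof.
apply/eqP; rewrite eq_le; apply/andP; split.
  by apply: open_content_le => f; exact: subordinate_le.
apply: open_content_ub; split => [|x|x /(_ I)//]; last exact: lexx.
exact: (nonneg_continuous_cst ler01).
Qed.

Lemma open_content0 : lam set0 = 0.
Proof.
apply/eqP; rewrite eq_le open_content_ge0 andbT.
apply: open_content_le => f [cf f1 f0].
have -> : f = fun=> 0 by apply/funext => x; rewrite f0.
by rewrite positive_functional0.
Qed.

(** Cutting off at height e costs at most e * La 1, because f is at most
    the cut off function plus the constant e. *)
Lemma positive_functional_cutoff (e : R) f : 0 <= e -> nonneg_continuous f ->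
  La f <= La (cutoff e f) + e * La (fun=> 1).
Proof.
move=> e0 cf; have [La0 LaD LaZ] := pLa.
rewrite -LaZ//; last exact: nonneg_continuous_cst.
have ? := @nonneg_continuous_cutoff e f cf.
have ? : nonneg_continuous (fun _ : K => e * 1).
  by rewrite mulr1; exact: nonneg_continuous_cst.
rewrite -LaD//; apply: positive_functional_le => //.
  exact: nonneg_continuousD.
by move=> x; rewrite /cutoff mulr1 -lerBlDr le_max lexx.
Qed.

Lemma closed_superlevel (e : R) f : nonneg_continuous f ->
  closed [set x | e <= f x].
Proof.
by move=> [cf _]; exact: (closed_comp (fun x _ => cf x) (@closed_ge R e)).
Qed.

Lemma superlevel_sub (e : R) f U : 0 < e -> subordinate U f ->
  [set x | e <= f x] `<=` U.
Proof.
move=> e0 [_ _ fU] x /= ex; apply: contrapT => /fU fx0.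
by move: ex; rewrite fx0 leNgt e0.
Qed.

Lemma cutoff_eq0 (e : R) f x : ~ e <= f x -> cutoff e f x = 0.
Proof. by move=> /negP; rewrite -ltNge => fe; rewrite /cutoff max_r//; lra. Qed.

Lemma cutoff_le (e : R) f x : 0 <= e -> nonneg_continuous f ->
  cutoff e f x <= f x.
Proof. by move=> e0 [_ f0]; rewrite /cutoff ge_max f0 andbT; lra. Qed.

Lemma subordinate_cutoff (e : R) U f : 0 <= e -> subordinate U f ->
  subordinate U (cutoff e f).
Proof.
move=> e0 [cf f1 fU]; split => [|x|x nU]; first exact: nonneg_continuous_cutoff.
  by apply: le_trans (f1 x); exact: cutoff_le.
by rewrite /cutoff fU// max_r//; lra.
Qed.

(** The part of f above height e lives on a compact subset of the union;
    a Urysohn function equal to 1 on the piece of it outside V, and to 0 outside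
    U, splits it into two functions subordinate to U and to V. *)
Lemma open_contentU U V : open U -> open V -> lam (U `|` V) <= lam U + lam V.
Proof.
move=> oU oV; apply: open_content_le => f UVf.
have [cf f1 fUV] := UVf.
apply: (le_of_eps_mul positive_functional1_ge0) => e e0.
apply: (le_trans (positive_functional_cutoff (ltW e0) cf)).
rewrite lerD2r.
have cF := @closed_superlevel e f cf.
have FV : [set x | e <= f x] `&` ~` V `<=` U.
  by move=> x [/(superlevel_sub e0 UVf)[]].
have cFV : closed ([set x | e <= f x] `&` ~` V).
  by apply: closedI => //; exact: open_closedC.
(* p is 1 on the part of F outside V, so (1 - p) f vanishes outside V *)
have [p [cp p1 pF pU]] := urysohn_open cFV oU FV.
have cc := @nonneg_continuous_cutoff e f cf.
have c1p : nonneg_continuous (fun x => 1 - p x).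
  by apply: nonneg_continuousB => //; exact: nonneg_continuous_cst.
have -> : cutoff e f = (fun x => cutoff e f x * p x + cutoff e f x * (1 - p x)).
  by apply/funext => x; ring.
have [_ f1c _] := subordinate_cutoff (ltW e0) UVf.
have [_ LaD _] := pLa; rewrite LaD; [|exact: nonneg_continuousM..].
apply: lerD; apply: open_content_ub; split => [|x|x nx].
- exact: nonneg_continuousM.
- by apply: mulr_ile1 => //; [exact: cc.2|exact: cp.2].
- by rewrite pU// mulr0.
- exact: nonneg_continuousM.
- apply: mulr_ile1 => //; [exact: cc.2|exact: c1p.2|].
  by rewrite gerBl cp.2.
- have [ef|ef] := pselect (e <= f x); last by rewrite cutoff_eq0// mul0r.
  by rewrite pF// subrr mulr0.
Qed.

Lemma open_content_bigsetU (U : nat -> set K) n : (forall i, open (U i)) ->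
  lam (\big[setU/set0]_(i < n) U i) <= \sum_(i < n) lam (U i).
Proof.
move=> oU; elim: n => [|n IH]; first by rewrite !big_ord0 open_content0.
rewrite !big_ord_recr/=; apply: le_trans (open_contentU _ _) _ => //.
  by rewrite -bigcup_mkord; exact: bigcup_open.
by rewrite lerD2r.
Qed.

(** By compactness of the set where f is at least d, a function subordinate
    to a countable union is, up to a cutoff, subordinate to a finite one. *)
Lemma open_content_bigcup (U : nat -> set K) (e : R) : 0 < e ->
  (forall i, open (U i)) ->
  exists n, lam (\bigcup_i U i) <= \sum_(i < n) lam (U i) + e.
Proof.
move=> e0 oU.
have e20 : 0 < e / 2 by lra.
have [_ [f Uf <-] lt] := sup_adherent e20 (open_content_has_sup (\bigcup_i U i)).
have [cf f1 fU] := Uf.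
(* the cutoff at height d costs at most d * La 1 <= e / 2 *)
pose d := e / 2 / (La (fun=> 1) + 1).
have La1p : 0 < La (fun=> 1) + 1 by have := positive_functional1_ge0; lra.
have d0 : 0 < d by exact: divr_gt0.
have cF := @closed_superlevel d f cf.
have FU := superlevel_sub d0 Uf.
have cptF : compact [set x | d <= f x].
  exact: subclosed_compact cF (@compactT K) _.
rewrite compact_cover in cptF.
have [D _ FD] := cptF nat setT U (fun i _ => oU i) FU.
exists (\max_(i <- finmap.enum_fset D) i).+1.
set n := (\max_(i <- _) i).+1.
have FDn : [set x | d <= f x] `<=` \big[setU/set0]_(i < n) U i.
  move=> x /FD [i iD Ux]; rewrite -bigcup_mkord; exists i => //=.
  by rewrite ltnS; apply: (@leq_bigmax_seq _ _ xpredT id).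
have h1 : La (cutoff d f) <= \sum_(i < n) lam (U i).
  apply: le_trans (open_content_bigsetU _ oU); apply: open_content_ub.
  have [cc c1 _] := subordinate_cutoff (ltW d0) Uf.
  by split => // x nx; apply: cutoff_eq0 => /FDn.
have h2 := positive_functional_cutoff (ltW d0) cf.
have h3 : d * La (fun=> 1) <= e / 2.
  by rewrite /d mulrAC ler_pdivrMr// ler_wpM2l ?(ltW e20)//; lra.
by rewrite /lam /open_content; lra.
Qed.

(** The inequality behind the Caratheodory criterion for U.  Remove from V
    the closed set on which a nearly optimal function for the intersection
    exceeds a small height: what is left is an open W containing the rest of V,
    and functions subordinate to the two pieces add up to one subordinate to
    V. *)
Lemma open_content_split V U (e : R) : 0 < e -> open V -> open U ->
  exists W, [/\ open W, V `&` ~` U `<=` W &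
    lam (V `&` U) + lam W <= lam V + e].
Proof.
move=> e0 oV oU.
have e30 : 0 < e / 3 by lra.
have [_ [f Uf <-] lt] := sup_adherent e30 (open_content_has_sup (V `&` U)).
have [cf f1 fU] := Uf.
(* one third of e pays for the cutoff, the others for the two suprema *)
pose d := e / 3 / (La (fun=> 1) + 1).
have La1p : 0 < La (fun=> 1) + 1 by have := positive_functional1_ge0; lra.
have d0 : 0 < d by exact: divr_gt0.
have cF := @closed_superlevel d f cf.
have FU := superlevel_sub d0 Uf.
exists (V `&` ~` [set x | d <= f x]); split.
- by apply: openI => //; exact: closed_openC.
- by move=> x [Vx nUx]; split => // /FU[].
have [_ [g Wg <-] lt'] := sup_adherent e30
  (open_content_has_sup (V `&` ~` [set x | d <= f x])).
have [cg g1 gW] := Wg.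
have h3 : d * La (fun=> 1) <= e / 3.
  by rewrite /d mulrAC ler_pdivrMr// ler_wpM2l ?(ltW e30)//; lra.
have h2 := positive_functional_cutoff (ltW d0) cf.
have [cc c1 cVU] := subordinate_cutoff (ltW d0) Uf.
have h4 : La (cutoff d f) + La g <= lam V.
  have [_ LaD _] := pLa; rewrite -LaD//; apply: open_content_ub; split => [|x|x nV].
  - exact: nonneg_continuousD.
  - have [df|df] := pselect (d <= f x).
      by rewrite gW ?addr0//=; case.
    by rewrite cutoff_eq0// add0r.
  - by rewrite cVU ?gW ?addr0//; case.
rewrite /lam /open_content in h4 *; lra.
Qed.

End riesz_markov.

Section riesz_markov_measure.
Context (R : realType) (K : compactHausdorffType).
Implicit Types (f g : K -> R) (U V F : set K).

Lemma measurable_open U : open U -> measurable (U : set (borel K)).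
Proof. by move=> oU; exact: sub_sigma_algebra. Qed.

Lemma measurable_closed F : closed F -> measurable (F : set (borel K)).
Proof.
move=> cF; rewrite -[F]setCK; apply: measurableC.
by apply: measurable_open; exact: closed_openC.
Qed.

Lemma continuous_measurable_borel f : continuous f ->
  measurable_fun setT (f : borel K -> R).
Proof.
move=> /continuousP cf; apply: (measurability _ (measurable_realfun.RGenOpens.measurableE R)).
move=> _ [_ [a [b ->] <-]]; rewrite setTI; apply: measurable_open.
exact: cf (interval_open _ _).
Qed.

Lemma nonneg_continuous_bounded f : nonneg_continuous f ->
  exists2 M : R, 0 < M & forall x, f x <= M.
Proof.
move=> [cf f0].
have cpt : compact [set f x | x in [set: K]].
  by apply: continuous_compact; [exact: continuous_subspaceT|exact: compactT].
have [M [_ HM]] := compact_bounded cpt.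
exists (`|M| + 1) => [|x]; first by have := normr_ge0 M; lra.
apply: le_trans (ler_norm _) _; apply: HM; last by exists x.
by have := ler_norm M; lra.
Qed.

Variable La : (K -> R) -> R.
Hypothesis pLa : positive_functional La.
Local Notation lam := (open_content La).

Definition outer_content (A : set K) : R :=
  inf [set lam U | U in [set U | open U /\ A `<=` U]].

Lemma outer_content_has_inf A :
  has_inf [set lam U | U in [set U | open U /\ A `<=` U]].
Proof.
split; first by exists (lam setT), setT => //; split => //; exact: openT.
by exists 0 => _ [U _ <-]; exact: open_content_ge0.
Qed.

Lemma outer_content_lb A U : open U -> A `<=` U -> outer_content A <= lam U.
Proof.
move=> oU AU; apply: inf_lbound; last by exists U.
by have [] := outer_content_has_inf A.
Qed.

Lemma outer_content_adherent A (e : R) : 0 < e ->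
  exists U, [/\ open U, A `<=` U & lam U < outer_content A + e].
Proof.
move=> e0; have [_ [U [oU AU] <-] lt] := inf_adherent e0 (outer_content_has_inf A).
by exists U.
Qed.

Lemma outer_content_open U : open U -> outer_content U = lam U.
Proof.
move=> oU; apply/eqP; rewrite eq_le outer_content_lb//=.
apply: lb_le_inf; first by have [] := outer_content_has_inf U.
by move=> _ [V [oV UV] <-]; exact: open_content_homo.
Qed.

Lemma outer_content_ge0 A : 0 <= outer_content A.
Proof.
apply: lb_le_inf; first by have [] := outer_content_has_inf A.
by move=> _ [V [oV UV] <-]; exact: open_content_ge0.
Qed.

Lemma outer_content_homo A B : A `<=` B -> outer_content A <= outer_content B.
Proof.
move=> AB; apply/ler_addgt0Pr => e e0.
have [U [oU BU lt]] := outer_content_adherent B e0.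
by apply: le_trans (ltW lt); apply: outer_content_lb => // x /AB /BU.
Qed.

Lemma outer_content_sigma_subadditive :
  sigma_subadditive (fun A => (outer_content A)%:E).
Proof.
move=> F; apply/lee_addgt0Pr => e e0.
have e20 : 0 < e / 2 by lra.
have Uex i : exists U, [/\ open U, F i `<=` U &
    lam U < outer_content (F i) + e / 2 / 2 ^+ i.+1].
  by apply: outer_content_adherent; rewrite divr_gt0// exprn_gt0.
have [U HU] := choice Uex.
have oU i : open (U i) by have [] := HU i.
have [n ltn] := open_content_bigcup pLa e20 oU.
apply: (@le_trans _ _ (\sum_(i < n) (outer_content (F i))%:E + e%:E)%E).
  rewrite sumEFin -EFinD lee_fin.
  apply: (@le_trans _ _ (lam (\bigcup_i U i))).
    apply: outer_content_lb; first exact: bigcup_open.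
    by move=> x [i _ Fx]; exists i => //; have [_ + _] := HU i; exact.
  apply: (le_trans ltn).
  have h : \sum_(i < n) lam (U i) <=
      \sum_(i < n) (outer_content (F i) + e / 2 / 2 ^+ i.+1).
    by apply: ler_sum => i _; have [_ _ /ltW] := HU i.
  rewrite big_split/= in h.
  have := @sum_geometric_le R (e / 2) n (ltW e20); lra.
rewrite leeD2r// -(big_mkord xpredT (fun i => (outer_content (F i))%:E)).
by apply: nneseries_lim_ge => i _ _; rewrite lee_fin outer_content_ge0.
Qed.

Lemma outer_content0 : outer_content set0 = 0.
Proof. by rewrite outer_content_open ?open_content0//; exact: open0. Qed.

Lemma open_caratheodory U : open U -> forall A,
  outer_content (A `&` U) + outer_content (A `&` ~` U) <= outer_content A.
Proof.
move=> oU A; apply/ler_addgt0Pr => e e0.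
have e20 : 0 < e / 2 by lra.
have [V [oV AV lt]] := outer_content_adherent A e20.
have [W [oW VW lt']] := open_content_split pLa e20 oV oU.
have h1 : outer_content (A `&` U) <= lam (V `&` U).
  by apply: outer_content_lb; [exact: openI|exact: setSI].
have h2 : outer_content (A `&` ~` U) <= lam W.
  apply: outer_content_lb => // x [Ax Ux]; apply: VW; split => //; exact: AV.
lra.
Qed.

Lemma riesz_markov_content : La (fun=> 1) = 1 ->
  exists nu : probability (borel K) R,
    forall A, measurable A -> nu A = (outer_content A)%:E.
Proof.
move=> La1.
pose rho (A : set K) := (outer_content A)%:E.
have r0 : rho set0 = 0%E by rewrite /rho outer_content0.
have rge0 A : (0 <= rho A)%E by rewrite lee_fin outer_content_ge0.
have rhomo : {homo rho : A B / A `<=` B >-> (A <= B)%E}.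
  by move=> A B AB; rewrite lee_fin outer_content_homo.
pose om : {outer_measure set K -> \bar R} := HB.pack rho
  (isOuterMeasure.Build R K rho r0 rge0 rhomo outer_content_sigma_subadditive).
have sub : (@measurable _ (borel K)) `<=` om.-caratheodory.
  apply: smallest_sub.
    split; first exact: caratheodory_measurable_set0.
    - by move=> A mA; rewrite setTD; exact: caratheodory_measurable_setC.
    - by move=> A mA; exact: caratheodory_measurable_bigcup.
  move=> U oU; apply: le_caratheodory_measurable => A.
  by rewrite -EFinD lee_fin; exact: open_caratheodory.
pose nu0 (A : set (borel K)) := (outer_content A)%:E.
have nu0add : semi_sigma_additive nu0.
  move=> F mF tF mUF.
  by apply: (@caratheodory_measure_sigma_additive R K om F) => //;
    [move=> i; apply: sub; exact: mF|apply: sub].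
pose nu1 : {measure set (borel K) -> \bar R} :=
  HB.pack nu0 (isMeasure.Build _ (borel K) R nu0 r0 rge0 nu0add).
have nuT : nu1 setT = 1%E.
  rewrite /nu1/= /nu0 outer_content_open; last exact: openT.
  by rewrite open_contentT// La1.
pose nu : probability (borel K) R := HB.pack nu0 (Measure.on nu1)
  (Measure_isProbability.Build _ (borel K) R nu1 nuT).
by exists nu.
Qed.

End riesz_markov_measure.

Section riesz_markov_representation.
Context (R : realType) (K : compactHausdorffType).
Implicit Types (f g : K -> R) (U V F : set K).
Variable La : (K -> R) -> R.
Hypothesis pLa : positive_functional La.
Local Notation lam := (open_content La).

(** Outer regularity is built into the construction, and inner regularity
    is outer regularity of the complement, the measure being finite. *)
Lemma outer_content_regular (nu : probability (borel K) R) :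
  (forall A, measurable A -> nu A = (outer_content La A)%:E) ->
  regular_measure nu.
Proof.
move=> nuE A mA; split; apply/eqP; rewrite eq_le; apply/andP; split.
- apply/lee_addgt0Pr => e e0.
  have [U [oU AU lt]] := outer_content_adherent pLa (~` A) e0.
  have mU := measurable_open oU.
  apply: (@le_trans _ _ (nu (~` U) + e%:E)%E).
    rewrite probability_setC//.
    have := probability_setC nu mA.
    rewrite !nuE//; last exact: measurableC.
    rewrite (outer_content_open pLa oU) -!EFinB => -[AC].
    by rewrite -EFinD lee_fin; lra.
  rewrite leeD2r//; apply: ereal_sup_ubound; exists (~` U) => //.
  by split; [exact: open_closedC|rewrite -[A]setCK; exact: subsetC].
- apply: ge_ereal_sup => _ [F [cF FA] <-].
  by apply: le_measure => //; rewrite inE//; exact: measurable_closed.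
- apply: le_ereal_inf_tmp => _ [U [oU AU] <-].
  by apply: le_measure => //; rewrite inE//; exact: measurable_open.
- apply/lee_addgt0Pr => e e0.
  have [U [oU AU lt]] := outer_content_adherent pLa A e0.
  apply: (@le_trans _ _ (nu U)).
    by apply: ereal_inf_lbound; exists U.
  rewrite !nuE//; last exact: measurable_open.
  by rewrite (outer_content_open pLa oU) -EFinD lee_fin ltW.
Qed.

Let slice (a : R) f (i : nat) x := Num.min (cutoff (i%:R * a) f x) a.

(** Layer cake: the slices of f between the heights i * a and (i + 1) * a
    rebuild f up to height n * a. *)
Lemma sum_slice (a : R) f n x : 0 <= a -> 0 <= f x ->
  \sum_(i < n) slice a f i x = Num.min (f x) (n%:R * a).
Proof.
move=> a0 f0; elim: n => [|n IH].
  by rewrite big_ord0 mul0r min_r.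
rewrite big_ord_recr/= IH /slice /cutoff -natr1 mulrDl mul1r.
set b := n%:R * a.
by have [?|?] := leP (f x) b; have [?|?] := leP (f x) (b + a);
  have [?|?] := leP (f x - b) 0; have [?|?] := leP (f x - b) a;
  rewrite ?(min_l a0); try lra.
Qed.

Lemma sum_superlevel_le (a : R) f n x : 0 <= a -> 0 <= f x ->
  \sum_(i < n) a * \1_[set y | i%:R * a < f y] x <= f x + a.
Proof.
move=> a0 f0; elim: n => [|n IH]; first by rewrite big_ord0 addr_ge0.
rewrite big_ord_recr/= indicE.
have [nf|nf] := boolP (x \in _); last by rewrite mulr0 addr0.
rewrite mulr1 lerD2r; move: nf; rewrite inE/= => /ltW; apply: le_trans.
rewrite mulr_natl -[n in leRHS]card_ord -sumr_const.
apply: ler_sum => i _.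
by rewrite indicE; case: (_ \in _); rewrite ?mulr1// mulr0.
Qed.

Lemma open_superlevel (e : R) f : nonneg_continuous f ->
  open [set x | e < f x].
Proof. by move=> [cf _]; exact: (open_comp (fun x _ => cf x) (@open_gt R e)). Qed.

(** Each slice, divided by a, is subordinate to the open set where it does
    not vanish. *)
Lemma positive_functional_le_slices (a : R) f n : 0 < a -> nonneg_continuous f ->
  (forall x, f x <= n%:R * a) ->
  La f <= \sum_(i < n) a * lam [set y | i%:R * a < f y].
Proof.
move=> a0 cf fn.
have cs i : nonneg_continuous (slice a f i).
  have [cc c0] := nonneg_continuous_cutoff (i%:R * a) cf.
  split=> x; last by rewrite /slice le_min c0 ltW.
  by apply: (@continuous_min R K _ (fun=> a) x); [exact: cc|exact: cvg_cst].
have [_ LaD LaZ] := pLa.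
have {1}-> : f = (fun x => \sum_(i < n) slice a f i x).
  by apply/funext => x; rewrite sum_slice ?(ltW a0)// ?min_l// cf.2.
have sle i : La (slice a f i) <= a * lam [set y | i%:R * a < f y].
  have ac : nonneg_continuous (fun x => a^-1 * slice a f i x).
    by apply: nonneg_continuousZ => //; rewrite invr_ge0 ltW.
  have -> : slice a f i = fun x => a * (a^-1 * slice a f i x).
    by apply/funext => x; rewrite mulVKf// gt_eqF.
  rewrite LaZ ?(ltW a0)// ler_wpM2l ?(ltW a0)//.
  apply: open_content_ub => //; split => // x.
    by rewrite mulrC ler_pdivrMr// mul1r /slice ge_min lexx orbT.
  move=> /negP; rewrite -leNgt => fx.
  by rewrite /slice /cutoff max_r ?min_l ?mulr0 ?(ltW a0)//; lra.
have : La (fun x => \sum_(i < n) slice a f i x) =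
    \sum_(i < n) La (slice a f i) /\
    nonneg_continuous (fun x => \sum_(i < n) slice a f i x).
  elim: n {fn} => [|n [IH cIH]].
    have -> : (fun x => \sum_(i < 0) slice a f i x) = fun=> 0.
      by apply/funext => x; rewrite big_ord0.
    rewrite big_ord0 positive_functional0//; split => //.
    exact: (@nonneg_continuous_cst R K 0 (lexx 0)).
  have -> : (fun x => \sum_(i < n.+1) slice a f i x) =
      (fun x => \sum_(i < n) slice a f i x + slice a f n x).
    by apply/funext => x; rewrite big_ord_recr.
  rewrite big_ord_recr/= LaD// IH; split => //.
  exact: nonneg_continuousD.
move=> [-> _].
by apply: ler_sum => i _; exact: sle.
Qed.

(** Comparing the layer cake sum of f with its integral loses at most the
    height a of one slice. *)
Lemma positive_functional_le_integral (nu : probability (borel K) R) f :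
  (forall U, open U -> nu U = (lam U)%:E) -> nonneg_continuous f ->
  ((La f)%:E <= \int[nu]_x (f x)%:E)%E.
Proof.
move=> nuE cf; apply/lee_addgt0Pr => a a0.
have [M M0 fM] := nonneg_continuous_bounded cf.
have [n Mn] : exists n : nat, M <= n%:R * a.
  have [n ltn] : exists n : nat, M / a < n%:R.
    exists (Num.truncn (M / a)).+1; exact: truncnS_gt.
  by exists n; rewrite -ler_pdivrMr// ltW.
have fn x : f x <= n%:R * a by exact: le_trans (fM x) Mn.
have mU (i : nat) : measurable ([set y | i%:R * a < f y] : set (borel K)).
  by apply: measurable_open; exact: open_superlevel.
have mf := continuous_measurable_borel cf.1.
have mfE : measurable_fun setT (EFin \o (f : borel K -> R)).
  exact/measurable_EFinP.
rewrite -[X in (_ + X)%E](integral_cst_probability nu).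
rewrite -ge0_integralD//; last 2 first.
  by move=> x _; rewrite lee_fin cf.2.
  by move=> x _; rewrite lee_fin ltW.
have ig0 (i : nat) (x : borel K) :
    (0 <= a%:E * (\1_[set y | (i%:R * a < f y)%R] x)%:E :> \bar R)%E.
  by rewrite mule_ge0// lee_fin ?ltW// indicE; case: (_ \in _).
have mi (i : nat) : measurable_fun setT (fun x : borel K =>
    (a%:E * (\1_[set y | (i%:R * a < f y)%R] x)%:E)%E).
  apply: emeasurable_funM; first exact: measurable_cst.
  by apply/measurable_EFinP; exact: measurable_indic.
apply: (@le_trans _ _ (\int[nu]_x
   \sum_(i < n) (a%:E * (\1_[set y | (i%:R * a < f y)%R] x)%:E))%E).
  rewrite ge0_integral_sum//.
  apply: (@le_trans _ _ (\sum_(i < n) (a * lam [set y | i%:R * a < f y]))%:E).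
    by rewrite lee_fin; exact: positive_functional_le_slices.
  rewrite -sumEFin; apply: lee_sum => i _.
  rewrite ge0_integralZl_EFin ?(ltW a0)//; last by apply/measurable_EFinP; exact: measurable_indic.
  rewrite integral_indic// setIT EFinM -nuE//.
  exact: open_superlevel.
apply: ge0_le_integral => //.
- by move=> x _; exact: sume_ge0.
- exact: emeasurable_sum.
- exact: emeasurable_funD.
- move=> x _.
  have := @sum_superlevel_le a f n x (ltW a0) (cf.2 x).
  by rewrite -lee_fin -sumEFin.
Qed.

(** Domination by the measure serves to bound the functional, and the values
    on open sets serve to transfer its invariance to the measure. *)
Lemma riesz_markov : La (fun=> 1) = 1 ->
  exists nu : probability (borel K) R,
  [/\ regular_measure nu,
      forall U, open U -> nu U = (lam U)%:E
    & forall f, nonneg_continuous f -> ((La f)%:E <= \int[nu]_x (f x)%:E)%E].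
Proof.
move=> La1; have [nu nuE] := riesz_markov_content pLa La1.
have nuo U : open U -> nu U = (lam U)%:E.
  move=> oU; rewrite nuE ?outer_content_open//; exact: measurable_open.
exists nu; split => //; first exact: outer_content_regular.
by move=> f cf; exact: positive_functional_le_integral.
Qed.

End riesz_markov_representation.

(** * The variation of a bounded functional *)

Section continuous_multipliers.
Context (R : realType) (K : compactHausdorffType) (N : nat).
Local Notation V := 'cV[R[i]]_N.
Implicit Types (h : CKN R K N) (p : K -> R).

Lemma enorm_continuous h : continuous (fun x => enorm ((h : K -> V) x)).
Proof.
move=> x; apply: (@continuous_comp _ _ _
  (fun y => \sum_i rnorm ((h : K -> V) y i ord0) ^+ 2) (@Num.sqrt R));
  last exact: sqrt_continuous.
apply: cvg_big => [|i _]; first exact: add_continuous.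
have cr : continuous (fun y => rnorm ((h : K -> V) y i ord0)).
  move=> y; apply: continuous_comp; last exact: rnorm_continuous.
  by apply: entry_continuous; exact: CKN_continuous.
under [X in X @ _ --> _]eq_fun do rewrite expr2.
by rewrite expr2; apply: cvgM; exact: cr.
Qed.

Lemma CKN_subE (h k : CKN R K N) x :
  ((h - k : CKN R K N) : K -> V) x = (h : K -> V) x - (k : K -> V) x.
Proof. by congr (_ + _); exact: scaleN1r. Qed.

Lemma CKN_mulc p h : continuous p ->
  continuous (fun x => (p x)%:C *: (h : K -> V) x).
Proof.
move=> cp; apply: mx_continuousP => i j x.
under [X in continuous_at _ X]funext do rewrite mxE.
apply: cvgM; last by apply: entry_continuous; exact: CKN_continuous.
by apply: (continuous_comp (cp x)); exact: real_complex_continuous.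
Qed.

Definition CKN_mul p (cp : continuous p) h : CKN R K N := mkcts (@CKN_mulc p h cp).

End continuous_multipliers.

Section variation.
Context (R : realType) (K : compactHausdorffType) (N : nat).
Local Notation V := 'cV[R[i]]_N.
Implicit Types (h : CKN R K N) (f p : K -> R).

(** Real linearity and norm at most 1; the functionals of interest are real
    parts of complex ones. *)
Definition bounded_real_functional (L : CKN R K N -> R) :=
  [/\ forall h h', L (h + h') = L h + L h',
    forall (a : R) h, L (a%:C *: h) = a * L h
  & forall h, L h <= supnorm h].

Definition dominated f : set (CKN R K N) :=
  [set h | forall x, enorm ((h : K -> V) x) <= f x].

(** For a functional given by integration against a vector measure this is
    integration against the total variation of that measure. *)
Definition functional_variation (L : CKN R K N -> R) f :=
  sup [set L h | h in dominated f].

Context (L : CKN R K N -> R).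
Hypothesis bL : bounded_real_functional L.
Local Notation tv := (functional_variation L).

Lemma functional0 : L 0 = 0.
Proof.
have [LD LZ _] := bL; have := LZ 0 0.
by rewrite scaler0 mul0r.
Qed.

Lemma dominated0 f : nonneg_continuous f -> dominated f 0.
Proof. by move=> [_ f0] x; rewrite [leLHS](enorm0 R N). Qed.

Lemma functional_variation_has_sup f : nonneg_continuous f ->
  has_sup [set L h | h in dominated f].
Proof.
move=> cf; split; first by exists (L 0), 0 => //; exact: dominated0.
have [M _ fM] := nonneg_continuous_bounded cf.
exists M => _ [h hf <-]; have [_ _ Lb] := bL.
by apply: le_trans (Lb h) _; apply: supnorm_le => x; exact: le_trans (hf x) _.
Qed.

Lemma functional_variation_ub f h : nonneg_continuous f -> dominated f h ->
  L h <= tv f.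
Proof.
move=> cf hf; apply: sup_upper_bound; last by exists h.
exact: functional_variation_has_sup.
Qed.

Lemma functional_variation_le f (M : R) : nonneg_continuous f ->
  (forall h, dominated f h -> L h <= M) -> tv f <= M.
Proof.
move=> cf H; apply: ge_sup; first by have [] := functional_variation_has_sup cf.
by move=> _ [h hf <-]; exact: H.
Qed.

Lemma functional_variation_ge0 f : nonneg_continuous f -> 0 <= tv f.
Proof.
by move=> cf; rewrite -functional0; apply: functional_variation_ub => //; exact: dominated0.
Qed.

Lemma functional_variation_superadditive f p :
  nonneg_continuous f -> nonneg_continuous p ->
  tv f + tv p <= tv (fun x => f x + p x).
Proof.
move=> cf cp; rewrite -lerBrDr; apply: functional_variation_le => // h hf.
rewrite lerBrDr addrC -lerBrDr; apply: functional_variation_le => // k kp.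
have [LD _ _] := bL.
rewrite lerBrDr addrC -LD; apply: functional_variation_ub.
  exact: nonneg_continuousD.
move=> x; apply: (le_trans (enormD (h x) (k x))); exact: lerD.
Qed.

Lemma continuous_ratio f p (e : R) : 0 < e ->
  nonneg_continuous f -> nonneg_continuous p ->
  continuous (fun x => f x / (p x + e)).
Proof.
move=> e0 [cf f0] [cp p0] x; apply: cvgM; first exact: cf.
apply: cvgV; first by rewrite gt_eqF// ltr_wpDl.
by apply: cvgD; [exact: cp|exact: cvg_cst].
Qed.

(** A function dominated by f + p is split in proportion to f and p.  The
    constant e in the denominators keeps the ratios continuous where f + p
    vanishes; the remainder has norm at most e. *)
Lemma functional_variation_subadditive f p :
  nonneg_continuous f -> nonneg_continuous p ->
  tv (fun x => f x + p x) <= tv f + tv p.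
Proof.
move=> cf cp; have cfp := nonneg_continuousD cf cp.
apply: functional_variation_le => // h hfp; apply/ler_addgt0Pr => e e0.
have [LD LZ Lb] := bL.
pose s x := f x + p x.
pose h1 := CKN_mul (continuous_ratio e0 cf cfp) h.
pose h2 := CKN_mul (continuous_ratio e0 cp cfp) h.
have s0 x : 0 <= s x by exact: cfp.2.
have se0 x : 0 < s x + e by rewrite ltr_wpDl.
have dom q x : 0 <= q x -> enorm ((q x / (s x + e))%:C *: (h : K -> V) x) <= q x.
  move=> q0; rewrite enormZ_real; last by rewrite divr_ge0// ltW.
  rewrite mulrAC ler_pdivrMr// ler_wpM2l//.
  by apply: le_trans (hfp x) _; rewrite lerDl ltW.
have h1f : dominated f h1 by move=> x; apply: dom; exact: cf.2.
have h2p : dominated p h2 by move=> x; apply: dom; exact: cp.2.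
have hE : h = (h1 + h2) + (h - (h1 + h2)) by rewrite addrC subrK.
rewrite hE LD (LD h1); apply: lerD.
  by apply: lerD; exact: functional_variation_ub.
apply: le_trans (Lb _) _; apply: supnorm_le => x.
have -> : ((h - (h1 + h2)) : K -> V) x = (e / (s x + e))%:C *: (h : K -> V) x.
  rewrite CKN_subE -[((h1 + h2 : CKN R K N) : K -> V) x]/((h1 : K -> V) x + (h2 : K -> V) x).
  rewrite /h1 /h2 /CKN_mul /mkcts/= -scalerDl -[X in X - _]scale1r -scalerBl.
  congr (_ *: _); rewrite -rmorphD -[X in X - _](rmorph1 (real_complex R)).
  rewrite -rmorphB/=; congr (_%:C).
  rewrite -mulrDl -/(s x); have : s x + e != 0 by rewrite gt_eqF.
  by move=> ?; field.
rewrite enormZ_real; last by rewrite divr_ge0// ltW.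
rewrite mulrAC ler_pdivrMr// ler_wpM2l ?(ltW e0)//.
by apply: le_trans (hfp x) _; rewrite lerDl ltW.
Qed.

Lemma functional_variation_positive : positive_functional tv.
Proof.
have [LD LZ _] := bL.
have tvZ (a : R) f : 0 < a -> nonneg_continuous f ->
    a * tv f <= tv (fun x => a * f x).
  move=> a0 cf; rewrite mulrC -ler_pdivlMr//; apply: functional_variation_le => // h hf.
  rewrite ler_pdivlMr// mulrC -LZ; apply: functional_variation_ub.
    by apply: nonneg_continuousZ => //; exact: ltW.
  by move=> x; rewrite [leLHS]enormZ_real ?(ltW a0)// ler_wpM2l ?(ltW a0).
split.
- exact: functional_variation_ge0.
- move=> f p cf cp; apply/eqP; rewrite eq_le.
  by rewrite functional_variation_subadditive// functional_variation_superadditive.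
- move=> a f a0 cf; have [->|an0] := eqVneq a 0.
    have -> : (fun x => 0 * f x) = (fun=> 0) by apply/funext => x; rewrite mul0r.
    rewrite mul0r; apply/eqP; rewrite eq_le.
    have c0 := @nonneg_continuous_cst R K 0 (lexx 0).
    rewrite functional_variation_ge0// andbT; apply: functional_variation_le => // h h0.
    suff -> : h = 0 by rewrite functional0.
    by apply: CKN_eq => x; apply: enorm0_eq0; apply/eqP; rewrite eq_le h0 enorm_ge0.
  have ap : 0 < a by rewrite lt_neqAle eq_sym an0.
  apply/eqP; rewrite eq_le tvZ// andbT.
  have caf := nonneg_continuousZ a0 cf.
  have aV : 0 < a^-1 by rewrite invr_gt0.
  have := tvZ a^-1 _ aV caf.
  rewrite ler_pdivrMl//; congr (_ <= a * tv _).
  by apply/funext => x; rewrite mulKf.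
Qed.

Lemma le_functional_variation h : L h <= tv (fun x => enorm ((h : K -> V) x)).
Proof.
apply: functional_variation_ub => //; split; first exact: enorm_continuous.
by move=> x; exact: enorm_ge0.
Qed.

End variation.

(** * Invariant functionals under unique ergodicity *)

Section unique_ergodicity.
Context (R : realType) (G : semitopSemigroupType) (K : compactHausdorffType).

Lemma measurable_preimage (g : K -> K) (A : set (borel K)) : continuous g ->
  measurable A -> measurable (g @^-1` A : set (borel K)).
Proof.
move=> /continuousP cg mA.
have mg : measurable_fun setT (g : borel K -> borel K).
  apply: (@measurability _ _ (borel K) (borel K) setT g (@open K)) => //.
  move=> B [U oU <-].
  by rewrite setTI; apply: measurable_open; exact: cg.
by rewrite -[X in measurable X]setTI; exact: mg.
Qed.

(** Complements turn the inequality on open sets into the opposite one on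
    closed sets.  A Borel set A is then handled through closed subsets F of its
    preimage: the image of F is compact, hence closed, contained in A, and its
    preimage contains F.  Complements once more give equality. *)
Lemma regular_measure_preimage (nu : probability (borel K) R) (g : K -> K) :
  continuous g -> regular_measure nu ->
  (forall U : set K, open U -> (nu U <= nu (g @^-1` U))%E) ->
  forall A : set (borel K), measurable A -> nu A = nu (g @^-1` A).
Proof.
move=> cg rnu nuU.
have closed_le (F : set K) : closed F -> (nu (g @^-1` F) <= nu F)%E.
  move=> cF; have oF := closed_openC cF.
  have mF := measurable_closed cF.
  have mgF := measurable_preimage cg mF.
  have := nuU _ oF; rewrite preimage_setC !probability_setC//.
  have : (nu F \is a fin_num) by exact: fin_num_measure.
  have : (nu (g @^-1` F) \is a fin_num) by exact: fin_num_measure.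
  move=> /fineK <- /fineK <-; rewrite -!EFinB !lee_fin; lra.
have le A : measurable (A : set (borel K)) -> (nu (g @^-1` A) <= nu A)%E.
  move=> mA; have mgA := measurable_preimage cg mA.
  have [-> _] := rnu _ mgA; apply: ge_ereal_sup => _ [F [cF FA] <-].
  (* K is compact Hausdorff: the continuous image of a closed set is closed *)
have cgF : closed (g @` F).
    apply: compact_closed; first exact: hausdorffT.
    apply: continuous_compact; first exact: continuous_subspaceT.
    exact: subclosed_compact cF (@compactT K) _.
  have mgF := measurable_closed cgF.
  apply: (@le_trans _ _ (nu (g @^-1` (g @` F)))).
    apply: le_measure; rewrite ?inE.
    - exact: measurable_closed.
    - exact: measurable_preimage.
    - by move=> x Fx; exists x.
  apply: (le_trans (closed_le _ cgF)).
  by apply: le_measure; rewrite ?inE// => _ [x /FA ? <-].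
move=> A mA; have mgA := measurable_preimage cg mA.
apply/eqP; rewrite eq_le le// andbT.
have := le _ (measurableC mA); rewrite preimage_setC !probability_setC//.
have : (nu A \is a fin_num) by exact: fin_num_measure.
have : (nu (g @^-1` A) \is a fin_num) by exact: fin_num_measure.
by move=> /fineK <- /fineK <-; rewrite -!EFinB !lee_fin; lra.
Qed.

Lemma action_continuous (phi : action G K) g : continuous (phi g).
Proof.
move=> x; apply: (@continuous_comp _ _ _ (fun y => (g, y))
  (fun p : G * K => phi p.1 p.2)); last exact: act_continuous.
by apply: cvg_pair; [exact: cvg_cst|exact: cvg_id].
Qed.

Lemma nonneg_continuous_comp (g : K -> K) (f : K -> R) : continuous g ->
  nonneg_continuous f -> nonneg_continuous (f \o g).
Proof.
move=> cg [cf f0]; split => x; last exact: f0.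
by apply: continuous_comp; [exact: cg|exact: cf].
Qed.

(** An inequality in the invariance hypothesis is enough, since it passes to
    open sets and [regular_measure_preimage] upgrades it to invariance of the
    measure. *)
Lemma invariant_positive_functional (phi : action G K)
    (mu : probability (borel K) R) (La : (K -> R) -> R) :
  uniquely_ergodic phi mu -> positive_functional La -> La (fun=> 1) = 1 ->
  (forall g f, nonneg_continuous f -> La f <= La (f \o phi g)) ->
  forall f, nonneg_continuous f -> ((La f)%:E <= \int[mu]_x (f x)%:E)%E.
Proof.
move=> [rmu imu umu] pLa La1 La_inv f cf.
have [nu [rnu nuE Lale]] := riesz_markov pLa La1.
have inu : invariant_measure phi nu.
  move=> g; apply: regular_measure_preimage => //; first exact: action_continuous.
  move=> U oU; have cg := @action_continuous phi g.
  have ogU : open (phi g @^-1` U) by move/continuousP : cg; exact.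
  rewrite !nuE// lee_fin; apply: open_content_le => // p [cp p1 pU].
  apply: le_trans (La_inv g _ cp) _; apply: open_content_ub => //; split.
  - exact: nonneg_continuous_comp.
  - by move=> x; exact: p1.
  - by move=> x nx; exact: pU.
have numu := umu nu rnu inu.
apply: (le_trans (Lale f cf)).
rewrite (@eq_measure_integral _ _ _ _ mu)// => A mA _; exact: numu.
Qed.

Context (N : nat).
Local Notation V := 'cV[R[i]]_N.

(** The variation of L is invariant because multiplication by a unitary
    matrix preserves lengths; after division by its value at 1 it is dominated by
    the only invariant probability measure. *)
Lemma invariant_functional_le_integral (phi : action G K)
    (mu : probability (borel K) R) (gam : cocycle R N phi)
    (L : CKN R K N -> R) :
  uniquely_ergodic phi mu -> bounded_real_functional L ->
  (forall g h, L (twisted_koopman gam g h) = L h) ->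
  exists2 c : R, 0 <= c & forall h : CKN R K N,
    ((L h)%:E <= c%:E * \int[mu]_x (enorm ((h : K -> V) x))%:E)%E.
Proof.
move=> ue bL Linv.
have ptv := functional_variation_positive bL.
pose tv := functional_variation L.
have c1 := @nonneg_continuous_cst R K 1 ler01.
pose c := tv (fun=> 1).
have c0 : 0 <= c by exact: functional_variation_ge0.
have cn (h : CKN R K N) : nonneg_continuous (fun x => enorm ((h : K -> V) x)).
  by split; [exact: enorm_continuous|move=> x; exact: enorm_ge0].
have [cz|cnz] := eqVneq c 0.
  exists 0 => // h; rewrite mul0e lee_fin.
  apply: (le_trans (le_functional_variation bL h)).
  apply: (@le_trans _ _ (tv (fun=> supnorm h * 1))).
    apply: positive_functional_le => //.
      by apply: nonneg_continuousZ => //; exact: supnorm_ge0.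
    by move=> x; rewrite mulr1; exact: supnorm_ub.
  have [_ _ tvZ] := ptv; rewrite /tv tvZ//; last exact: supnorm_ge0.
  by rewrite -/tv -/c cz mulr0.
have cp : 0 < c by rewrite lt_neqAle eq_sym cnz.
exists c => // h.
pose La f := c^-1 * tv f.
have cV : 0 <= c^-1 by rewrite invr_ge0.
have pLa : positive_functional La.
  have [t0 tD tZ] := ptv; split.
  - by move=> f cf; apply: mulr_ge0 => //; exact: t0.
  - by move=> f p cf cp'; rewrite /La /tv tD// mulrDr.
  - by move=> a f a0 cf; rewrite /La /tv tZ// mulrCA.
have La1 : La (fun=> 1) = 1 by rewrite /La mulVf.
have La_inv g f : nonneg_continuous f -> La f <= La (f \o phi g).
  move=> cf; rewrite /La ler_wpM2l//; apply: functional_variation_le => // k kf.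
  rewrite -(Linv g); apply: functional_variation_ub => //.
    by apply: nonneg_continuous_comp => //; exact: action_continuous.
  move=> x; rewrite [leLHS]enorm_unitary; last exact: cocycle_unitary.
  exact: kf.
have h1 := invariant_positive_functional ue pLa La1 La_inv (cn h).
apply: (le_trans (y := (c * La (fun x => enorm ((h : K -> V) x)))%:E)).
  by rewrite lee_fin /La mulVKf//; exact: le_functional_variation.
by rewrite EFinM; apply: lee_wpmul2l => //; rewrite lee_fin.
Qed.

End unique_ergodicity.

(** * Completeness in mean square *)

Section square_integrable_limit.
Context d (T : measurableType d) (R : realType) (P : probability T R).

Lemma nneseries_geometric_le : (\sum_(0 <= n <oo) ((2 ^- n)%:E : \bar R) <= 2%:E)%E.
Proof.
apply: lime_le; first by apply: is_cvg_nneseries => n _ _; rewrite lee_fin invr_ge0 exprn_ge0.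
near=> n; rewrite big_mkord sumEFin lee_fin.
have := @sum_geometric_le R 2 n (ler0n _ _).
congr (_ <= _); apply: eq_bigr => i _; rewrite exprS invfM mulVKf//.
Unshelve. all: by end_near. Qed.

Lemma limn_einf_le (u : (\bar R)^nat) (c : \bar R) :
  (forall n, u n <= c)%E -> (limn_einf u <= c)%E.
Proof.
move=> uc; rewrite limn_einf_lim; apply: lime_le; first exact: is_cvg_einfs.
near=> n; apply: le_trans (uc n); apply: ereal_inf_lbound; exists n => //=.
Unshelve. all: by end_near. Qed.

Context (f : nat -> T -> R).
Hypothesis mf : forall n, measurable_fun setT (f n).
Hypothesis f_cauchy : forall n m, (n <= m)%N ->
  (\int[P]_x ((f n x - f m x) ^+ 2)%:E <= (4 ^- n)%:E)%E.

Let jump n x := f n.+1 x - f n x.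

Let mjump n : measurable_fun setT (jump n).
Proof. exact: measurable_funB. Qed.

Let integral_jump n : (\int[P]_x `|jump n x|%:E <= (2 ^- n)%:E)%E.
Proof.
have n0 : 0 < 2 ^+ n :> R by rewrite exprn_gt0.
apply: (le_trans (integral_normr_le_sqr P n0 (mjump n))).
have -> : (2 ^- n : R)%:E = ((2 ^+ n / 2)%:E * (4 ^- n)%:E + (2 ^- n / 2)%:E)%E.
  have -> : (4 : R) = 2 * 2 by rewrite -natrM.
  rewrite -EFinM -EFinD exprMn; congr (_%:E).
  by field; rewrite gt_eqF.
apply: leeD => //; apply: lee_wpmul2l; first by rewrite lee_fin divr_ge0 ?ltW.
apply: le_trans (f_cauchy (leqnSn n)).
by under eq_integral do rewrite /jump -sqrrN opprB.
Qed.

Let ae_cvg : {ae P, forall x, cvgn (f ^~ x)}.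
Proof.
pose S x := (\sum_(0 <= n <oo) `|jump n x|%:E)%E.
have mS : measurable_fun setT S.
  apply: (@ge0_emeasurable_sum _ _ _ _ (fun n x => `|jump n x|%:E) xpredT) => //.
  by move=> n _; apply/measurable_EFinP; exact: measurableT_comp.
have S0 x : (0 <= S x)%E by apply: nneseries_ge0 => n _ _; rewrite lee_fin.
have iS : P.-integrable setT S.
  apply/integrableP; split => //.
  under eq_integral do rewrite gee0_abs//.
  rewrite integral_nneseries//; last first.
    by move=> n; apply/measurable_EFinP; exact: measurableT_comp.
  apply: (@le_lt_trans _ _ 2%:E); last by rewrite ltry.
  apply: le_trans nneseries_geometric_le; apply: lee_nneseries => [n _ _|n _].
    by apply: integral_ge0 => x _; rewrite lee_fin.
  exact: integral_jump.
apply: filterS (integrable_ae measurableT iS) => x /(_ I) Sx.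
have cj : cvgn (series (jump ^~ x)).
  apply: normed_cvg; apply: nondecreasing_is_cvgn.
    by apply/nondecreasing_seqP => n; rewrite [leRHS](seriesSr (fun n => `|jump n x|)) lerDl.
  exists (fine (S x)) => _ [n _ <-]; rewrite -lee_fin fineK//.
  rewrite /series/= -sumEFin; exact: nneseries_lim_ge.
have -> : f ^~ x = (fun n => f 0%N x + series (jump ^~ x) n).
  apply/funext => n; rewrite /series/= /jump.
  by rewrite (telescope_sumr (f ^~ x))// addrC subrK.
by apply: is_cvgD => //; exact: is_cvg_cst.
Qed.

(** The Riesz-Fischer argument for a sequence with a geometric rate: the
    jumps are summable almost everywhere, so the sequence converges there, and
    Fatou's lemma transfers the estimate to the limit. *)
Lemma square_integrable_limit : exists k : T -> R, measurable_fun setT k /\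
  forall n, (\int[P]_x ((f n x - k x) ^+ 2)%:E <= (4 ^- n)%:E)%E.
Proof.
(* an upper limit is measurable everywhere and is the limit almost everywhere *)
pose k x := fine (limn_esup (fun n => (f n x)%:E)).
have mk : measurable_fun setT k.
  apply: (measurableT_comp (@fine_measurable R setT measurableT)).
  by apply: measurable_fun_limn_esup => n; exact/measurable_EFinP.
exists k; split => // n.
have m2 m : measurable_fun setT (fun x => ((f n x - f (n + m)%N x) ^+ 2)%:E).
  by apply/measurable_EFinP; apply: measurable_funX; exact: measurable_funB.
apply: (@le_trans _ _ (\int[P]_x
    limn_einf (fun m => ((f n x - f (n + m)%N x) ^+ 2)%:E))%E); last first.
  apply: (le_trans (fatou P measurableT m2 _)).
    by move=> m x _; rewrite lee_fin sqr_ge0.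
  by apply: limn_einf_le => m; apply: f_cauchy; exact: leq_addr.
apply: ae_ge0_le_integral => //.
- by move=> x _; rewrite lee_fin sqr_ge0.
- by apply/measurable_EFinP; apply: measurable_funX; exact: measurable_funB.
- move=> x _; rewrite limn_einf_lim; apply: lime_ge; first exact: is_cvg_einfs.
  near=> m; apply: le_ereal_inf_tmp => _ [j _ <-]; by rewrite lee_fin sqr_ge0.
- apply: measurableT_comp; first exact: oppe_measurable.
  by apply: measurable_fun_limn_esup => m; apply: measurableT_comp.
apply: filterS ae_cvg => x cx _.
have /cvg_ex[l fl] := cx.
have kl : k x = l.
  have fE : (fun n => (f n x)%:E) @ \oo --> l%:E by apply: cvg_EFin => //; near=> j.
  by rewrite /k (cvg_limn_einf_sup fE).2.
have h : (fun m => ((f n x - f (n + m)%N x) ^+ 2)%:E) @ \oo --> ((f n x - l) ^+ 2)%:E.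
  apply: cvg_EFin; first by near=> j.
  rewrite expr2; under eq_fun do rewrite expr2.
  have hl : (fun m => f n x - f (n + m)%N x) @ \oo --> f n x - l.
    apply: cvgB; first exact: cvg_cst.
    exact: (cvg_comp (addn n) (f ^~ x) (cvg_addnl n) fl).
  exact: cvgM.
by rewrite (cvg_limn_einf_sup h).1 kl.
Unshelve. all: by end_near. Qed.

End square_integrable_limit.

(** * Mean squares of vector-valued functions *)

Section real_inner_product.
Context (R : realType) (N : nat).
Local Notation V := 'cV[R[i]]_N.
Implicit Types v w : V.

(** The real part of the Hermitian inner product, see [Re_sum_conj]. *)
Definition rdot v w : R := \sum_i
  (complex.Re (v i ord0) * complex.Re (w i ord0) +
   complex.Im (v i ord0) * complex.Im (w i ord0)).

Lemma enorm_sqr v : enorm v ^+ 2 = rdot v v.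
Proof.
rewrite /enorm sqr_sqrtr ?sum_sqr_ge0//; apply: eq_bigr => i _.
by case: (v i ord0) => a b; rewrite /rnorm normc_def/= sqr_sqrtr ?addr_ge0 ?sqr_ge0.
Qed.

Lemma enorm_sqr_ReIm v : enorm v ^+ 2 =
  \sum_i (complex.Re (v i ord0) ^+ 2 + complex.Im (v i ord0) ^+ 2).
Proof. by rewrite enorm_sqr; apply: eq_bigr => i _; rewrite !expr2. Qed.

Lemma enorm_sqr_comb (a b : R) v w : enorm (a%:C *: v + b%:C *: w) ^+ 2 =
  a ^+ 2 * enorm v ^+ 2 + 2 * a * b * rdot v w + b ^+ 2 * enorm w ^+ 2.
Proof.
rewrite !enorm_sqr /rdot !mulr_sumr -!big_split/=; apply: eq_bigr => i _.
by rewrite !mxE; case: (v i ord0) => ? ?; case: (w i ord0) => ? ? /=; ring.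
Qed.

Lemma rdot_split u v w : rdot u v = rdot u w + rdot u (v - w).
Proof.
rewrite /rdot -big_split/=; apply: eq_bigr => i _; rewrite !mxE.
by case: (v i ord0) => ? ?; case: (w i ord0) => ? ? /=; ring.
Qed.

Lemma normr_rdot_le (a : R) v w : 0 < a ->
  `|rdot v w| <= a / 2 * enorm v ^+ 2 + a^-1 / 2 * enorm w ^+ 2.
Proof.
move=> a0; have an0 : a != 0 by rewrite gt_eqF.
have h (b : R) : b ^+ 2 = 1 ->
    b * rdot v w <= a / 2 * enorm v ^+ 2 + a^-1 / 2 * enorm w ^+ 2.
  move=> b1; have := sqr_ge0 (enorm ((1%:C) *: v + (- b / a)%:C *: w)).
  rewrite enorm_sqr_comb exprMn sqrrN b1 expr1n !mul1r mulr1 => h.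
  have a20 : 0 < a / 2 by rewrite divr_gt0.
  have := mulr_ge0 (ltW a20) h.
  have -> : a / 2 * (enorm v ^+ 2 + 2 * (- b / a) * rdot v w +
    a^-1 ^+ 2 * enorm w ^+ 2) = a / 2 * enorm v ^+ 2 - b * rdot v w +
    a^-1 / 2 * enorm w ^+ 2 by field.
  by lra.
rewrite ler_norml -[X in X && _]lerN2 opprK -mulN1r.
by rewrite h ?sqrrN ?expr1n//= -[X in X <= _]mul1r h ?expr1n.
Qed.

Lemma enorm_sqr_add3 u v w : enorm (u + v + w) ^+ 2 <=
  3 * (enorm u ^+ 2 + enorm v ^+ 2 + enorm w ^+ 2).
Proof.
have h : enorm (u + v + w) <= enorm u + enorm v + enorm w.
  by apply: (le_trans (enormD _ _)); rewrite lerD2r; exact: enormD.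
apply: (@le_trans _ _ ((enorm u + enorm v + enorm w) ^+ 2)).
  by rewrite ler_pXn2r// nnegrE ?addr_ge0 ?enorm_ge0.
rewrite -subr_ge0; set a := enorm u; set b := enorm v; set c := enorm w.
have -> : 3 * (a ^+ 2 + b ^+ 2 + c ^+ 2) - (a + b + c) ^+ 2 =
  (a - b) ^+ 2 + (b - c) ^+ 2 + (a - c) ^+ 2 by ring.
by rewrite !addr_ge0 ?sqr_ge0.
Qed.

Lemma Re_sum_conj v w :
  complex.Re (\sum_i v i ord0 * (w i ord0)^*) = rdot v w.
Proof.
rewrite (raddf_sum (@complex.Re R)); apply: eq_bigr => i _.
by case: (v i ord0) => ? ?; case: (w i ord0) => ? ? /=; ring.
Qed.

End real_inner_product.

Section complex_measurability.
Context (R : realType) (K : compactHausdorffType).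
Implicit Types f h : K -> R[i].

Definition cmeasurable f :=
  measurable_fun setT (fun x : borel K => complex.Re (f x)) /\
  measurable_fun setT (fun x : borel K => complex.Im (f x)).

Lemma cmeasurableD f h : cmeasurable f -> cmeasurable h ->
  cmeasurable (fun x => f x + h x).
Proof.
move=> [fr fi] [hr hi]; split.
  have -> : (fun x : borel K => complex.Re (f x + h x)) =
    (fun x => complex.Re (f x) + complex.Re (h x)).
    by apply/funext => x; case: (f x); case: (h x).
  exact: measurable_funD.
have -> : (fun x : borel K => complex.Im (f x + h x)) =
  (fun x => complex.Im (f x) + complex.Im (h x)).
  by apply/funext => x; case: (f x); case: (h x).
exact: measurable_funD.
Qed.

Lemma cmeasurableB f h : cmeasurable f -> cmeasurable h ->
  cmeasurable (fun x => f x - h x).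
Proof.
move=> [fr fi] [hr hi]; split.
  have -> : (fun x : borel K => complex.Re (f x - h x)) =
    (fun x => complex.Re (f x) - complex.Re (h x)).
    by apply/funext => x; case: (f x); case: (h x).
  exact: measurable_funB.
have -> : (fun x : borel K => complex.Im (f x - h x)) =
  (fun x => complex.Im (f x) - complex.Im (h x)).
  by apply/funext => x; case: (f x); case: (h x).
exact: measurable_funB.
Qed.

Lemma cmeasurableM f h : cmeasurable f -> cmeasurable h ->
  cmeasurable (fun x => f x * h x).
Proof.
move=> [fr fi] [hr hi]; split.
  have -> : (fun x : borel K => complex.Re (f x * h x)) =
    (fun x => complex.Re (f x) * complex.Re (h x) -
              complex.Im (f x) * complex.Im (h x)).
    by apply/funext => x; case: (f x); case: (h x).
  by apply: measurable_funB; exact: measurable_funM.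
have -> : (fun x : borel K => complex.Im (f x * h x)) =
  (fun x => complex.Re (f x) * complex.Im (h x) +
            complex.Im (f x) * complex.Re (h x)).
  by apply/funext => x; case: (f x) => ? ?; case: (h x) => ? ? /=; ring.
by apply: measurable_funD; exact: measurable_funM.
Qed.

Lemma cmeasurable0 : cmeasurable (fun=> 0).
Proof. by split; exact: measurable_cst. Qed.

Lemma cmeasurable_sum n (f : 'I_n -> K -> R[i]) :
  (forall j, cmeasurable (f j)) -> cmeasurable (fun x => \sum_j f j x).
Proof.
elim: n f => [|n IH] f mf.
  have -> : (fun x => \sum_(j < 0) f j x) = (fun=> 0).
    by apply/funext => x; rewrite big_ord0.
  exact: cmeasurable0.
have -> : (fun x => \sum_j f j x) =
    (fun x => \sum_(j < n) f (widen_ord (leqnSn n) j) x + f ord_max x).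
  by apply/funext => x; rewrite big_ord_recr.
by apply: cmeasurableD => //; apply: (IH (fun j => f (widen_ord (leqnSn n) j))).
Qed.

Lemma cmeasurable_comp f (g : K -> K) : continuous g -> cmeasurable f ->
  cmeasurable (f \o g).
Proof.
move=> cg [fr fi].
have mg : measurable_fun setT (g : borel K -> borel K).
  by move=> _ A mA; rewrite setTI; exact: measurable_preimage.
by split; [exact: (measurableT_comp fr mg)|exact: (measurableT_comp fi mg)].
Qed.

Lemma continuous_cmeasurable f : continuous f -> cmeasurable f.
Proof.
move=> cf; split; apply: continuous_measurable_borel => x.
  by apply: (continuous_comp (cf x)); exact: Re_continuous.
by apply: (continuous_comp (cf x)); exact: Im_continuous.
Qed.

Context (N : nat).
Local Notation V := 'cV[R[i]]_N.

Definition vmeasurable (k : K -> V) := forall i, cmeasurable (fun x => k x i ord0).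

Lemma vmeasurableB (k h : K -> V) : vmeasurable k -> vmeasurable h ->
  vmeasurable (fun x => k x - h x).
Proof.
move=> mk mh i.
have -> : (fun x => (k x - h x) i ord0) = (fun x => k x i ord0 - h x i ord0).
  by apply/funext => x; rewrite !mxE.
exact: cmeasurableB.
Qed.

Lemma CKN_vmeasurable (h : CKN R K N) : vmeasurable (h : K -> V).
Proof.
move=> i; apply: continuous_cmeasurable; apply: entry_continuous.
exact: CKN_continuous.
Qed.

Lemma measurable_rdot (k h : K -> V) : vmeasurable k -> vmeasurable h ->
  measurable_fun setT (fun x : borel K => rdot (k x) (h x)).
Proof.
move=> mk mh; apply: measurable_sum => i.
have [? ?] := mk i; have [? ?] := mh i.
by apply: measurable_funD; apply: measurable_funM.
Qed.

Lemma measurable_enorm_sqr (k : K -> V) : vmeasurable k ->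
  measurable_fun setT (fun x : borel K => enorm (k x) ^+ 2).
Proof.
move=> mk; under eq_fun do rewrite enorm_sqr; exact: measurable_rdot.
Qed.

End complex_measurability.

Section mean_square_norm.
Context (R : realType) (G : semitopSemigroupType) (K : compactHausdorffType).
Context (N : nat) (mu : probability (borel K) R).
Local Notation V := 'cV[R[i]]_N.
Implicit Types (h u : CKN R K N) (k : K -> V).

Lemma continuous_integrable (f : K -> R) : continuous f ->
  mu.-integrable setT (EFin \o (f : borel K -> R)).
Proof.
move=> cf; have mf := continuous_measurable_borel cf.
have cn : nonneg_continuous (fun x => `|f x|).
  split => // x; apply: continuous_comp; [exact: cf|exact: norm_continuous].
have [M M0 fM] := nonneg_continuous_bounded cn.
apply/integrableP; split; first exact/measurable_EFinP.
apply: (@le_lt_trans _ _ (\int[mu]_x (M%:E : \bar R))%E); last first.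
  by rewrite integral_cst_probability ltry.
apply: ge0_le_integral => //.
  by apply/measurable_EFinP; exact: measurableT_comp.
by move=> x _; rewrite lee_fin.
Qed.

Lemma rdot_continuous h u :
  continuous (fun x => rdot ((h : K -> V) x) ((u : K -> V) x)).
Proof.
move=> x; apply: cvg_big => [|i _]; first exact: add_continuous.
have cR (w : CKN R K N) : continuous (fun y => complex.Re ((w : K -> V) y i ord0)).
  move=> y; apply: (@continuous_comp _ _ _
    (fun z => (w : K -> V) z i ord0) (@complex.Re R)); last exact: Re_continuous.
  by apply: entry_continuous; exact: CKN_continuous.
have cI (w : CKN R K N) : continuous (fun y => complex.Im ((w : K -> V) y i ord0)).
  move=> y; apply: (@continuous_comp _ _ _
    (fun z => (w : K -> V) z i ord0) (@complex.Im R)); last exact: Im_continuous.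
  by apply: entry_continuous; exact: CKN_continuous.
apply: cvgD; apply: cvgM; [exact: cR|exact: cR|exact: cI|exact: cI].
Qed.

Definition mean_square h : R := (\int[mu]_x (enorm ((h : K -> V) x) ^+ 2))%R.

Definition mean_dot h u : R :=
  (\int[mu]_x (rdot ((h : K -> V) x) ((u : K -> V) x)))%R.

Lemma integrable_rdot h u : mu.-integrable setT
  (EFin \o (fun x : borel K => rdot ((h : K -> V) x) ((u : K -> V) x))).
Proof. apply: continuous_integrable; exact: rdot_continuous. Qed.

Lemma integrable_enorm_sqr h : mu.-integrable setT
  (EFin \o (fun x : borel K => enorm ((h : K -> V) x) ^+ 2)).
Proof. by under [X in EFin \o X]funext do rewrite enorm_sqr; exact: integrable_rdot. Qed.

Lemma mean_squareE h :
  ((mean_square h)%:E = \int[mu]_x (enorm ((h : K -> V) x) ^+ 2)%:E)%E.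
Proof. by rewrite fineK//; exact: (integrable_fin_num measurableT (integrable_enorm_sqr h)). Qed.

Lemma mean_square_ge0 h : 0 <= mean_square h.
Proof. by apply: Rintegral_ge0 => x _; exact: sqr_ge0. Qed.

Lemma mean_square_comb (a b : R) h u : mean_square (a%:C *: h + b%:C *: u) =
  a ^+ 2 * mean_square h + 2 * a * b * mean_dot h u + b ^+ 2 * mean_square u.
Proof.
have iZ (r : R) (f : borel K -> R) : mu.-integrable setT (EFin \o f) ->
    mu.-integrable setT (EFin \o (fun x => r * f x)).
  by move=> fi; exact: (integrableZl measurableT r fi).
rewrite /mean_square /mean_dot.
rewrite -!RintegralZl//; [|exact: integrable_enorm_sqr|
  exact: integrable_rdot|exact: integrable_enorm_sqr].
have i1 := iZ (a ^+ 2) _ (integrable_enorm_sqr h).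
have i2 := iZ (2 * a * b) _ (integrable_rdot h u).
have i3 := iZ (b ^+ 2) _ (integrable_enorm_sqr u).
rewrite -!RintegralD//; last exact: (integrableD measurableT i1 i2).
by apply: eq_Rintegral => x _; rewrite -enorm_sqr_comb.
Qed.

Lemma mean_square_parallelogram h u : mean_square (h - u) =
  2 * mean_square h + 2 * mean_square u -
  4 * mean_square ((2^-1)%:C *: h + (2^-1)%:C *: u).
Proof.
have -> : h - u = (1 : R)%:C *: h + (-1 : R)%:C *: u.
  by rewrite rmorphN rmorph1 scale1r scaleN1r.
by rewrite !mean_square_comb; field.
Qed.

Section invariance.
Context (phi : action G K).
Hypothesis imu : invariant_measure phi mu.

(** An invariant measure equals its image under the action of g. *)
Lemma invariant_integral g (f : borel K -> \bar R) :
  measurable_fun setT f -> (forall x, 0 <= f x)%E ->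
  (\int[mu]_x f (phi g x) = \int[mu]_x f x)%E.
Proof.
move=> mf f0.
have mg : measurable_fun setT (phi g : borel K -> borel K).
  by move=> _ A mA; rewrite setTI; apply: measurable_preimage => //; exact: action_continuous.
have := @ge0_integral_pushforward _ _ _ _ R _ mg mu setT f measurableT mf.
rewrite preimage_setT => <-; last by move=> x _.
by apply: eq_measure_integral => A mA _; rewrite /pushforward [RHS](imu g).
Qed.

Lemma enorm_twisted (gam : cocycle R N phi) g k x :
  enorm (twisted gam g k x) = enorm (k (phi g x)).
Proof. by rewrite /twisted enorm_unitary//; exact: cocycle_unitary. Qed.

Lemma vmeasurable_twisted (gam : cocycle R N phi) g k :
  vmeasurable k -> vmeasurable (twisted gam g k).
Proof.
move=> mk i.
have -> : (fun x => twisted gam g k x i ord0) =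
    (fun x => \sum_j gam g x i j * k (phi g x) j ord0).
  by apply/funext => x; rewrite mxE.
apply: cmeasurable_sum => j; apply: cmeasurableM.
  apply: continuous_cmeasurable; apply: entry_continuous => x.
  apply: (@continuous_comp _ _ _ (fun y => (g, y))
    (fun p : G * K => gam p.1 p.2)); last exact: cocycle_continuous.
  by apply: cvg_pair; [exact: cvg_cst|exact: cvg_id].
apply: (@cmeasurable_comp _ _ (fun y => k y j ord0)) => //.
exact: action_continuous.
Qed.

Lemma integral_twisted (gam : cocycle R N phi) g k : vmeasurable k ->
  (\int[mu]_x (enorm (twisted gam g k x) ^+ 2)%:E =
   \int[mu]_x (enorm (k x) ^+ 2)%:E)%E.
Proof.
move=> mk; under eq_integral do rewrite enorm_twisted.
apply: (@invariant_integral g (fun x => (enorm (k x) ^+ 2)%:E)).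
  by apply/measurable_EFinP; exact: measurable_enorm_sqr.
by move=> x; rewrite lee_fin sqr_ge0.
Qed.

Lemma mean_square_twisted (gam : cocycle R N phi) g h :
  mean_square (twisted_koopman gam g h) = mean_square h.
Proof.
apply: EFin_inj; rewrite !mean_squareE; apply: integral_twisted.
exact: CKN_vmeasurable.
Qed.

End invariance.

(** Apply [square_integrable_limit] to the real and imaginary parts of the
    N coordinates, which explains the factor 2 N. *)
Lemma mean_square_limit (h : nat -> CKN R K N) :
  (forall n m, (n <= m)%N -> mean_square (h n - h m) <= 4 ^- n) ->
  exists k, vmeasurable k /\
    forall n, (\int[mu]_x (enorm (((h n : K -> V) x - k x)%R) ^+ 2)%:E <=
      (N%:R * 2 * 4 ^- n)%:E)%E.
Proof.
move=> hc.
have hm n i := CKN_vmeasurable (h n) i.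
have bound n m (f : borel K -> R) : (n <= m)%N ->
    measurable_fun setT f ->
    (forall x, f x ^+ 2 <= enorm ((h n - h m : CKN R K N) x) ^+ 2) ->
    (\int[mu]_x (f x ^+ 2)%:E <= (4 ^- n)%:E)%E.
  move=> nm mf fle.
  apply: (@le_trans _ _ (mean_square (h n - h m))%:E); last by rewrite lee_fin hc.
  rewrite mean_squareE; apply: ge0_le_integral => //.
  - by move=> x _; rewrite lee_fin sqr_ge0.
  - by apply/measurable_EFinP; exact: measurable_funX.
  - apply/measurable_EFinP; apply: measurable_enorm_sqr; exact: CKN_vmeasurable.
  - by move=> x _; rewrite lee_fin.
have entry n m i (x : K) : complex.Re ((h n : K -> V) x i ord0) -
      complex.Re ((h m : K -> V) x i ord0) =
      complex.Re (((h n - h m : CKN R K N) : K -> V) x i ord0) /\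
    complex.Im ((h n : K -> V) x i ord0) -
      complex.Im ((h m : K -> V) x i ord0) =
      complex.Im (((h n - h m : CKN R K N) : K -> V) x i ord0).
  have -> : ((h n - h m : CKN R K N) : K -> V) x i ord0 =
     (h n : K -> V) x i ord0 - (h m : K -> V) x i ord0.
    by rewrite CKN_subE !mxE.
  by case: ((h n : K -> V) x i ord0) => ? ?; case: ((h m : K -> V) x i ord0).
have le1 (v : V) i : complex.Re (v i ord0) ^+ 2 <= enorm v ^+ 2 /\
    complex.Im (v i ord0) ^+ 2 <= enorm v ^+ 2.
  rewrite enorm_sqr_ReIm (bigD1 i)//=.
  set s := \sum_(_ | _) _; have s0 : 0 <= s.
    by apply: sumr_ge0 => j _; rewrite addr_ge0 ?sqr_ge0.
  have := sqr_ge0 (complex.Re (v i ord0)); have := sqr_ge0 (complex.Im (v i ord0)).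
  by move=> ? ?; split; lra.
have exRe i : exists a : borel K -> R, measurable_fun setT a /\ forall n,
    (\int[mu]_x ((complex.Re ((h n : K -> V) x i ord0) - a x) ^+ 2)%:E <= (4 ^- n)%:E)%E.
  apply: square_integrable_limit => [n|n m nm]; first exact: (hm n i).1.
  apply: (bound n m) => //.
    by apply: measurable_funB; [exact: (hm n i).1|exact: (hm m i).1].
  by move=> x; rewrite (entry n m i x).1; exact: (le1 _ i).1.
have exIm i : exists a : borel K -> R, measurable_fun setT a /\ forall n,
    (\int[mu]_x ((complex.Im ((h n : K -> V) x i ord0) - a x) ^+ 2)%:E <= (4 ^- n)%:E)%E.
  apply: square_integrable_limit => [n|n m nm]; first exact: (hm n i).2.
  apply: (bound n m) => //.
    by apply: measurable_funB; [exact: (hm n i).2|exact: (hm m i).2].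
  by move=> x; rewrite (entry n m i x).2; exact: (le1 _ i).2.
have [a Ha] := choice exRe; have [b Hb] := choice exIm.
exists (fun x => \col_i (a i x +i* b i x)); split.
  move=> i; split.
    by under eq_fun do rewrite mxE; exact: (Ha i).1.
  by under eq_fun do rewrite mxE; exact: (Hb i).1.
move=> n.
have mR i : measurable_fun setT (fun x : borel K =>
    ((complex.Re ((h n : K -> V) x i ord0) - a i x) ^+ 2)%:E).
  apply/measurable_EFinP; apply: measurable_funX; apply: measurable_funB.
    exact: (hm n i).1.
  exact: (Ha i).1.
have mI i : measurable_fun setT (fun x : borel K =>
    ((complex.Im ((h n : K -> V) x i ord0) - b i x) ^+ 2)%:E).
  apply/measurable_EFinP; apply: measurable_funX; apply: measurable_funB.
    exact: (hm n i).2.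
  exact: (Hb i).1.
under eq_integral => x _.
  rewrite enorm_sqr_ReIm -sumEFin.
  under eq_bigr => i _.
    rewrite !mxE.
    have -> : complex.Re ((h n : K -> V) x i ord0 - (a i x +i* b i x)) =
      complex.Re ((h n : K -> V) x i ord0) - a i x.
      by case: ((h n : K -> V) x i ord0).
    have -> : complex.Im ((h n : K -> V) x i ord0 - (a i x +i* b i x)) =
      complex.Im ((h n : K -> V) x i ord0) - b i x.
      by case: ((h n : K -> V) x i ord0).
    rewrite EFinD.
    over.
  over.
rewrite ge0_integral_sum//; last 2 first.
- by move=> i; exact: emeasurable_funD.
- by move=> i x _; rewrite -EFinD lee_fin addr_ge0 ?sqr_ge0.
have -> : N%:R * 2 * 4 ^- n = \sum_(i < N) (4 ^- n + 4 ^- n) :> R.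
  by rewrite sumr_const card_ord -[RHS]mulr_natl; ring.
rewrite -sumEFin; apply: lee_sum => i _.
rewrite ge0_integralD//; last 2 first.
- by move=> x _; rewrite lee_fin sqr_ge0.
- by move=> x _; rewrite lee_fin sqr_ge0.
by rewrite EFinD; apply: leeD; [exact: (Ha i).2|exact: (Hb i).2].
Qed.

End mean_square_norm.

(** * Minimization of the mean square on a hyperplane *)

Section hilbert_argument.
Context (R : realType) (G : semitopSemigroupType) (K : compactHausdorffType).
Context (N : nat) (mu : probability (borel K) R) (phi : action G K).
Local Notation V := 'cV[R[i]]_N.
Context (gam : cocycle R N phi) (L : CKN R K N -> R) (u : CKN R K N).
Hypothesis imu : invariant_measure phi mu.
Hypothesis bL : bounded_real_functional L.
Hypothesis L_inv : forall g h, L (twisted_koopman gam g h) = L h.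
Local Notation qn := (mean_square mu).

(** A real hyperplane, preserved by the twisted Koopman operators. *)
Definition level_set : set (CKN R K N) := [set h | L h = L u].

Definition level_min : R := inf [set qn h | h in level_set].

Lemma level_min_has_inf : has_inf [set qn h | h in level_set].
Proof.
by split; [exists (qn u), u|exists 0 => _ [h _ <-]; exact: mean_square_ge0].
Qed.

Lemma level_min_lb h : level_set h -> level_min <= qn h.
Proof.
by move=> Ah; apply: inf_lbound; [have [] := level_min_has_inf|exists h].
Qed.

Lemma level_min_ge0 : 0 <= level_min.
Proof.
apply: lb_le_inf; first by have [] := level_min_has_inf.
by move=> _ [h _ <-]; exact: mean_square_ge0.
Qed.

Lemma level_set_comb (a b : R) h h' : a + b = 1 ->
  level_set h -> level_set h' -> level_set (a%:C *: h + b%:C *: h').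
Proof.
move=> ab Lh Lh'; have [LD LZ _] := bL.
by rewrite /level_set/= LD !LZ Lh Lh' -mulrDl ab mul1r.
Qed.

(** In the parallelogram law the midpoint stays on the hyperplane, so its
    mean square is at least the minimum. *)
Lemma level_set_near (d : R) h h' : level_set h -> level_set h' ->
  qn h <= level_min + d -> qn h' <= level_min + d -> qn (h - h') <= 4 * d.
Proof.
move=> Ah Ah' hd h'd; rewrite mean_square_parallelogram.
(* the coefficients of the midpoint *)
have half : 2^-1 + 2^-1 = 1 :> R by field.
have := level_min_lb (level_set_comb half Ah Ah'); lra.
Qed.

Lemma level_seq : exists h : nat -> CKN R K N,
  forall n, level_set (h n) /\ qn (h n) <= level_min + 4 ^- n / 4.
Proof.
have ex n : exists h, level_set h /\ qn h <= level_min + 4 ^- n / 4.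
  have e0 : 0 < 4 ^- n / 4 :> R by rewrite divr_gt0// invr_gt0 exprn_gt0.
  have [_ [h Ah <-] lt] := inf_adherent e0 level_min_has_inf.
  by exists h; split => //; exact: ltW.
by have [h Hh] := choice ex; exists h.
Qed.

(** In this section k is a limit in mean square of a minimizing sequence
    h. *)
Section minimizer.
Context (h : nat -> CKN R K N) (k : K -> V) (C : R).
Hypothesis hA : forall n, level_set (h n) /\ qn (h n) <= level_min + 4 ^- n / 4.
Hypothesis mk : vmeasurable k.
Hypothesis hk : forall n,
  (\int[mu]_x (enorm ((h n : K -> V) x - k x) ^+ 2)%:E <= (C * 4 ^- n)%:E)%E.

Let mhk n : vmeasurable (fun x => (h n : K -> V) x - k x).
Proof. by apply: vmeasurableB => //; exact: CKN_vmeasurable. Qed.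

Let mhk2 n : measurable_fun setT
  (fun x : borel K => (enorm ((h n : K -> V) x - k x) ^+ 2)%:E).
Proof. by apply/measurable_EFinP; apply: measurable_enorm_sqr. Qed.

Lemma minimizer_L2 : L2 mu k.
Proof.
split; first exact: mk.
apply: (@le_lt_trans _ _ (\int[mu]_x (3%:E *
   ((enorm ((h 0%N : K -> V) x) ^+ 2)%:E +
    (enorm ((h 0%N : K -> V) x - k x) ^+ 2)%:E)))%E).
  have m0 : measurable_fun setT (fun x : borel K => (enorm ((h 0%N : K -> V) x) ^+ 2)%:E).
    by apply/measurable_EFinP; apply: measurable_enorm_sqr; exact: CKN_vmeasurable.
  apply: ge0_le_integral => //.
  - by move=> x _; rewrite lee_fin sqr_ge0.
  - by apply/measurable_EFinP; exact: measurable_enorm_sqr.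
  - by apply: emeasurable_funM; [exact: measurable_cst|exact: emeasurable_funD].
  - move=> x _; rewrite -EFinD -EFinM lee_fin.
    have := enorm_sqr_add3 ((h 0%N : K -> V) x) (- ((h 0%N : K -> V) x - k x)) 0.
    by rewrite addr0 enorm0 enormN opprB addrC subrK expr0n/= addr0.
have m0 : measurable_fun setT (fun x : borel K => (enorm ((h 0%N : K -> V) x) ^+ 2)%:E).
  by apply/measurable_EFinP; apply: measurable_enorm_sqr; exact: CKN_vmeasurable.
rewrite ge0_integralZl_EFin//; last 2 first.
- by move=> x _; rewrite -EFinD lee_fin addr_ge0 ?sqr_ge0.
- exact: emeasurable_funD.
rewrite ge0_integralD//; last 2 first.
- by move=> x _; rewrite lee_fin sqr_ge0.
- by move=> x _; rewrite lee_fin sqr_ge0.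
rewrite -mean_squareE; apply: (@le_lt_trans _ _ (3%:E * ((qn (h 0%N))%:E + (C * 4 ^- 0)%:E))%E).
  by rewrite lee_wpmul2l// leeD2l.
by rewrite -EFinD -EFinM ltry.
Qed.

(** Write the difference of k and its image as the sum of three small terms:
    the error h n - k, its image, which has the same mean square, and the
    difference of h n and its image, two nearly minimizing elements to which
    [level_set_near] applies. *)
Lemma twisted_minimizer_le g n :
  (\int[mu]_x (enorm (twisted gam g k x - k x) ^+ 2)%:E <=
    ((6 * C + 3) * 4 ^- n)%:E)%E.
Proof.
pose S x := twisted gam g (fun y => (h n : K -> V) y - k y) x.
pose d := twisted_koopman gam g (h n) - h n.
have mS : vmeasurable S by exact: vmeasurable_twisted.
have mS2 : measurable_fun setT (fun x : borel K => (enorm (S x) ^+ 2)%:E).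
  by apply/measurable_EFinP; exact: measurable_enorm_sqr.
have md2 : measurable_fun setT (fun x : borel K => (enorm ((d : K -> V) x) ^+ 2)%:E).
  by apply/measurable_EFinP; apply: measurable_enorm_sqr; exact: CKN_vmeasurable.
have dle : qn d <= 4 ^- n.
  have [Ah hn] := hA n.
  have -> : 4 ^- n = 4 * (4 ^- n / 4) :> R by field; rewrite expf_neq0.
  apply: level_set_near => //; first by rewrite /level_set/= L_inv.
  by rewrite mean_square_twisted.
apply: (@le_trans _ _ (\int[mu]_x (3%:E * ((enorm (S x) ^+ 2)%:E +
   (enorm ((d : K -> V) x) ^+ 2)%:E + (enorm ((h n : K -> V) x - k x) ^+ 2)%:E)))%E).
  apply: ge0_le_integral => //.
  - by move=> x _; rewrite lee_fin sqr_ge0.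
  - apply/measurable_EFinP; apply: measurable_enorm_sqr; apply: vmeasurableB => //.
    exact: vmeasurable_twisted.
  - apply: emeasurable_funM; first exact: measurable_cst.
    by apply: emeasurable_funD => //; exact: emeasurable_funD.
  - move=> x _; rewrite -!EFinD -EFinM lee_fin.
    have -> : twisted gam g k x - k x =
        - S x + (d : K -> V) x + ((h n : K -> V) x - k x).
      rewrite /S /d CKN_subE /twisted mulmxBr.
      rewrite -[(twisted_koopman gam g (h n) : K -> V) x]/(gam g x *m (h n : K -> V) (phi g x)).
      by rewrite opprB !addrA subrK subrK.
    by apply: le_trans (enorm_sqr_add3 _ _ _) _; rewrite enormN.
rewrite ge0_integralZl_EFin//; last 2 first.
- by move=> x _; rewrite -!EFinD lee_fin !addr_ge0 ?sqr_ge0.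
- by apply: emeasurable_funD => //; exact: emeasurable_funD.
have nn (w : K -> V) (x : borel K) : setT x -> (0 <= (enorm (w x) ^+ 2)%:E)%E.
  by rewrite lee_fin sqr_ge0.
rewrite ge0_integralD//; last 3 first.
- by move=> x _; rewrite -!EFinD lee_fin !addr_ge0 ?sqr_ge0.
- exact: emeasurable_funD.
- exact: (nn (fun x => (h n : K -> V) x - k x)).
rewrite ge0_integralD//; last 2 first.
- exact: nn.
- exact: nn.
rewrite (integral_twisted imu gam g (mhk n)) -mean_squareE.
have -> : (6 * C + 3) * 4 ^- n = 3 * (C * 4 ^- n + 4 ^- n + C * 4 ^- n) :> R by ring.
rewrite EFinM lee_wpmul2l// !EFinD.
by apply: leeD => //; apply: leeD => //; rewrite lee_fin.
Qed.

Lemma minimizer_fixed : fixed_points_L2 mu gam k.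
Proof.
split; first exact: minimizer_L2.
move=> g; set w := fun x : borel K => enorm (twisted gam g k x - k x) ^+ 2.
have mw : measurable_fun setT (fun x => (w x)%:E).
  apply/measurable_EFinP; apply: measurable_enorm_sqr; apply: vmeasurableB => //.
  exact: vmeasurable_twisted.
have w0 : (\int[mu]_x `|(w x)%:E| = 0)%E.
  apply/eqP; rewrite eq_le integral_ge0// andbT.
  apply/lee_addgt0Pr => e e0; rewrite add0e.
  have [n lt] := geometric_small (6 * C + 3) e0.
  under eq_integral do rewrite abse_EFin ger0_norm ?sqr_ge0//.
  apply: (le_trans (twisted_minimizer_le g n)).
  by rewrite lee_fin ltW.
have := (ae_eq_integral_abs mu measurableT mw).1 w0.
apply: filterS => x /(_ I) wx.
have /eqP : w x = 0 by apply: EFin_inj; exact: wx.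
by rewrite sqrf_eq0 => /eqP /enorm0_eq0 /eqP; rewrite subr_eq0 => /eqP.
Qed.

Lemma integrable_rdot_measurable (w : K -> V) : vmeasurable w ->
  (\int[mu]_x (enorm (w x) ^+ 2)%:E < +oo)%E ->
  mu.-integrable setT (EFin \o (fun x : borel K => rdot ((u : K -> V) x) (w x))).
Proof.
move=> mw wfin.
have m1 : measurable_fun setT (fun x : borel K => rdot ((u : K -> V) x) (w x)).
  by apply: measurable_rdot => //; exact: CKN_vmeasurable.
apply/integrableP; split; first exact/measurable_EFinP.
have mu2 : measurable_fun setT (fun x : borel K => (enorm ((u : K -> V) x) ^+ 2)%:E).
  by apply/measurable_EFinP; apply: measurable_enorm_sqr; exact: CKN_vmeasurable.
have mw2 : measurable_fun setT (fun x : borel K => (enorm (w x) ^+ 2)%:E).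
  by apply/measurable_EFinP; apply: measurable_enorm_sqr.
apply: (@le_lt_trans _ _ (\int[mu]_x ((enorm ((u : K -> V) x) ^+ 2)%:E +
   (enorm (w x) ^+ 2)%:E))%E).
  apply: ge0_le_integral => //.
  - by apply/measurable_EFinP; exact: measurableT_comp.
  - exact: emeasurable_funD.
  - move=> x _; rewrite -EFinD lee_fin.
    apply: (le_trans (normr_rdot_le _ _ ltr01)).
    have := sqr_ge0 (enorm ((u : K -> V) x)); have := sqr_ge0 (enorm (w x)).
    by rewrite invr1; lra.
rewrite ge0_integralD//; last 2 first.
- by move=> x _; rewrite lee_fin sqr_ge0.
- by move=> x _; rewrite lee_fin sqr_ge0.
by rewrite -mean_squareE lte_add_pinfty// ltry.
Qed.

Hypothesis u_perp : forall w, fixed_points_L2 mu gam w ->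
  L2_inner mu (u : K -> V) w = 0.

(** The inner product of u with k vanishes, since k is a fixed function and u is
    orthogonal to all of them; so only the error h n - k contributes. *)
Lemma mean_dot_minimizer_le (a : R) n : 0 < a ->
  mean_dot mu u (h n) <= a / 2 * qn u + a^-1 / 2 * (C * 4 ^- n).
Proof.
move=> a0.
have fin n' : (\int[mu]_x (enorm ((h n' : K -> V) x - k x) ^+ 2)%:E < +oo)%E.
  by apply: (le_lt_trans (hk n')); rewrite ltry.
have ik := integrable_rdot_measurable mk minimizer_L2.2.
have ihk := integrable_rdot_measurable (mhk n) (fin n).
have uk : (\int[mu]_x (rdot ((u : K -> V) x) (k x)))%R = 0.
  have := congr1 (@complex.Re R) (u_perp minimizer_fixed); rewrite /L2_inner/=.
  by under eq_Rintegral do rewrite Re_sum_conj.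
have -> : mean_dot mu u (h n) =
    (\int[mu]_x (rdot ((u : K -> V) x) ((h n : K -> V) x - k x)))%R.
  rewrite -[RHS]add0r -uk -RintegralD//.
  by apply: eq_Rintegral => x _; exact: rdot_split.
rewrite -lee_fin /Rintegral fineK; last exact: integrable_fin_num.
have mu2 : measurable_fun setT (fun x : borel K => (enorm ((u : K -> V) x) ^+ 2)%:E).
  by apply/measurable_EFinP; apply: measurable_enorm_sqr; exact: CKN_vmeasurable.
have a2 : 0 <= a / 2 by rewrite divr_ge0// ltW.
have aV2 : 0 <= a^-1 / 2 by rewrite divr_ge0// invr_ge0 ltW.
apply: (@le_trans _ _ (\int[mu]_x ((a / 2)%:E * (enorm ((u : K -> V) x) ^+ 2)%:E +
   (a^-1 / 2)%:E * (enorm ((h n : K -> V) x - k x) ^+ 2)%:E))%E).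
  apply: (le_trans (lee_abs _)).
  apply: (le_trans (le_abse_integral mu measurableT _)).
    by case/integrableP : ihk.
  apply: ge0_le_integral => //.
  - by case/integrableP : ihk => ? _; exact: measurableT_comp.
  - by apply: emeasurable_funD; apply: emeasurable_funM => //; exact: measurable_cst.
  - by move=> x _; rewrite -!EFinM -EFinD lee_fin; exact: normr_rdot_le.
have n1 (x : borel K) : setT x -> (0 <= (a / 2)%:E * (enorm ((u : K -> V) x) ^+ 2)%:E)%E.
  by move=> _; rewrite lee_fin mulr_ge0 ?sqr_ge0.
have n2 (x : borel K) : setT x ->
    (0 <= (a^-1 / 2)%:E * (enorm ((h n : K -> V) x - k x) ^+ 2)%:E)%E.
  by move=> _; rewrite lee_fin mulr_ge0 ?sqr_ge0.
rewrite ge0_integralD//; last 2 first.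
- by apply: emeasurable_funM => //; exact: measurable_cst.
- by apply: emeasurable_funM => //; exact: measurable_cst.
rewrite !ge0_integralZl_EFin//; last 2 first.
- by move=> x _; rewrite lee_fin sqr_ge0.
- by move=> x _; rewrite lee_fin sqr_ge0.
rewrite -mean_squareE EFinD; apply: leeD; first by rewrite EFinM.
by rewrite [leRHS]EFinM lee_wpmul2l// lee_fin.
Qed.

End minimizer.

Hypothesis u_perp : forall w, fixed_points_L2 mu gam w ->
  L2_inner mu (u : K -> V) w = 0.

(** Since <u, h n> tends to 0, the mean square of (1 - r) h n + r u is
    close to (1 - r)^2 D + r^2 Q, where D is the minimum and Q the mean square of
    u.  It is at least D, so D (2 - r) <= r Q, and r tends to 0. *)
Lemma level_min_eq0 : level_min = 0.
Proof.
have [h hA] := level_seq.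
have h_cauchy n m : (n <= m)%N -> qn (h n - h m) <= 4 ^- n.
  move=> nm; have [An hn] := hA n; have [Am hm] := hA m.
  have -> : 4 ^- n = 4 * (4 ^- n / 4) :> R by field; rewrite expf_neq0.
  apply: level_set_near => //; apply: (le_trans hm).
  rewrite lerD2l ler_wpM2r// lef_pV2 ?posrE ?exprn_gt0//.
  by rewrite ler_weXn2l// ler1n.
have [k [mk hk]] := mean_square_limit h_cauchy.
set C := N%:R * 2 in hk.
have C0 : 0 <= C by rewrite mulr_ge0.
have D0 := level_min_ge0.
set Q := qn u; have Q0 : 0 <= Q by exact: mean_square_ge0.
apply/eqP; rewrite eq_le D0 andbT.
(* convex combinations of u and h n stay on the level set *)
have key (r e : R) : 0 < r -> r < 1 -> 0 < e ->
    level_min <= (1 - r) ^+ 2 * (level_min + e) + 2 * r * (1 - r) * e + r ^+ 2 * Q.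
  move=> r0 r1 e0.
  (* this weight makes the term a * Q of the bound on the inner product at most e *)
  pose a := e / (Q + 1).
  have Q1 : 0 < Q + 1 by lra.
  have a0 : 0 < a by exact: divr_gt0.
  have aQ : a * Q <= e.
    by rewrite /a mulrAC ler_pdivrMr// ler_wpM2l ?(ltW e0)//; lra.
  have [n ltn] := geometric_small (4^-1 + a^-1 * C) e0.
  have p4 : 0 < 4 ^- n :> R by rewrite invr_gt0 exprn_gt0.
  have aV : 0 < a^-1 by rewrite invr_gt0.
  have aC : 0 <= a^-1 * C * 4 ^- n by rewrite !mulr_ge0 ?(ltW aV) ?(ltW p4).
  rewrite mulrDl in ltn.
  have [An hn] := hA n.
  have dn : qn (h n) <= level_min + e by lra.
  have sn : mean_dot mu u (h n) <= e.
    have := mean_dot_minimizer_le hA mk hk u_perp n a0.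
    rewrite -/Q -/C; lra.
  have r1' : r + (1 - r) = 1 by ring.
  have := level_min_lb (level_set_comb r1' (erefl : level_set u) An).
  rewrite mean_square_comb -/Q => /le_trans; apply.
  have s1 : 2 * r * (1 - r) * mean_dot mu u (h n) <= 2 * r * (1 - r) * e.
    by rewrite ler_wpM2l// !mulr_ge0//; lra.
  have s2 : (1 - r) ^+ 2 * qn (h n) <= (1 - r) ^+ 2 * (level_min + e).
    by rewrite ler_wpM2l// sqr_ge0.
  lra.
have key2 (r : R) : 0 < r -> r < 1 -> level_min <= (1 - r) ^+ 2 * level_min + r ^+ 2 * Q.
  move=> r0 r1; apply: (@le_of_eps_mul _ _ _ ((1 - r) ^+ 2 + 2 * r * (1 - r))).
    by rewrite addr_ge0 ?sqr_ge0// !mulr_ge0//; lra.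
  by move=> e e0; apply: le_trans (key r e r0 r1 e0) _; lra.
have key3 (r : R) : 0 < r -> r < 1 -> 2 * level_min <= r * (level_min + Q).
  move=> r0 r1; have := key2 r r0 r1.
  rewrite -(ler_pM2l r0 (2 * level_min)); lra.
suff : 2 * level_min <= 0 by lra.
apply: (@le_of_eps_mul _ _ _ (level_min + Q)); first exact: addr_ge0.
move=> e e0; rewrite add0r; have [e1|e1] := ltP e 1; first exact: key3.
apply: le_trans (key3 (2^-1) _ _) _; [by rewrite invr_gt0|by lra|].
by rewrite ler_wpM2r ?addr_ge0//; lra.
Qed.

(** L u = L h for elements h of the hyperplane of arbitrarily small mean
    square, and L h is controlled by the mean of |h|. *)
Lemma invariant_functional_le0 (c : R) : 0 <= c ->
  (forall h : CKN R K N,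
    ((L h)%:E <= c%:E * \int[mu]_x (enorm ((h : K -> V) x))%:E)%E) ->
  L u <= 0.
Proof.
move=> c0 Lle; apply: (@le_of_eps_mul _ _ _ c c0) => e e0; rewrite add0r.
have e20 : 0 < e ^+ 2 by rewrite exprn_gt0.
have [_ [h Ah <-]] := inf_adherent e20 level_min_has_inf.
rewrite -/level_min level_min_eq0 add0r => qh.
rewrite -Ah -lee_fin; apply: (le_trans (Lle h)); rewrite mulrC EFinM.
apply: lee_wpmul2l => //.
have mn : measurable_fun setT (fun x : borel K => enorm ((h : K -> V) x)).
  by apply: continuous_measurable_borel; exact: enorm_continuous.
have eV : 0 < e^-1 by rewrite invr_gt0.
have := integral_normr_le_sqr mu eV mn.
under eq_integral do rewrite ger0_norm ?enorm_ge0//.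
move=> /le_trans; apply; rewrite -mean_squareE -EFinM -EFinD lee_fin invrK.
have : e^-1 / 2 * qn h <= e^-1 / 2 * e ^+ 2.
  by rewrite ler_wpM2l ?(ltW qh)// divr_ge0// ltW.
have -> : e^-1 / 2 * e ^+ 2 = e / 2 by field; rewrite gt_eqF.
by lra.
Qed.

End hilbert_argument.

(** * Limits of functionals along an ultrafilter *)

Section ultralimits.
Context (R : realType) (A : Type) (U : set_system A).
Hypothesis UU : UltraFilter U.

(** The limit is the supremum of the t that are eventually lower bounds; an
    ultrafilter decides every threshold. *)
Lemma real_ultralimit (z : A -> R) (M : R) : (forall a, `|z a| <= M) ->
  exists l, forall e, 0 < e -> U [set a | `|z a - l| < e].
Proof.
move=> zM; pose B := [set t | U [set a | t <= z a]].
have B0 : B (- M).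
  by apply: filterS filterT => a _ /=; have := zM a; rewrite ler_norml => /andP[].
have BM : ubound B M.
  move=> t Ut; have /filter_ex[a /= ta] := Ut.
  by apply: le_trans ta _; apply: le_trans (ler_norm _) (zM a).
have supB : has_sup B by split; [exists (- M)|exists M].
exists (sup B) => e e0.
have [t Bt ltt] := sup_adherent e0 supB.
(* l + e / 2 is not an eventual lower bound, hence an eventual upper bound *)
have nB : ~ B (sup B + e / 2).
  by move=> /(sup_upper_bound supB) h; lra.
have [//|nU] := in_ultra_setVsetC [set a | sup B + e / 2 <= z a] UU.
apply: filterS2 Bt nU => a /= ta /negP; rewrite -ltNge => az.
by rewrite ltr_norml; apply/andP; split; lra.
Qed.

Lemma complex_ultralimit (z : A -> R[i]) (M : R) : (forall a, rnorm (z a) <= M) ->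
  exists l, forall e, 0 < e -> U [set a | rnorm (z a - l) < e].
Proof.
move=> zM.
have [r Hr] := real_ultralimit (fun a => le_trans (Re_le_rnorm _) (zM a)).
have [s Hs] := real_ultralimit (fun a => le_trans (Im_le_rnorm _) (zM a)).
exists (r +i* s) => e e0; have e20 : 0 < e / 2 by lra.
apply: filterS2 (Hr _ e20) (Hs _ e20) => a /= h1 h2.
have -> : z a - (r +i* s) =
    (complex.Re (z a) - r)%:C + (complex.Im (z a) - s)%:C * (0 +i* 1).
  by case: (z a) => x y; apply/eqP; rewrite eq_complex/=; apply/andP; split; apply/eqP; ring.
apply: (le_lt_trans (rnormD _ _)); rewrite rnormM !rnorm_real_complex.
have -> : rnorm (0 +i* 1 : R[i]) = 1.
  by rewrite /rnorm normc_def/= expr0n/= expr1n add0r sqrtr1.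
lra.
Qed.

Lemma ultralimit_functional (X : normedModType R[i]) (l : A -> X -> R[i]) (M : R) :
  (forall a (c : R[i]) x y, l a (c *: x + y) = c * l a x + l a y) ->
  (forall a x, rnorm (l a x) <= M * rnorm x) ->
  exists lam : X -> R[i],
  [/\ forall (c : R[i]) x y, lam (c *: x + y) = c * lam x + lam y,
      forall x, rnorm (lam x) <= M * rnorm x
    & forall x e, 0 < e -> U [set a | rnorm (l a x - lam x) < e]].
Proof.
move=> llin lM.
have ex x : exists v, forall e, 0 < e -> U [set a | rnorm (l a x - v) < e].
  exact: (complex_ultralimit (fun a => lM a x)).
have [lam Hlam] := choice ex.
exists lam; split => //.
- move=> c x y; apply/eqP; rewrite -subr_eq0; apply/eqP/rnorm_small_eq0 => e e0.
  pose d := e / (rnorm c + 2).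
  have c2 : 0 < rnorm c + 2 by have := rnorm_ge0 c; lra.
  have d0 : 0 < d by exact: divr_gt0.
  have /filter_ex[a /= [h1 h2 h3]] : U [set a |
      [/\ rnorm (l a (c *: x + y) - lam (c *: x + y)) < d,
      rnorm (l a x - lam x) < d & rnorm (l a y - lam y) < d]].
    apply: filterS (filterI (Hlam (c *: x + y) _ d0)
      (filterI (Hlam x _ d0) (Hlam y _ d0))).
    by move=> a [? [? ?]]; split.
  have -> : lam (c *: x + y) - (c * lam x + lam y) =
      (-1) * (l a (c *: x + y) - lam (c *: x + y)) +
      (c * (l a x - lam x) + (l a y - lam y)).
    by rewrite llin; ring.
  apply: (le_trans (rnormD _ _)); rewrite rnormM.
  have -> : rnorm (-1 : R[i]) = 1 by rewrite /rnorm normrN1.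
  rewrite mul1r; have := rnormD (c * (l a x - lam x)) (l a y - lam y).
  rewrite rnormM.
  have : rnorm c * rnorm (l a x - lam x) <= rnorm c * d.
    by rewrite ler_wpM2l ?rnorm_ge0// ltW.
  have : d * (rnorm c + 2) = e by rewrite /d divfK// gt_eqF.
  lra.
- move=> x; apply/ler_addgt0Pr => e e0.
  have /filter_ex[a /= h] := Hlam x e e0.
  have -> : lam x = l a x + (-1) * (l a x - lam x) by ring.
  apply: (le_trans (rnormD _ _)); rewrite rnormM.
  have -> : rnorm (-1 : R[i]) = 1 by rewrite /rnorm normrN1.
  by rewrite mul1r; apply: lerD (lM a x) (ltW h).
Qed.

End ultralimits.

Section tails_filter.
Context (A : Type) (le : A -> A -> Prop).
Hypothesis dle : directed le.

(** Ultrafilters finer than this filter pick a subnet that stays in B. *)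
Lemma frequently_filter (B : set A) : (forall a, exists2 b, le a b & B b) ->
  ProperFilter (filter_from setT (fun a => [set b | le a b /\ B b])).
Proof.
have [[a0] lexx letrans ledir] := dle => Bfreq.
apply: filter_from_proper; last by move=> a _; have [b ? ?] := Bfreq a; exists b.
apply: filter_from_filter; first by exists a0.
move=> a b _ _; have [c [ac bc]] := ledir a b; exists c => // d [cd Bd].
by split; split => //; exact: letrans cd.
Qed.

Lemma tails_filter : ProperFilter (tails le).
Proof.
have [[a0] lexx _ _] := dle.
have := @frequently_filter setT; set F := filter_from _ _; set F' := tails le.
have -> : F = F'.
  rewrite /F /F' /tails; congr (filter_from _ _); apply/funext => a.
  by apply/seteqP; split => b //= [].
by apply=> a; exists a.
Qed.

End tails_filter.

(** * Right ergodic nets and the mean ergodic projection *)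

Section ergodic_nets.
Context (R : realType) (X : normedModType R[i]).
Implicit Types x y p : X.

Definition linear_op (T : X -> X) :=
  forall (a : R[i]) x y, T (a *: x + y) = a *: T x + T y.

Section linear_op_theory.
Context (T : X -> X).
Hypothesis lT : linear_op T.

Lemma linear_op0 : T 0 = 0.
Proof. by have := lT (-1) 0 0; rewrite scaler0 addr0 scaleN1r addNr. Qed.

Lemma linear_opZ (a : R[i]) x : T (a *: x) = a *: T x.
Proof. by have := lT a x 0; rewrite !addr0 linear_op0 addr0. Qed.

Lemma linear_opD x y : T (x + y) = T x + T y.
Proof. by have := lT 1 x y; rewrite !scale1r. Qed.

Lemma linear_opB x y : T (x - y) = T x - T y.
Proof. by rewrite -scaleN1r linear_opD linear_opZ scaleN1r. Qed.

Lemma linear_op_sum n (x : 'I_n -> X) : T (\sum_j x j) = \sum_j T (x j).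
Proof.
elim: n x => [|n IH] x; first by rewrite !big_ord0 linear_op0.
by rewrite !big_ord_recr/= linear_opD IH.
Qed.

End linear_op_theory.

Context (G A : Type) (le : A -> A -> Prop).
Hypothesis dle : directed le.

(** One member of a uniform family of right ergodic nets, with the limits
    written out along the directed order; M bounds the operators S g. *)
Definition right_ergodic_net (M : R) (S : G -> X -> X) (E : A -> X -> X) :=
  [/\ 0 <= M /\ (forall g x, rnorm (S g x) <= M * rnorm x),
    forall g, linear_op (S g), forall a, linear_op (E a),
    forall a (e : R) m (x : 'I_m -> X), 0 < e ->
      exists n (g : 'I_n -> G) (c : 'I_n -> R), convex_weights c /\
        forall k, rnorm (E a (x k) - \sum_j (c j)%:C *: S (g j) (x k)) < e
  & forall g x (e : R), 0 < e -> exists a0, forall a, le a0 a ->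
      rnorm (E a x - E a (S g x)) < e].

Lemma eventually_and (P Q : A -> Prop) :
  (exists a0, forall a, le a0 a -> P a) ->
  (exists a0, forall a, le a0 a -> Q a) ->
  exists a0, forall a, le a0 a -> P a /\ Q a.
Proof.
have [_ _ letr ledir] := dle.
move=> [a Pa] [b Qb]; have [c [ac bc]] := ledir a b.
by exists c => d cd; split; [apply: Pa|apply: Qb]; apply: letr cd.
Qed.

Lemma eventually_forall n (P : 'I_n -> A -> Prop) :
  (forall j, exists a0, forall a, le a0 a -> P j a) ->
  exists a0, forall a, le a0 a -> forall j, P j a.
Proof.
elim: n P => [|n IH] P H; first by have [[a0] _ _ _] := dle; exists a0 => a _ [].
have [a0 Ha] := eventually_and (H ord_max)
  (IH (fun j => P (widen_ord (leqnSn n) j)) (fun j => H _)).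
exists a0 => a /Ha[Pm Pw] j.
case: (ltnP j n) => jn.
  by have := Pw (Ordinal jn); congr (P _ _); exact: val_inj.
suff -> : j = ord_max by [].
by apply: val_inj => /=; apply/eqP; rewrite eqn_leq jn -ltnS ltn_ord.
Qed.

Section one_net.
Context (M : R) (S : G -> X -> X) (E : A -> X -> X).
Hypothesis eE : right_ergodic_net M S E.

Lemma rnorm_comb_le n (c : 'I_n -> R) (g : 'I_n -> G) x : convex_weights c ->
  rnorm (\sum_j (c j)%:C *: S (g j) x) <= M * rnorm x.
Proof.
have [[M0 SM] _ _ _ _] := eE; move=> [c0 c1].
apply: le_trans (rnormX_sum _) _; rewrite -[leRHS]mul1r -c1 mulr_suml.
apply: ler_sum => j _; rewrite rnormXZ rnorm_real_complex ger0_norm//.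
by rewrite ler_wpM2l.
Qed.

Lemma comb_fixed n (c : 'I_n -> R) (g : 'I_n -> G) p : convex_weights c ->
  fixed_points S p -> \sum_j (c j)%:C *: S (g j) p = p.
Proof.
move=> [_ c1] fp; transitivity ((\sum_j (c j)%:C) *: p); last first.
  by rewrite -rmorph_sum c1 scale1r.
by rewrite scaler_suml; apply: eq_bigr => j _; rewrite fp.
Qed.

Lemma net_approx a e x : 0 < e ->
  exists n (g : 'I_n -> G) (c : 'I_n -> R), convex_weights c /\
    rnorm (E a x - \sum_j (c j)%:C *: S (g j) x) < e.
Proof.
have [_ _ _ Eap _] := eE; move=> e0.
have [n [g [c [cw Hc]]]] := Eap a e 1%N (fun=> x) e0.
by exists n, g, c; split => //; exact: (Hc ord0).
Qed.

(** An empty family of weights cannot sum to 1. *)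
Lemma net_inhabited : inhabited G.
Proof.
have [[a0] _ _ _] := dle; have [n [g [c [[_ c1] _]]]] := net_approx a0 0 ltr01.
case: n g c c1 => [g c|n g c _]; last exact: (inhabits (g ord0)).
by rewrite big_ord0 => /esym/eqP; rewrite oner_eq0.
Qed.

Lemma rnorm_net_le a x : rnorm (E a x) <= M * rnorm x.
Proof.
apply/ler_addgt0Pr => e e0; have [n [g [c [cw Hc]]]] := net_approx a x e0.
have := rnormXB (E a x) (\sum_j (c j)%:C *: S (g j) x) 0; rewrite !subr0.
have := rnorm_comb_le g x cw; lra.
Qed.

(** Convex combinations of the operators S g fix p. *)
Lemma net_fixed a p : fixed_points S p -> E a p = p.
Proof.
move=> fp; apply/eqP; rewrite -subr_eq0; apply/eqP/rnorm_eq0.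
apply/eqP; rewrite eq_le rnormX_ge0 andbT; apply/ler_addgt0Pr => e e0.
have [n [g [c [cw Hc]]]] := net_approx a p e0.
by rewrite add0r; move: Hc; rewrite comb_fixed// => /ltW.
Qed.

Definition net_cvg x v := forall e : R, 0 < e ->
  exists a0, forall a, le a0 a -> rnorm (E a x - v) < e.

Lemma net_cvg_orbit g x v : net_cvg x v -> net_cvg (S g x) v.
Proof.
have [_ _ _ _ Einv] := eE; move=> xv e e0; have e20 : 0 < e / 2 by lra.
have [a0 H] := eventually_and (xv _ e20) (Einv g x _ e20).
exists a0 => a /H[h1 h2]; have := rnormXB (E a (S g x)) (E a x) v.
rewrite -[rnorm (E a (S g x) - E a x)]rnormXN opprB; lra.
Qed.

Lemma net_cvgZD (b : R[i]) x y v w : net_cvg x v -> net_cvg y w ->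
  net_cvg (b *: x + y) (b *: v + w).
Proof.
have [_ _ Elin _ _] := eE; move=> xv yw e e0.
have b1 : 0 < rnorm b + 1 by have := rnorm_ge0 b; lra.
have e20 : 0 < e / 2 by lra.
have d0 : 0 < e / 2 / (rnorm b + 1) by exact: divr_gt0.
have [a0 H] := eventually_and (xv _ d0) (yw _ e20).
exists a0 => a /H[h1 h2].
have -> : E a (b *: x + y) - (b *: v + w) = b *: (E a x - v) + (E a y - w).
  by rewrite Elin scalerBr opprD addrACA.
apply: (le_lt_trans (rnormXD _ _)); rewrite rnormXZ.
have : rnorm b * rnorm (E a x - v) <= rnorm b * (e / 2 / (rnorm b + 1)).
  by rewrite ler_wpM2l ?rnorm_ge0// ltW.
have : rnorm b * (e / 2 / (rnorm b + 1)) <= e / 2.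
  by rewrite mulrA ler_pdivrMr// mulrC ler_wpM2l ?(ltW e20)//; lra.
lra.
Qed.

Lemma net_cvg0 : net_cvg 0 0.
Proof.
have [_ _ Elin _ _] := eE; have [[a0] _ _ _] := dle.
by move=> e e0; exists a0 => a _; rewrite linear_op0// subr0 rnormX0.
Qed.

Lemma net_cvg_sum n (b : 'I_n -> R[i]) (x v : 'I_n -> X) :
  (forall j, net_cvg (x j) (v j)) ->
  net_cvg (\sum_j b j *: x j) (\sum_j b j *: v j).
Proof.
elim: n b x v => [|n IH] b x v H; first by rewrite !big_ord0; exact: net_cvg0.
rewrite !big_ord_recr/= addrC [X in net_cvg _ X]addrC.
by apply: net_cvgZD => //; exact: (IH _ (fun j => x (widen_ord (leqnSn n) j))).
Qed.

Section mean_ergodic_projection.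
Context (f p : X) (lam : X -> R[i]) (C : R).
Hypothesis fp : net_cvg f p.
Hypothesis pfix : fixed_points S p.
Hypothesis lamlin : forall (c : R[i]) x y, lam (c *: x + y) = c * lam x + lam y.
Hypothesis lamC : forall x, rnorm (lam x) <= C * rnorm x.
Hypothesis lam_inv : forall g x, lam (S g x) = lam x.
Hypothesis lamf : lam f *: p = p.

Local Notation Y := (orbit_span S f).
Local Notation hull := (sot_closure Y (convex_hull S)).
Let P x := lam x *: p.

Let P_lin : linear_op P.
Proof. by move=> c x y; rewrite /P lamlin scalerDl scalerA. Qed.

Let P_le x : rnorm (P x) <= C * rnorm p * rnorm x.
Proof.
rewrite rnormXZ mulrAC; apply: ler_wpM2r; first exact: rnormX_ge0.
exact: lamC.
Qed.

Let P_inv g x : P (S g x) = P x.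
Proof. by rewrite /P lam_inv. Qed.

Let P_orbit g : P (S g f) = p.
Proof. by rewrite P_inv. Qed.

Lemma orbit_span_orbit g : Y (S g f).
Proof.
apply: subset_closure; exists 1%N, (fun=> 1), (fun=> g).
by rewrite big_ord1 scale1r.
Qed.

Lemma orbit_span_fixed (b : R[i]) : Y (b *: p).
Proof.
apply/closure_rnormP => e e0; have b1 : 0 < rnorm b + 1 by have := rnorm_ge0 b; lra.
pose d := e / (rnorm b + 1); have d0 : 0 < d by exact: divr_gt0.
have d20 : 0 < d / 2 by lra.
have [a0 H] := fp d20; have [_ lexx _ _] := dle; have h1 := H a0 (lexx a0).
have [n [g [c [cw Hc]]]] := net_approx a0 f d20.
exists (b *: \sum_j (c j)%:C *: S (g j) f).
  exists n, (fun j => b * (c j)%:C), g.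
  by rewrite scaler_sumr; apply: eq_bigr => j _; rewrite scalerA.
rewrite -scalerBr rnormXZ.
have := rnormXB p (E a0 f) (\sum_j (c j)%:C *: S (g j) f).
rewrite -[rnorm (p - E a0 f)]rnormXN opprB => h2.
have : rnorm b * rnorm (p - \sum_j (c j)%:C *: S (g j) f) <= rnorm b * d.
  by rewrite ler_wpM2l ?rnorm_ge0//; lra.
have : d * (rnorm b + 1) = e by rewrite /d divfK// gt_eqF.
lra.
Qed.

(** The limit is computed on the linear span of the orbit, where it is the
    sum of the coefficients times p; both the averages and P are bounded, so it
    extends to the closure.  P is defined by lam on all of X, so the limit only
    has to be identified, never constructed. *)
Lemma net_cvg_orbit_span y : Y y -> net_cvg y (P y).
Proof.
have [[M0 _] _ Elin _ _] := eE.
move=> /closure_rnormP Yy e e0; set D := M + C * rnorm p.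
have D0 : 0 <= D.
  by rewrite addr_ge0//; exact: le_trans (rnorm_ge0 _) (lamC p).
have e20 : 0 < e / 2 by lra.
have d0 : 0 < e / 2 / (D + 1) by apply: divr_gt0 => //; lra.
have [_ [n [b [g ->]]] yz] := Yy _ d0.
set z := \sum_j _ in yz.
have zp : net_cvg z (P z).
  have -> : P z = \sum_j b j *: p.
    rewrite /z (linear_op_sum P_lin); apply: eq_bigr => j _.
    by rewrite (linear_opZ P_lin) P_orbit.
  by apply: net_cvg_sum => j; exact: net_cvg_orbit.
have [a0 H] := zp _ e20; exists a0 => a /H h.
have h1 : rnorm (E a (y - z)) <= M * rnorm (y - z) by exact: rnorm_net_le.
have h2 := P_le (y - z).
have h3 : D * rnorm (y - z) <= e / 2.
  apply: (@le_trans _ _ (D * (e / 2 / (D + 1)))); first by rewrite ler_wpM2l// ltW.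
  by rewrite mulrA ler_pdivrMr; [rewrite mulrC ler_wpM2l ?(ltW e20)// lerDl|lra].
have -> : E a y - P y = E a (y - z) + ((E a z - P z) + - P (y - z)).
  by rewrite (linear_opB (Elin a)) (linear_opB P_lin) opprB addrA !subrKA.
have := rnormXD (E a (y - z)) ((E a z - P z) + - P (y - z)).
have := rnormXD (E a z - P z) (- P (y - z)); rewrite rnormXN.
rewrite /D mulrDl in h3; lra.
Qed.

(** On finitely many vectors P is close to one average, which is close to a
    convex combination of the operators S g. *)
Lemma sot_closure_projection : hull P.
Proof.
have [_ _ _ Eap _] := eE.
split.
  split=> [x _|b x y _ _|]; first exact: orbit_span_fixed.
    exact: P_lin.
  by exists (C * rnorm p) => x _; exact: P_le.
move=> n y e Yy e0; have e20 : 0 < e / 2 by lra.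
have [a0 H] := eventually_forall (fun k => net_cvg_orbit_span (Yy k) e20).
have [_ lexx _ _] := dle.
have [m [g [c [cw Hc]]]] := Eap a0 (e / 2) n y e20.
exists (fun x => \sum_j (c j)%:C *: S (g j) x); first by exists m, c, g.
move=> k; have := H a0 (lexx a0) k; have := Hc k.
have := rnormXB (P (y k)) (E a0 (y k)) (\sum_j (c j)%:C *: S (g j) (y k)).
rewrite -[rnorm (P (y k) - E a0 (y k))]rnormXN opprB; lra.
Qed.

Lemma zero_element_projection : zero_element Y hull P.
Proof.
split; first exact: sot_closure_projection.
move=> T [_ HT] y Yy; split.
  apply/eqP; rewrite -subr_eq0; apply/eqP/rnorm_eq0.
  apply/eqP; rewrite eq_le rnormX_ge0 andbT; apply/ler_addgt0Pr => e e0; rewrite add0r.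
  pose D := C * rnorm p + 1.
  have D0 : 0 < D by have := le_trans (rnorm_ge0 _) (lamC p); rewrite /D; lra.
  have d0 : 0 < e / D by exact: divr_gt0.
  have [_ [n [c [g [[_ c1] ->]]]] Hc] := HT 1%N (fun=> y) _ (fun=> Yy) d0.
  have {}Hc := Hc ord0; set s := \sum_j _ in Hc.
  have -> : P y = P s.
    rewrite /s (linear_op_sum P_lin); under eq_bigr do rewrite (linear_opZ P_lin) P_inv.
    by rewrite -scaler_suml -rmorph_sum c1 scale1r.
  rewrite -(linear_opB P_lin); apply: (le_trans (P_le _)).
  apply: (@le_trans _ _ (D * rnorm (T y - s))).
    by rewrite ler_wpM2r ?rnormX_ge0//; rewrite /D; lra.
  by rewrite mulrC -ler_pdivlMr// ltW.
apply/eqP; rewrite -subr_eq0; apply/eqP/rnorm_eq0.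
apply/eqP; rewrite eq_le rnormX_ge0 andbT; apply/ler_addgt0Pr => e e0; rewrite add0r.
have [_ [n [c [g [cw ->]]]] Hc] := HT 1%N (fun=> P y) e (fun=> @orbit_span_fixed (lam y)) e0.
have {Hc} := Hc ord0; rewrite comb_fixed//; first exact: ltW.
have [_ Slin _ _ _] := eE.
by move=> g'; rewrite /P (linear_opZ (Slin g')) pfix.
Qed.

(** Two zero elements agree on the orbit span, since each absorbs the
    other. *)
Lemma mean_ergodic_valueE : mean_ergodic_value S f = p.
Proof.
have zP := zero_element_projection.
apply: xget_unique.
  exists P; split=> [//|_|_ g]; [by rewrite /P lamf|by rewrite P_orbit].
move=> v [P' [zP' vY vnY]].
have PP' y : Y y -> P' y = P y.
  move=> Yy; have [<- _] := zP'.2 P zP.1 y Yy.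
  by have [_] := zP.2 P' zP'.1 y Yy.
have [Yf|nYf] := pselect (Y f); first by rewrite vY// PP'// /P lamf.
have [g] := net_inhabited; rewrite (vnY nYf g) PP' ?P_orbit//; exact: orbit_span_orbit.
Qed.

End mean_ergodic_projection.

End one_net.

End ergodic_nets.

(** * Uniform convergence over a compact family *)

Section uniform_convergence.
Context (R : realType) (X : normedModType R[i]) (G A : Type).
Context (le : A -> A -> Prop).
Hypothesis dle : directed le.

Lemma usup_lt (I : Type) (D : set I) (F : I -> R) (e : R) i :
  (usup D F < e%:E)%E -> D i -> F i < e.
Proof.
move=> lt Di; rewrite -lte_fin; apply: le_lt_trans lt.
by apply: ereal_sup_ubound; right; exists i.
Qed.

Lemma usup_le (I : Type) (D : set I) (F : I -> R) (e : R) : 0 <= e ->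
  (forall i, D i -> F i <= e) -> (usup D F <= e%:E)%E.
Proof.
move=> e0 H; apply: ge_ereal_sup => _ [->|[i Di <-]]; rewrite lee_fin//.
exact: H.
Qed.

Lemma usup_ge0 (I : Type) (D : set I) (F : I -> R) : (0 <= usup D F)%E.
Proof. by apply: ereal_sup_ubound; left. Qed.

(** Suprema may be infinite, so convergence to 0 is restated through
    thresholds. *)
Lemma usup_cvg0 (I : Type) (D : set I) (F : A -> I -> R) :
  usup D (F a) @[a --> tails le] --> 0%E <->
  forall e, 0 < e -> exists a0, forall a, le a0 a -> (usup D (F a) < e%:E)%E.
Proof.
split=> [H e e0|H].
  have W : nbhs (0%E : \bar R) [set y | (y < e%:E)%E].
    have : \forall r \near (0 : R), r < e by exact: lt_nbhsl.
    by apply: filterS => r; rewrite /= lte_fin.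
  by have [a0 _ Ha] := H _ W; exists a0 => a; exact: Ha.
move=> W [e /= e0 eW]; have [a0 Ha] := H e e0; exists a0 => // a /Ha lt /=.
have ge0 := usup_ge0 D (F a).
move: lt ge0; case: (usup D (F a)) => [r|//|//]; rewrite lte_fin lee_fin => re r0.
by apply: eW; rewrite /ball/= sub0r normrN ger0_norm.
Qed.

Context (I : topologicalType) (D : set I) (S : I -> G -> X -> X).
Context (E : I -> A -> X -> X).
Hypothesis uE : uniform_right_ergodic D le S E.
Hypothesis S_lin : forall i g, D i -> linear_op (S i g).

Lemma uniform_right_ergodic_net : exists M : R, forall i, D i ->
  right_ergodic_net le M (S i) (E i).
Proof.
have [[M HM] Eop Eap Einv] := uE; exists (Num.max M 0) => i Di; split.
- split=> [|g x]; first by rewrite le_max lexx orbT.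
  apply: (le_trans (HM i g x Di)); rewrite ler_wpM2r ?rnormX_ge0//.
  by rewrite le_max lexx.
- by move=> g; exact: S_lin.
- by move=> a b x y; have [_ + _] := Eop i a Di; exact.
- move=> a e m x e0; have [n [g [c [cw Hc]]]] := Eap a e m x e0.
  by exists n, g, (c i); split => [|k]; [exact: cw|exact: usup_lt (Hc k) Di].
- move=> g x e e0; have [a0 Ha] := (usup_cvg0 _ _).1 (Einv g x) e e0.
  by exists a0 => a aa; exact: usup_lt (Ha a aa) Di.
Qed.

(** The estimate near a point i of D compares E_a f with E_a s, where s is
    the convex combination approximating one good average E_b f: the index b and
    the elements g_j are chosen at i, while the weights follow the nearby
    point j. *)
Lemma uniform_net_convergence (f : X) (v : I -> X) : compact D ->
  (forall i, D i -> fixed_points (S i) (v i)) ->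
  (forall i, D i -> net_cvg le (E i) f (v i)) ->
  (forall a, {within D, continuous (fun i => rnorm (E i a f - v i))}) ->
  usup D (fun i => rnorm (E i a f - v i)) @[a --> tails le] --> 0%E.
Proof.
move=> cD vfix fv cont; apply/usup_cvg0 => e e0.
have [M HM] := uniform_right_ergodic_net.
have Ft := tails_filter dle.
pose d := e / 2 / (1 + 2 * `|M|).
have M2 : 0 < 1 + 2 * `|M| by have := normr_ge0 M; lra.
have d0 : 0 < d by rewrite !divr_gt0.
have dE : d * (1 + 2 * `|M|) = e / 2 by rewrite /d divfK// gt_eqF.
suff : \forall a \near tails le, D `<=` [set i | rnorm (E i a f - v i) <= e / 2].
  move=> [a0 _ Ha]; exists a0 => a aa.
  apply: (@le_lt_trans _ _ (e / 2)%:E); last by rewrite lte_fin; lra.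
  by apply: usup_le; [lra|move=> i Di; exact: (Ha a aa i Di)].
suff : \forall a \near tails le,
    D `<=` [set i | D i -> rnorm (E i a f - v i) <= e / 2].
  by apply: filterS => a H i Di; exact: H.
have /compact_near_coveringP ncD := cD; apply: ncD => i Di.
have [b Hb] := fv i Di d d0.
have [_ lexx _ _] := dle.
have {Hb} Hb := Hb b (lexx b).
(* b is a good index at i, hence at all points of D near i *)
have nbi : \forall j \near i, D j -> rnorm (E j b f - v j) < d.
  have := cont b i; rewrite /continuous_at => /(_ [set y | y < d]) H.
  have : nbhs (rnorm (E i b f - v i)) [set y : R | y < d] by exact: lt_nbhsl.
  by move=> /H; rewrite /nbhs/= -(nbhs_subspace_in Di).
have [_ _ Eap Einv] := uE.
have [n [g [c [cw Hc]]]] := Eap b d 1%N (fun=> f) d0.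
have {}Hc := Hc ord0.
have Hg j : exists a0, forall a, le a0 a ->
    (usup D (fun i => rnorm (E i a f - E i a (S i (g j) f))%R) < d%:E)%E.
  exact: (usup_cvg0 _ _).1 (Einv (g j) f) d d0.
have [a0 Ha0] := eventually_forall dle Hg.
have na : \forall a \near tails le, forall j : 'I_n,
    (usup D (fun i => rnorm (E i a f - E i a (S i (g j) f))%R) < d%:E)%E.
  by exists a0.
exists ([set j | D j -> rnorm (E j b f - v j) < d],
  [set a | forall j : 'I_n,
    (usup D (fun i => rnorm (E i a f - E i a (S i (g j) f))%R) < d%:E)%E]).
  by split.
move=> [j a] /= [jb ag] Dj.
have eEj := HM j Dj; have [[M0 _] Slin Elin _ _] := eEj.
rewrite ger0_norm// in dE M2.
set s := \sum_k (c j k)%:C *: S j (g k) f.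
have [c0 c1] := cw j Dj.
have h1 : rnorm (E j a f - E j a s) <= d.
  have -> : E j a f - E j a s =
      \sum_k (c j k)%:C *: (E j a f - E j a (S j (g k) f)).
    under [RHS]eq_bigr do rewrite scalerBr.
    rewrite sumrB -scaler_suml -rmorph_sum c1 scale1r; congr (_ - _).
    rewrite (linear_op_sum (Elin a)); apply: eq_bigr => k _.
    exact: (linear_opZ (Elin a)).
  apply: le_trans (rnormX_sum _) _; rewrite -[leRHS]mul1r -c1 mulr_suml.
  apply: ler_sum => k _; rewrite rnormXZ rnorm_real_complex ger0_norm//.
  by rewrite ler_wpM2l// ltW//; exact: usup_lt (ag k) Dj.
have h2 : rnorm (E j a (s - E j b f)) <= M * d.
  apply: le_trans (rnorm_net_le eEj _ _) _; rewrite ler_wpM2l//.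
  rewrite -rnormXN opprB ltW//; exact: usup_lt Hc Dj.
have h3 : rnorm (E j a (E j b f - v j)) <= M * d.
  apply: le_trans (rnorm_net_le eEj _ _) _; rewrite ler_wpM2l// ltW//.
  exact: jb.
have -> : E j a f - v j = (E j a f - E j a s) + (E j a (s - E j b f) +
    E j a (E j b f - v j)).
  by rewrite !(linear_opB (Elin a)) (net_fixed eEj a (vfix j Dj)) addrA !subrKA.
have := rnormXD (E j a f - E j a s) (E j a (s - E j b f) + E j a (E j b f - v j)).
have := rnormXD (E j a (s - E j b f)) (E j a (E j b f - v j)).
lra.
Qed.

End uniform_convergence.

(** * Ergodic nets of twisted Koopman operators *)

Section cocycle_ergodic_nets.
Context (R : realType) (G : semitopSemigroupType) (K : compactHausdorffType).
Context (N : nat) (phi : action G K) (A : Type) (le : A -> A -> Prop).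
Local Notation V := 'cV[R[i]]_N.
Implicit Types (h u p : CKN R K N) (gam : cocycle R N phi).
Hypothesis dle : directed le.

Definition cdot (v w : V) : R[i] := \sum_i v i ord0 * (w i ord0)^*.

Lemma rnorm_cdot_le v w : rnorm (cdot v w) <= enorm v * enorm w.
Proof.
have h : rnorm (cdot v w) <= \sum_i rnorm (v i ord0) * rnorm (w i ord0).
  apply: le_trans (rnormX_sum _) _; apply: ler_sum => i _.
  by rewrite [leLHS]rnormM rnorm_conj.
apply: (le_trans h); set s := \sum_i _.
have s0 : 0 <= s by apply: sumr_ge0 => i _; rewrite mulr_ge0 ?rnorm_ge0.
rewrite -[leLHS]ger0_norm// -sqrtr_sqr /enorm -sqrtrM ?sum_sqr_ge0//.
by apply: ler_wsqrtr; exact: sum_CS.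
Qed.

Lemma cdot_linear (c : R[i]) v v' w :
  cdot (c *: v + v') w = c * cdot v w + cdot v' w.
Proof.
rewrite /cdot mulr_sumr -big_split/=; apply: eq_bigr => i _.
by rewrite !mxE mulrDl mulrA.
Qed.

Lemma cdot_self (a : R) v : cdot v (a%:C *: v) = (a * enorm v ^+ 2)%:C.
Proof.
rewrite enorm_sqr_ReIm /cdot mulr_sumr rmorph_sum; apply: eq_bigr => i _.
rewrite mxE; case: (v i ord0) => x y; apply/eqP; rewrite eq_complex/=.
by apply/andP; split; apply/eqP; ring.
Qed.

Lemma twisted_koopman_linear gam g : linear_op (twisted_koopman gam g).
Proof.
move=> c h k; apply: CKN_eq => x.
transitivity (gam g x *m (c *: (h : K -> V) (phi g x) + (k : K -> V) (phi g x))) => //.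
by rewrite mulmxDr -scalemxAr.
Qed.

Lemma rnorm_supnorm h : rnorm h = supnorm h.
Proof. by []. Qed.

Lemma supnorm_twisted gam g h :
  supnorm (twisted_koopman gam g h) <= supnorm h.
Proof.
apply: supnorm_le => x; rewrite [leLHS]enorm_unitary; last exact: cocycle_unitary.
exact: supnorm_ub.
Qed.

(** The functional is invariant because E_a (S_g h) - E_a h tends to 0 along
    the net.  The points x_a and vectors w_a are arbitrary: they are norming pairs
    in [perp_net_cvg0] and constant in [twisted_mean_ergodic_value]. *)
Lemma net_functional gam (E : A -> CKN R K N -> CKN R K N) (M C : R)
    (U : set_system A) (x : A -> K) (w : A -> V) :
  right_ergodic_net le M (twisted_koopman gam) E ->
  UltraFilter U -> tails le `<=` U -> (forall a, enorm (w a) <= C) -> 0 <= C ->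
  exists lam : CKN R K N -> R[i],
  [/\ forall (c : R[i]) h k, lam (c *: h + k) = c * lam h + lam k,
      forall h, rnorm (lam h) <= C * supnorm h,
      forall g h, lam (twisted_koopman gam g h) = lam h
    & forall h e, 0 < e ->
        U [set a | rnorm (cdot ((E a h : K -> V) (x a)) (w a) - lam h) < e]].
Proof.
move=> [_ Slin Elin Eap Einv] UU tU wC C0.
(* unitary values make the twisted operators contractions *)
have eE : right_ergodic_net le 1 (twisted_koopman gam) E.
  split => //; split => [|g h]; first exact: ler01.
  by rewrite mul1r; exact: supnorm_twisted.
have El a h : supnorm (E a h) <= supnorm h.
  by have := rnorm_net_le eE a h; rewrite mul1r.
have lC (h : CKN R K N) y a : rnorm (cdot ((h : K -> V) y) (w a)) <= C * supnorm h.
  apply: le_trans (rnorm_cdot_le _ _) _; rewrite mulrC.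
  by apply: ler_pM; rewrite ?enorm_ge0//; exact: supnorm_ub.
have [||lam [lamlin lamC lamU]] := @ultralimit_functional R A U UU (CKN R K N)
  (fun a h => cdot ((E a h : K -> V) (x a)) (w a)) C.
- by move=> a c h k; rewrite Elin; exact: cdot_linear.
- move=> a h; apply: le_trans (lC _ _ _) _; rewrite ler_wpM2l//; exact: El.
exists lam; split => // g h.
have lamB (k k' : CKN R K N) : lam (k - k') = lam k - lam k'.
  by rewrite -scaleN1r addrC lamlin mulN1r addrC.
apply/eqP; rewrite -subr_eq0 -lamB; apply/eqP/rnorm_small_eq0 => e e0.
have e20 : 0 < e / 2 by lra.
pose d := e / 2 / (C + 1).
have d0 : 0 < d by rewrite divr_gt0//; lra.
have dC : C * d <= e / 2.
  by rewrite /d mulrA ler_pdivrMr; [rewrite mulrC ler_wpM2l ?(ltW e20)// lerDl|lra].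
have [a0 Ha] := Einv g h d d0.
have Ud : U [set a | supnorm (E a h - E a (twisted_koopman gam g h)) < d].
  by apply: tU; exists a0 => // a; exact: Ha.
have [a [/= h1 h2]] := filter_ex (filterI Ud (lamU (twisted_koopman gam g h - h) _ e20)).
set k := twisted_koopman gam g h - h in h2 *.
have -> : lam k = cdot ((E a k : K -> V) (x a)) (w a) -
  (cdot ((E a k : K -> V) (x a)) (w a) - lam k) by rewrite subKr.
apply: le_trans (rnormXB _ 0 _) _; rewrite subr0 sub0r rnormXN.
have : rnorm (cdot ((E a k : K -> V) (x a)) (w a)) <= C * d.
  apply: le_trans (lC _ _ _) _; rewrite ler_wpM2l//.
  rewrite /k (linear_opB (Elin a)) -rnorm_supnorm -rnormXN opprB rnorm_supnorm.
  exact: ltW.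
by lra.
Qed.

Lemma norming_pair h (e : R) : 0 < e -> e <= supnorm h ->
  exists xw : K * V, enorm xw.2 <= 1 /\
    e / 2 <= complex.Re (cdot ((h : K -> V) xw.1) xw.2).
Proof.
move=> e0 eh; have e20 : 0 < e / 2 by lra.
have [_ [x _ <-] lt] := sup_adherent e20 (supnorm_has_sup h).
rewrite -/(supnorm h) in lt; set v := (h : K -> V) x in lt.
have v0 : 0 < enorm v by lra.
exists (x, ((enorm v)^-1)%:C *: v) => /=.
rewrite enormZ rnorm_real_complex ger0_norm ?invr_ge0 ?enorm_ge0// mulVf ?gt_eqF//.
split; first exact: lexx.
by rewrite -/v cdot_self/= expr2 mulKf ?gt_eqF//; lra.
Qed.

Lemma perp_net_cvg0 (mu : probability (borel K) R) gam M
    (E : A -> CKN R K N -> CKN R K N) u :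
  uniquely_ergodic phi mu ->
  right_ergodic_net le M (twisted_koopman gam) E ->
  (forall w, fixed_points_L2 mu gam w -> L2_inner mu (u : K -> V) w = 0) ->
  net_cvg le E u 0.
Proof.
move=> ue eE uperp e e0; apply: contrapT => nex.
(* failure of convergence: the averages stay large along a subnet *)
have freq a0 : exists2 a, le a0 a & [set a | e <= supnorm (E a u)] a.
  apply: contrapT => na; apply: nex; exists a0 => a aa; rewrite subr0.
  by apply: contrapT => /negP; rewrite -leNgt => ?; apply: na; exists a.
have Ff := frequently_filter dle freq.
have [U [UU FU]] := ultraFilterLemma Ff.
have tU : tails le `<=` U.
  move=> W [a0 _ aW]; apply: FU; exists a0 => // a [aa _]; exact: aW.
have Uf : U [set a | e <= supnorm (E a u)].
  by have [[a0] _ _ _] := dle; apply: FU; exists a0 => // a [].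
have exw a : exists xw : K * V, enorm xw.2 <= 1 /\ (e <= supnorm (E a u) ->
    e / 2 <= complex.Re (cdot ((E a u : K -> V) xw.1) xw.2)).
  have [ea|na] := pselect (e <= supnorm (E a u)).
    by have [xw [w1 H]] := norming_pair e0 ea; exists xw.
  by exists (point, 0); split => //=; rewrite enorm0 ler01.
have [xw Hxw] := choice exw.
have [lam [lamlin lamC lam_inv lamU]] := @net_functional gam E M 1 U
  (fun a => (xw a).1) (fun a => (xw a).2) eE UU tU (fun a => (Hxw a).1) ler01.
pose L h := complex.Re (lam h).
have lam0 : lam 0 = 0.
  by have := lamlin (-1) 0 0; rewrite scaler0 addr0 mulN1r addNr.
have bL : bounded_real_functional L.
  split=> [h k|a h|h].
  - by rewrite /L -[h]scale1r lamlin mul1r scale1r; case: (lam h); case: (lam k).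
  - rewrite /L -[_ *: h]addr0 lamlin lam0 addr0.
    by case: (lam h) => r s /=; rewrite mul0r subr0.
  - apply: le_trans (ler_norm _) _; apply: le_trans (Re_le_rnorm _) _.
    by rewrite -[leRHS]mul1r.
have L_inv g h : L (twisted_koopman gam g h) = L h by rewrite /L lam_inv.
have [c c0 Lle] := invariant_functional_le_integral ue bL L_inv.
have [_ imu _] := ue.
have Lu := invariant_functional_le0 imu bL L_inv uperp c0 Lle.
have e40 : 0 < e / 4 by lra.
have [a [/= h1 h2]] := filter_ex (filterI Uf (lamU u _ e40)).
have h3 := (Hxw a).2 h1.
have := le_lt_trans (Re_le_rnorm _) h2.
have -> : complex.Re (cdot ((E a u : K -> V) (xw a).1) (xw a).2 - lam u) =
  complex.Re (cdot ((E a u : K -> V) (xw a).1) (xw a).2) - L u.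
  by rewrite /L; case: (cdot _ _); case: (lam u).
move=> /ltr_normlW; lra.
Qed.

(** If p = 0 the zero functional serves as lam; otherwise evaluate at a
    point where p does not vanish, against p there, normalized so that
    lam f = 1. *)
Lemma twisted_mean_ergodic_value gam M (E : A -> CKN R K N -> CKN R K N) f p :
  right_ergodic_net le M (twisted_koopman gam) E ->
  fixed_points (twisted_koopman gam) p -> net_cvg le E f p ->
  mean_ergodic_value (twisted_koopman gam) f = p.
Proof.
move=> eE pfix fp; have [p0|pn0] := pselect (p = 0).
  apply: (mean_ergodic_valueE dle eE fp pfix (lam := fun=> 0) (C := 0)) => //.
  - by move=> c h k; rewrite mulr0 addr0.
  - by move=> h; rewrite mul0r /rnorm normr0.
  - by rewrite scale0r p0.
have [x0 px0] : exists x0, (p : K -> V) x0 <> 0.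
  apply: contrapT => nx; apply: pn0; apply: CKN_eq => x.
  by apply: contrapT => px; apply: nx; exists x.
set v := (p : K -> V) x0 in px0.
have v0 : 0 < enorm v.
  by rewrite lt_neqAle enorm_ge0 andbT eq_sym; apply/eqP => /enorm0_eq0.
pose w : V := ((enorm v ^+ 2)^-1)%:C *: v.
have pw : cdot v w = 1 by rewrite /w cdot_self mulVf// expf_neq0// gt_eqF.
have [U [UU FU]] := ultraFilterLemma (tails_filter dle).
have [lam [lamlin lamC lam_inv lamU]] := @net_functional gam E M (enorm w) U
  (fun=> x0) (fun=> w) eE UU FU (fun=> lexx _) (enorm_ge0 _).
apply: (mean_ergodic_valueE dle eE fp pfix lamlin lamC lam_inv).
suff -> : lam f = 1 by rewrite scale1r.
apply/eqP; rewrite -subr_eq0; apply/eqP/rnorm_small_eq0 => e e0.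
have e20 : 0 < e / 2 by lra.
pose d := e / 2 / (enorm w + 1).
have w1 : 0 < enorm w + 1 by have := enorm_ge0 w; lra.
have d0 : 0 < d by rewrite divr_gt0.
have [a0 Ha] := fp d d0.
have Ud : U [set a | supnorm (E a f - p) < d] by apply: FU; exists a0 => // a; exact: Ha.
have [a [/= h1 h2]] := filter_ex (filterI Ud (lamU f _ e20)).
have h3 : rnorm (cdot ((E a f : K -> V) x0) w - 1) <= e / 2.
  rewrite -pw; have -> : cdot ((E a f : K -> V) x0) w - cdot v w =
      cdot (((E a f - p : CKN R K N) : K -> V) x0) w.
    by rewrite CKN_subE -/v addrC -mulN1r -cdot_linear scaleN1r addrC.
  apply: le_trans (rnorm_cdot_le _ _) _.
  apply: (@le_trans _ _ (d * enorm w)).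
    rewrite ler_wpM2r ?enorm_ge0//; apply: le_trans (ltW h1); exact: supnorm_ub.
  by rewrite /d mulrAC ler_pdivrMr// ler_wpM2l ?(ltW e20)// lerDl.
have := rnormXB (lam f) (cdot ((E a f : K -> V) x0) w) 1.
rewrite -[rnorm (lam f - cdot _ _)]rnormXN opprB; lra.
Qed.

End cocycle_ergodic_nets.

Theorem corollary2p11 (R : realType) (G : semitopSemigroupType)
    (K : compactHausdorffType) (N : nat) (phi : action G K)
    (mu : probability (borel K) R) (Z : set 'M[R[i]]_N)
    (Lambda : set (cocycle R N phi)) (A : Type) (le : A -> A -> Prop)
    (E : cocycle R N phi -> A -> CKN R K N -> CKN R K N) (f : CKN R K N) :
  right_amenable R G ->
  uniquely_ergodic phi mu ->
  unitary_subgroup Z -> compact Z ->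
  Lambda `<=` cocycles_in Z -> compact Lambda ->
  directed le ->
  uniform_right_ergodic Lambda le
    (fun gam => twisted_koopman gam) E ->
  (forall gam, Lambda gam -> exists p : CKN R K N,
    fixed_points (twisted_koopman gam) p /\
    is_orthogonal_projection mu (fixed_points_L2 mu gam) f p) ->
  (forall a : A, {within Lambda, continuous (fun gam =>
    rnorm (E gam a f - mean_ergodic_value (twisted_koopman gam) f))}) ->
  usup Lambda (fun gam =>
    rnorm (E gam a f - mean_ergodic_value (twisted_koopman gam) f))
    @[a --> tails le] --> 0%E.
Proof.
move=> _ ue _ _ _ cLambda dle uE proj cont.
have Slin gam g : Lambda gam -> linear_op (twisted_koopman gam g).
  by move=> _; exact: twisted_koopman_linear.
have [M eE] := uniform_right_ergodic_net uE Slin.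
have lim gam : Lambda gam -> fixed_points (twisted_koopman gam)
      (mean_ergodic_value (twisted_koopman gam) f) /\
    net_cvg le (E gam) f (mean_ergodic_value (twisted_koopman gam) f).
  move=> Lgam; have [p [pfix [_ perp]]] := proj gam Lgam.
  have eEg := eE gam Lgam.
  have fp : net_cvg le (E gam) f p.
    have up : net_cvg le (E gam) (f - p) 0.
      apply: (perp_net_cvg0 dle ue eEg) => w /perp.
      by congr (L2_inner mu _ w = 0); apply/funext => x; rewrite CKN_subE.
    have [_ _ Elin _ _] := eEg.
    move=> e e0; have [a0 Ha] := up e e0; exists a0 => a /Ha.
    by rewrite (linear_opB (Elin a)) (net_fixed eEg a pfix) subr0.
  by rewrite (twisted_mean_ergodic_value dle eEg pfix fp).
by apply: (uniform_net_convergence dle uE Slin cLambda) => // gam /lim[].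
Qed.
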